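(* For any noise schedule $\beta$, $$\mathrm{KL}(p_T\|\pi_\infty)\le\mathrm{KL}(\pi_{\rm data}\|\pi_\infty)\exp\left(-\frac1{\sigma^2}\int_0^T\beta(s)\,ds\right).$$
   Context: Fix $d\ge1$, $\sigma>0$, $T>0$. $\pi_\infty=\mathcal N(0,\sigma^2I_d)$. $\pi_{\rm data}$ is a probability measure on $\mathbb R^d$ absolutely continuous with respect to $\pi_\infty$. A noise schedule is a continuous, positive, non-decreasing function $\beta:[0,T]\to(0,\infty)$. $p_t$ is the density of $\overrightarrow X_t$, where $d\overrightarrow X_t=-\frac{\beta(t)}{2\sigma^2}\overrightarrow X_t\,dt+\sqrt{\beta(t)}\,dB_t$, $\overrightarrow X_0\sim\pi_{\rm data}$, with $B$ a standard Brownian motion in $\mathbb R^d$. KL is the Kullback-Leibler divergence $\mathrm{KL}(\mu\|\nu)=\int\log\frac{d\mu}{d\nu}\,d\mu$. *)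

(* Defs.v *)
From HB Require Import structures.
From mathcomp Require Import all_boot all_order all_algebra.
From mathcomp Require Import all_classical all_reals all_analysis.

Set Implicit Arguments.
Unset Strict Implicit.
Unset Printing Implicit Defensive.

Import Order.TTheory GRing.Theory Num.Theory.
Import numFieldNormedType.Exports.

Local Open Scope classical_set_scope.
Local Open Scope ring_scope.
Local Open Scope charge_scope.

(** R^n is [n.-tuple R] with the sigma-algebra generated by the coordinates. *)

Definition cons_pair (R : realType) (n : nat) (x : measurableTypeR R * n.-tuple R) :
  n.+1.-tuple R := [tuple of (x.1 : R) :: x.2].

Lemma measurable_cons_pair (R : realType) (n : nat) :
  measurable_fun [set: measurableTypeR R * n.-tuple R] (@cons_pair R n).
Proof. exact: (@measurable_cons _ _ _ R). Qed.

HB.instance Definition _ (R : realType) (n : nat) :=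
  isMeasurableFun.Build _ _ _ _ (@cons_pair R n) (@measurable_cons_pair R n).

(** The Gaussian measure N(0, s^2 I_n), as the n-fold product of N(0, s^2).
    The second argument of [normal_prob] is the standard deviation; for s = 0
    it is by convention not a Dirac mass, so [gaussian] is to be used with
    s <> 0 only. *)
Fixpoint gaussian (R : realType) (s : R) (n : nat) :
    probability (n.-tuple R) R :=
  match n with
  | 0 => dirac ([tuple] : 0.-tuple R)
  | m.+1 => distribution (normal_prob 0 s \x gaussian s m)%E (@cons_pair R m)
  end.

(** The integral of log(dmu/dnu) against mu, with value +oo when mu is not
    absolutely continuous with respect to nu. *)
Definition KL (d : measure_display) (E : measurableType d) (R : realType)
    (mu nu : probability E R) : \bar R :=
  if `[< mu `<< nu >] then
    (\int[mu]_x lne ('d (charge_of_finite_measure mu) '/d nu x))%E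
  else +oo%E.

Definition independent_systems (dO : measure_display) (Omega : measurableType dO)
    (R : realType) (P : probability Omega R) (F G : set (set Omega)) : Prop :=
  forall A B, F A -> G B -> P (A `&` B) = (P A * P B)%E.

(** The sigma-algebra generated by the variables Z_u, u in J. *)
Definition process_sigma (dO : measure_display) (Omega : measurableType dO)
    (d : measure_display) (E : measurableType d) (R : realType) (J : set R)
    (Z : R -> Omega -> E) : set (set Omega) :=
  <<s \bigcup_(u in J) g_sigma_algebra_preimage (Z u) >>.

Definition increment (Omega : Type) (R : realType) (n : nat)
    (Z : R -> Omega -> n.-tuple R) (s t : R) (w : Omega) : n.-tuple R :=
  [tuple tnth (Z t w) i - tnth (Z s w) i | i < n].

(** Only the times t >= 0 are constrained. *)
Record standard_brownian_motion (dO : measure_display)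
    (Omega : measurableType dO) (R : realType) (P : probability Omega R)
    (n : nat) (B : R -> {RV P >-> n.-tuple R}) : Prop := {
  brownian_start : {ae P, forall w, forall i, tnth (B 0 w) i = 0};
  brownian_continuous : {ae P, forall w, forall i,
    {within `[0, +oo[, continuous (fun t => tnth (B t w) i)}};
  brownian_gaussian : forall s t, 0 <= s -> s < t ->
    forall A, measurable A ->
    P (increment B s t @^-1` A) = gaussian (Num.sqrt (t - s)) n A;
  brownian_independent : forall s t, 0 <= s -> s < t ->
    independent_systems P (g_sigma_algebra_preimage (increment B s t))
      (process_sigma `[0, s] B) }.

(** The step function equal to c_k on ]u_k, u_(k+1)] for k < N, and its
    integral against the path of W. *)
Definition step_fun (R : realType) (N : nat) (u c : nat -> R) (s : R) : R :=
  \sum_(k < N) c k * \1_(`]u k, u k.+1] : set R) s.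

Definition step_integral (Omega : Type) (R : realType) (N : nat)
    (u c : nat -> R) (W : R -> Omega -> R) (w : Omega) : R :=
  \sum_(k < N) c k * (W (u k.+1) w - W (u k) w).

(** I is (a version of) the Ito integral of the deterministic integrand g
    against W over [0, t]: the L^2(P)-limit of the integrals of step functions
    that converge to g in L^2([0, t]). By the Ito isometry the limit does not
    depend on the approximating step functions. *)
Definition is_ito_integral (dO : measure_display) (Omega : measurableType dO)
    (R : realType) (P : probability Omega R) (W : R -> Omega -> R) (g : R -> R)
    (t : R) (I : Omega -> R) : Prop :=
  exists (N : nat -> nat) (u c : nat -> nat -> R),
  [/\ forall j, [/\ u j 0%N = 0, u j (N j) = t & nondecreasing_seq (u j)],
      (\int[lebesgue_measure]_(s in `[0%R, t])
         ((g s - step_fun (N j) (u j) (c j) s) ^+ 2)%:E)%E @[j --> \oo] --> 0%E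
    & 'E_P[(fun w => (step_integral (N j) (u j) (c j) W w - I w) ^+ 2)%R]%E
        @[j --> \oo] --> 0%E].

Record noise_schedule (R : realType) (T : R) (beta : R -> R) : Prop := {
  schedule_continuous : {within `[0, T], continuous beta};
  schedule_positive : forall t, t \in `[0, T] -> 0 < beta t;
  schedule_nondecreasing : {in `[0, T] &, {homo beta : s t / s <= t}} }.

(** X is a continuous solution on [0, T], driven by B, of
    dX_t = - beta(t) / (2 sigma^2) X_t dt + sqrt(beta(t)) dB_t,
    read coordinatewise in integral form. *)
Record forward_sde (dO : measure_display) (Omega : measurableType dO)
    (R : realType) (P : probability Omega R) (n : nat) (sigma T : R)
    (beta : R -> R) (B X : R -> {RV P >-> n.-tuple R}) : Prop := {
  sde_continuous : {ae P, forall w, forall i,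
    {within `[0, T], continuous (fun t => tnth (X t w) i)}};
  sde_equation : forall t, t \in `[0, T] -> forall i,
    exists2 I : {RV P >-> R},
      is_ito_integral P (fun s w => tnth (B s w) i)
        (fun s => Num.sqrt (beta s)) t I
    & {ae P, forall w, tnth (X t w) i = tnth (X 0 w) i
        + \int[lebesgue_measure]_(s in `[0, t])
            (- (beta s / (2 * sigma ^+ 2)) * tnth (X s w) i)
        + I w} }.

(* Main.v *)
From HB Require Import structures.
Require Import Defs.
From mathcomp Require Import all_boot all_order all_algebra.
From mathcomp Require Import all_classical all_reals all_analysis measurable_realfun.
From mathcomp Require Import ring lra.

(** The forward process is an Ornstein-Uhlenbeck process run at variable speed. With
    a = exp (- \int_0^T beta / (2 sigma^2)) and b = sqrt (1 - a^2), the law of X_T is that of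
    a X_0 + b G, for G of law N(0, sigma^2 I) independent of X_0 ([terminal_law]). So the law of
    X_T integrates phi as pi_data integrates Q phi, where Q phi (x) = E phi (a x + b G) is the
    Mehler operator, and the theorem says that the adjoint of Q multiplies the entropy relative
    to the Gaussian measure by at most a^2, the exponential factor of the statement.

    By the variational formula KL (mu | nu) = sup_phi (\int phi dmu - ln \int e^phi dnu), whose
    two halves are [gibbs_inequality] and [KL_le_variational], this contraction follows from a
    statement about nu = N(0, sigma^2 I) alone: \int e^phi dnu <= 1 implies
    \int e^(a^-2 Q phi) dnu <= 1, for all bounded phi ([KL_contraction],
    [gaussian_exp_contractive]). In dimension one it is proved by monotone transport of the
    normal law to the probability proportional to e^(a^-2 Q phi) ([contraction1_normalized]); it
    passes to products by Jensen's inequality ([exp_contractive_product]) and to all variances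
    by scaling.

    For the law of X_T, let w_t = exp (- \int_t^T beta / (2 sigma^2)) and let I be the Ito
    integrals in the equation, known only as limits in mean square. On a grid of mesh T / n two
    sums are compared. The sum Z_n = sum_k w_k (I_(k+1) - I_k) converges to X_T - a X_0 along
    almost every path, because w is an integrating factor ([decay_sum_cvg]). The sum
    H_n = sum_k c_k (B_(k+1) - B_k), with heights c_k giving each step the variance
    sigma^2 (w_(k+1)^2 - w_k^2), has the law N(0, sigma^2 b^2 I) for every n
    ([step_tuple_law]) and is independent of X_0. By the Wiener isometry, E (Z_n - H_n)^2 is
    bounded by the integral of the squared difference of the integrands
    ([wiener_approx_bound]), which is O(1 / n) since w sqrt(beta) is nondecreasing
    ([sqnorm_kernel_error]). Hence a X_0 + H_n, whose law does not depend on n, tends to X_T in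
    probability, and X_T has that law ([law_limit]). *)

Set Implicit Arguments.
Unset Strict Implicit.
Unset Printing Implicit Defensive.
Import Order.TTheory GRing.Theory Num.Theory.
Import numFieldNormedType.Exports.
Import HBNNSimple.
Local Open Scope classical_set_scope.
Local Open Scope ring_scope.

(** * Densities and change of variables on the line *)

Section density.
Context d (T : measurableType d) (R : realType) (mu : {measure set T -> \bar R}).
Local Open Scope ereal_scope.

(** By monotone convergence it is enough to treat indicators, where the equality is the
    hypothesis on m. *)
Lemma integral_density (m : {measure set T -> \bar R}) (p : T -> R) (f : T -> \bar R) :
  measurable_fun setT p -> (forall x, (0 <= p x)%R) ->
  (forall A, measurable A -> m A = \int[mu]_(x in A) (p x)%:E) ->
  measurable_fun setT f -> (forall x, 0 <= f x) ->
  \int[m]_x f x = \int[mu]_x (f x * (p x)%:E).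
Proof.
move=> mp p0 mE mf f0.
pose h := nnsfun_approx measurableT mf.
have mg : measurable_fun setT (EFin \o p) by exact/measurable_EFinP.
have -> : \int[m]_x f x = lim (\int[m]_x (EFin \o h n) x @[n --> \oo]).
  have fE x : setT x -> f x = lim ((EFin \o h n) x @[n --> \oo]).
    by move=> Ex; apply/esym/cvg_lim => //; exact: cvg_nnsfun_approx.
  under eq_integral => x /[!inE] /fE -> //.
  apply: monotone_convergence => //.
  - by move=> n; exact/measurable_EFinP.
  - by move=> n x Ex //=; rewrite lee_fin.
  - by move=> x Ex a b ab; rewrite lee_fin; exact/lefP/nd_nnsfun_approx.
have -> : \int[mu]_x (f x * (p x)%:E) =
    lim (\int[mu]_x ((h n x)%:E * (p x)%:E) @[n --> \oo]).
  have fg x : setT x -> f x * (p x)%:E = lim ((h n x)%:E * (p x)%:E @[n --> \oo]).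
    by move=> Ex; apply/esym/cvg_lim => //; apply: cvgeZr => //;
      exact: cvg_nnsfun_approx.
  under eq_integral => x /[!inE] /fg -> //.
  apply: monotone_convergence => [//| | |].
  - by move=> n; apply/emeasurable_funM => //; exact/measurable_EFinP.
  - by move=> n x Ex /=; rewrite mule_ge0 ?lee_fin.
  - by move=> x Ex a b ab/=; rewrite lee_wpmul2r ?lee_fin//; exact/lefP/nd_nnsfun_approx.
suff -> : (fun n : nat => \int[mu]_x ((h n x)%:E * (p x)%:E)) =
    (fun n => \int[m]_x (EFin \o h n) x) by [].
apply/funext => n.
have hE x : (h n x)%:E = \sum_(y \in range (h n)) (y * \1_(h n @^-1` [set y]) x)%:E.
  by rewrite fimfunE -fsumEFin.
have ind0 x y : 0 <= (y * \1_(h n @^-1` [set y]) x)%:E.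
  by rewrite EFinM nnfun_muleindic_ge0.
have indich (r : R) : measurable_fun setT (fun x => (r * \1_(h n @^-1` [set r]) x)%:E).
  by apply/measurable_EFinP; exact: measurable_funM.
under [RHS]eq_integral do rewrite /= hE.
under [LHS]eq_integral => x _.
  rewrite hE ge0_mule_fsuml; last by move=> y; exact: nnfun_muleindic_ge0.
  over.
rewrite ge0_integral_fsum//; last 2 first.
  - by move=> y; apply: emeasurable_funM.
  - by move=> y x _; rewrite mule_ge0 ?ind0 ?lee_fin.
rewrite ge0_integral_fsum//.
apply: eq_fsbigr => r rhn.
have r0 : (0 <= r)%R by move: rhn; rewrite inE => -[t _ <-].
under [RHS]eq_integral do rewrite EFinM.
under [LHS]eq_integral do rewrite EFinM -muleA.
have mind : measurable_fun setT (fun x => (\1_(h n @^-1` [set r]) x)%:E : \bar R).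
  exact/measurable_EFinP.
rewrite [RHS]ge0_integralZl// [LHS]ge0_integralZl//; last 2 first.
  - exact: emeasurable_funM.
  - by move=> t _; rewrite mule_ge0 ?lee_fin.
congr (_ * _).
rewrite integral_indic// setIT mE//.
rewrite [RHS]integral_mkcond; apply: eq_integral => x _.
by rewrite epatch_indic muleC.
Qed.

End density.

Section density_measure.
Context d (T : measurableType d) (R : realType) (mu : {measure set T -> \bar R}).
Context (p : T -> R) (mp : measurable_fun [set: T] p) (p0 : forall x, 0 <= p x).
Local Open Scope ereal_scope.

(** The properties of p are arguments so that the measure structure below can be found from
    the term itself. *)
Definition density_measure of measurable_fun [set: T] p & (forall x, (0 <= p x)%R) :=
  fun A : set T => \int[mu]_(x in A) (p x)%:E.

Local Notation m := (density_measure mp p0).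

Let m0 : m set0 = 0. Proof. exact: integral_set0. Qed.

Let m_ge0 A : 0 <= m A.
Proof. by apply: integral_ge0 => x _; rewrite lee_fin. Qed.

Let m_sigma_additive : semi_sigma_additive m.
Proof.
apply: semi_sigma_additive_nng_induced => [|x]; last by rewrite lee_fin.
exact/measurable_EFinP.
Qed.

HB.instance Definition _ := isMeasure.Build _ _ _ m m0 m_ge0 m_sigma_additive.

End density_measure.

Section substitution.
Context (R : realType).
Local Notation leb := (@lebesgue_measure R).

(** The image under S of the measure with density s gives ]S p, S q] the mass S q - S p, by
    the fundamental theorem of calculus, so it is Lebesgue measure; the lower bound c makes
    S onto. *)
Lemma ge0_integral_substitution (S s : R -> R) (c : R) (f : R -> \bar R) :
  0 < c -> (forall x : R, is_derive x (1 : R) S (s x)) -> continuous s ->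
  (forall x, c <= s x) ->
  measurable_fun [set: R] f -> (forall x, 0 <= f x)%E ->
  (\int[leb]_y f y = \int[leb]_x (f (S x) * (s x)%:E))%E.
Proof.
move=> c0 dS cs cS mf f0.
have contS : continuous S.
  move=> x; apply: differentiable_continuous; apply/derivable1_diffP.
  exact: (@ex_derive _ _ _ _ _ _ _ (dS x)).
have incS x y : x <= y -> c * (y - x) <= S y - S x.
  move=> xy.
  have [z _ ->] := @MVT_segment R S s x y xy (fun z _ => dS z)
    (continuous_subspaceT contS).
  by rewrite ler_wpM2r ?subr_ge0.
have ltS x y : (S x < S y) = (x < y).
  have [xy|yx] := ltP x y.
    by rewrite -subr_gt0 (lt_le_trans _ (incS _ _ (ltW xy)))// mulr_gt0// subr_gt0.
  by apply/negbTE; rewrite -leNgt -subr_ge0 (le_trans _ (incS _ _ yx))// mulr_ge0 ?subr_ge0// ltW.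
have leS x y : (S x <= S y) = (x <= y) by rewrite !leNgt ltS.
have surS y : exists x, S x = y.
  pose k := `|y - S 0| / c.
  have k0 : 0 <= k by rewrite divr_ge0// ltW.
  have ck : c * k = `|y - S 0| by rewrite /k mulrC divfK// gt_eqF.
  have h1 : y <= S k.
    have := incS 0 k k0; rewrite subr0 ck.
    by have := ler_norm (y - S 0); lra.
  have h2 : S (- k) <= y.
    have := incS (- k) 0; rewrite oppr_le0 => /(_ k0); rewrite sub0r opprK ck.
    by have := ler_norm (- (y - S 0)); rewrite normrN; lra.
  have kk : - k <= k by rewrite ge0_cp.
  have [|x _ <-] := @IVT R S (- k) k y kk (continuous_subspaceT contS).
    by rewrite ge_min le_max h1 h2 orbT.
  by exists x.
have mS : measurable_fun [set: R] S by exact: continuous_measurable_fun.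
have ms : measurable_fun [set: R] s by exact: continuous_measurable_fun.
have s0 x : 0 <= s x by rewrite (le_trans _ (cS x))// ltW.
pose k := density_measure leb ms s0.
have lebE : forall A, measurable A -> leb A = pushforward k (S : measurableTypeR R -> measurableTypeR R) A.
  apply: lebesgue_measure_unique => _ [[p q]] _ <- /=.
  have [p' p'E] := surS p; have [q' q'E] := surS q.
  rewrite /pushforward /k /density_measure.
  have -> : S @^-1` [set` `]p, q]] = [set` `]p', q']].
    by apply/seteqP; split => x /=; rewrite !in_itv/= -p'E -q'E ltS leS.
  rewrite lebesgue_measure_itv/= lte_fin -p'E -q'E ltS.
  case: ltP => [pq|qp]; last by rewrite set_itv_ge ?integral_set0// bnd_simp -leNgt.
  rewrite integral_itv_obnd_cbnd; last first.
    by apply: measurable_funTS; exact/measurable_EFinP.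
  rewrite (@continuous_FTC2 R s S p' q')//.
  - exact: continuous_subspaceT.
  - split => [x _||]; first exact: (@ex_derive _ _ _ _ _ _ _ (dS x)).
    + by apply: cvg_at_right_filter; exact: contS.
    + by apply: cvg_at_left_filter; exact: contS.
  - by move=> x _; rewrite derive1E; exact: (@derive_val _ _ _ _ _ _ _ (dS x)).
transitivity (\int[pushforward k (S : measurableTypeR R -> measurableTypeR R)]_y f y)%E.
  by apply: eq_measure_integral => A mA _; exact: lebE.
rewrite ge0_integral_pushforward//.
rewrite preimage_setT; rewrite (@integral_density _ (measurableTypeR R) R leb k s (f \o S) ms s0)//; last first.
  by move=> x /=.
exact: measurableT_comp.
Qed.

End substitution.

(** * Monotone transport between positive densities *)

Section transport.
Context (R : realType).
Local Notation leb := (@lebesgue_measure R).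

Definition cumul (q : R -> R) (y : R) : R := \int[leb]_(t in `]-oo, y]) q t.

Context (q : R -> R) (cq : continuous q) (q0 : forall x, 0 < q x)
  (q1 : (\int[leb]_x (q x)%:E = 1)%E).

Let mq : measurable_fun [set: R] q. Proof. exact: continuous_measurable_fun. Qed.

Let q_ge0 x : 0 <= q x. Proof. exact: ltW. Qed.

Let iq : leb.-integrable [set: R] (EFin \o q).
Proof.
apply/integrableP; split; first exact/measurable_EFinP.
under eq_integral do rewrite /= ger0_norm//.
by rewrite q1 ltry.
Qed.

Let iqD (D : set R) : measurable D -> leb.-integrable D (EFin \o q).
Proof. by move=> mD; exact: integrableS iq. Qed.

Let m := density_measure leb mq q_ge0.

Let cumulE y : (cumul q y)%:E = m `]-oo, y].
Proof. by rewrite /cumul /m /density_measure fineK//; exact: integrable_fin_num (iqD _). Qed.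

Lemma is_derive_cumul (y : R) : is_derive y (1 : R) (cumul q) (q y).
Proof.
have y1 : y < y + 1 by rewrite ltrDl.
have [||dF F'] := @continuous_FTC1 R q (BInfty R true) y (y + 1) y1 (iqD (measurable_itv _)).
- by rewrite ltNyr.
- exact: cq.
by apply: DeriveDef; [exact: dF|rewrite -F' derive1E].
Qed.

Lemma continuous_cumul : continuous (cumul q).
Proof.
move=> y; apply: differentiable_continuous; apply/derivable1_diffP.
exact: (@ex_derive _ _ _ _ _ _ _ (is_derive_cumul y)).
Qed.

Lemma cumul_lt x y : x < y -> cumul q x < cumul q y.
Proof.
move=> xy; rewrite -subr_gt0.
have [z _ ->] := @MVT R (cumul q) q x y xy (fun z _ => is_derive_cumul z)
  (continuous_subspaceT continuous_cumul).
by rewrite mulr_gt0// subr_gt0.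
Qed.

Let mT : m setT = 1%E. Proof. exact: q1. Qed.

Lemma cumul_itv x : 0 < cumul q x < 1.
Proof.
apply/andP; split.
- apply: (@le_lt_trans _ _ (cumul q (x - 1))); last by apply: cumul_lt; rewrite gtrBl.
  by apply: Rintegral_ge0.
- apply: (@lt_le_trans _ _ (cumul q (x + 1))); first by apply: cumul_lt; rewrite ltrDl.
  by rewrite -lee_fin cumulE -mT le_measure// inE.
Qed.

Lemma cumul_surj (L : R) : 0 < L < 1 -> exists y, cumul q y = L.
Proof.
move=> /andP[L0 L1].
have [n Ln] : exists n : nat, L < cumul q n%:R.
  pose F n : set (measurableTypeR R) := [set` `]-oo, n%:R : R]].
  have : m (F n) @[n --> \oo] --> 1%E.
    have <- : m (\bigcup_n F n) = 1%E.
      rewrite -mT; congr (m _); rewrite -subTset => t _/=.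
      by exists (Num.truncn t).+1; rewrite /F //= in_itv/= ltW// truncnS_gt.
    apply: nondecreasing_cvg_mu.
    + by move=> i; exact: measurable_itv.
    + by apply: bigcup_measurable => i _; exact: measurable_itv.
    move=> a b ab; apply/subsetPset => x; rewrite /F /= !in_itv/= => /le_trans.
    by apply; rewrite ler_nat.
  move=> /fine_cvgP[_] /cvgrPdist_lt /(_ (1 - L)); rewrite subr_gt0 => /(_ L1).
  move=> [N _ /(_ N (leqnn _))] /= h; exists N.
  rewrite -cumulE/= in h; have := ler_norm (1 - cumul q N%:R); lra.
have [k kL] : exists k : nat, cumul q (- k%:R) < L.
  pose F n : set (measurableTypeR R) := [set` `]-oo, - n%:R : R]].
  have : m (F n) @[n --> \oo] --> 0%E.
    have <- : m (\bigcap_n F n) = 0%E.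
      rewrite (_ : \bigcap_n F n = set0) ?measure0// -subset0 => t /(_ (Num.bound t) I).
      by rewrite /F /= in_itv/= leNgt => /negP; apply; rewrite ltrNl unstable.ltrNbound.
    apply: nonincreasing_cvg_mu.
    + apply: (@le_lt_trans _ _ (m setT)); last by rewrite mT ltry.
      by apply: le_measure; rewrite ?inE//; exact: measurable_itv.
    + by move=> i; exact: measurable_itv.
    + by apply: bigcap_measurable => // i _; exact: measurable_itv.
    + move=> a b ab; apply/subsetPset => x; rewrite /F /= !in_itv => /le_trans; apply.
      by rewrite lerN2 ler_nat.
  move=> /fine_cvgP[_] /cvgrPdist_lt /(_ L L0).
  move=> [N _ /(_ N (leqnn _))] /= h; exists N.
  rewrite -cumulE/= in h; have := ler_norm (- (0 - cumul q (- N%:R))); rewrite normrN; lra.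
have kn : - k%:R <= n%:R :> R by rewrite (@le_trans _ _ 0) ?oppr_le0.
have [|y _ <-] := @IVT R (cumul q) (- k%:R) n%:R L kn (continuous_subspaceT continuous_cumul).
  by rewrite ge_min le_max (ltW kL) (ltW Ln) orbT.
by exists y.
Qed.

End transport.

(** T is the inverse distribution function of q after the distribution function of p; its
    derivative comes from differentiating F_q (T x) = F_p x. *)
Lemma monotone_transport (R : realType) (p q : R -> R) :
  continuous p -> continuous q -> (forall x, 0 < p x) -> (forall x, 0 < q x) ->
  (\int[lebesgue_measure]_x (p x)%:E = 1)%E ->
  (\int[lebesgue_measure]_x (q x)%:E = 1)%E ->
  exists T : R -> R, forall x : R, is_derive x (1 : R) T (p x / q (T x)).
Proof.
move=> cp cq p0 q0 p1 q1.
pose inv L := if pselect (exists y, cumul q y = L) is left e then sval (cid e) else 0.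
have cumulK : cancel (cumul q) inv.
  move=> y; rewrite /inv; case: pselect => [e|[]]; last by exists y.
  case: cid => z /= zy; apply/eqP; case: ltgtP => // h.
  - by have := cumul_lt cq q0 q1 h; rewrite zy ltxx.
  - by have := cumul_lt cq q0 q1 h; rewrite zy ltxx.
have invK L : 0 < L < 1 -> cumul q (inv L) = L.
  move=> /(cumul_surj cq q0 q1) e; rewrite /inv; case: pselect => // e'.
  by case: cid.
exists (inv \o cumul p) => x /=.
set y := inv (cumul p x).
have yE : cumul q y = cumul p x by apply: invK; exact: cumul_itv.
have dinv : is_derive (cumul p x) (1 : R) inv (q y)^-1.
  rewrite -yE; apply: is_derive_inverse; [by near=> z; exact: cumulK| | exact: is_derive_cumul|].
  - by near=> z; exact: (continuous_cumul cq q0 q1).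
  - by rewrite gt_eqF.
have dp := is_derive_cumul cp p0 p1 x.
rewrite mulrC.
exact: is_derive1_comp.
Unshelve. all: by end_near. Qed.

(** * Integrals of bounded functions against probabilities *)

Section bounded_measurable.
Context d (T : measurableType d) (R : realType).
Implicit Types (f g : T -> R) (P : probability T R).

Definition bounded_measurable (f : T -> R) : Prop :=
  measurable_fun [set: T] f /\ exists M, forall x, `|f x| <= M.

Lemma bounded_measurable_integrable P f :
  bounded_measurable f -> P.-integrable [set: T] (EFin \o f).
Proof.
move=> [mf [M fM]]; apply: measurable_bounded_integrable => //.
  by rewrite (le_lt_trans (probability_le1 P measurableT)) ?ltry.
exists M; split; first exact: num_real.
by move=> N MN x _; apply: (le_trans (fM x)); exact: ltW.
Qed.

Lemma bounded_measurable_cst r : bounded_measurable (fun _ : T => r).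
Proof. by split; [exact: measurable_cst|exists `|r|]. Qed.

Lemma bounded_measurableD f g : bounded_measurable f -> bounded_measurable g ->
  bounded_measurable (fun x => f x + g x).
Proof.
move=> [mf [M fM]] [mg [N gN]]; split; first exact: measurable_funD.
by exists (M + N) => x; rewrite (le_trans (ler_normD _ _))// lerD.
Qed.

Lemma bounded_measurableN f : bounded_measurable f -> bounded_measurable (fun x => - f x).
Proof.
move=> [mf [M fM]]; split; first exact: measurableT_comp.
by exists M => x; rewrite normrN.
Qed.

Lemma bounded_measurableB f g : bounded_measurable f -> bounded_measurable g ->
  bounded_measurable (fun x => f x - g x).
Proof. by move=> bf bg; apply: bounded_measurableD => //; exact: bounded_measurableN. Qed.

Lemma bounded_measurableM f g : bounded_measurable f -> bounded_measurable g ->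
  bounded_measurable (fun x => f x * g x).
Proof.
move=> [mf [M fM]] [mg [N gN]]; split; first exact: measurable_funM.
by exists (M * N) => x; rewrite normrM ler_pM.
Qed.

Lemma bounded_measurableZ r f : bounded_measurable f ->
  bounded_measurable (fun x => r * f x).
Proof. by move=> bf; apply: bounded_measurableM => //; exact: bounded_measurable_cst. Qed.

Lemma bounded_measurable_expR f : bounded_measurable f ->
  bounded_measurable (fun x => expR (f x)).
Proof.
move=> [mf [M fM]]; split; first exact: measurableT_comp.
exists (expR M) => x; rewrite ger0_norm ?expR_ge0// ler_expR.
by rewrite (le_trans (ler_norm _)).
Qed.

Lemma bounded_measurable_expR_lb f : bounded_measurable f ->
  exists2 c, 0 < c & forall x, c <= expR (f x).
Proof.
move=> [mf [M fM]]; exists (expR (- M)); first exact: expR_gt0.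
by move=> x; rewrite ler_expR lerNl (le_trans _ (fM x))// -normrN ler_norm.
Qed.

Lemma bounded_measurable_ln f (c : R) : 0 < c -> bounded_measurable f ->
  (forall x, c <= f x) -> bounded_measurable (fun x => ln (f x)).
Proof.
move=> c0 [mf [M fM]] cf; split; first exact: measurableT_comp.
exists (`|ln c| + `|ln M|) => x.
have fx0 : 0 < f x by rewrite (lt_le_trans c0).
have fxM : f x <= M by rewrite (le_trans (ler_norm _)).
have M0 : 0 < M by rewrite (lt_le_trans fx0).
have h1 : ln c <= ln (f x) by rewrite ler_ln ?posrE.
have h2 : ln (f x) <= ln M by rewrite ler_ln ?posrE.
rewrite ler_norml; have := ler_norm (ln M); have := ler_norm (- ln c).
have := normr_ge0 (ln c); have := normr_ge0 (ln M); rewrite normrN; lra.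
Qed.

Lemma RintegralE P f : bounded_measurable f ->
  (\int[P]_x (f x)%:E = (\int[P]_x f x)%:E)%E.
Proof.
by move=> bf; rewrite fineK//; exact/integrable_fin_num/bounded_measurable_integrable.
Qed.

Lemma Rintegral_bdD P f g : bounded_measurable f -> bounded_measurable g ->
  \int[P]_x (f x + g x) = \int[P]_x f x + \int[P]_x g x.
Proof. by move=> bf bg; rewrite RintegralD//; exact: bounded_measurable_integrable. Qed.

Lemma Rintegral_bdB P f g : bounded_measurable f -> bounded_measurable g ->
  \int[P]_x (f x - g x) = \int[P]_x f x - \int[P]_x g x.
Proof. by move=> bf bg; rewrite RintegralB//; exact: bounded_measurable_integrable. Qed.

Lemma Rintegral_bdZ P r f : bounded_measurable f ->
  \int[P]_x (r * f x) = r * \int[P]_x f x.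
Proof. by move=> bf; rewrite RintegralZl//; exact: bounded_measurable_integrable. Qed.

Lemma le_Rintegral_bd P f g : bounded_measurable f -> bounded_measurable g ->
  (forall x, f x <= g x) -> \int[P]_x f x <= \int[P]_x g x.
Proof. by move=> bf bg fg; apply: le_Rintegral => //; exact: bounded_measurable_integrable. Qed.

Lemma Rintegral_prob_cst P r : \int[P]_x r = r.
Proof. by rewrite Rintegral_cst//= [X in fine X]probability_setT /= mulr1. Qed.

Lemma Rintegral_bdDcst P f r : bounded_measurable f ->
  \int[P]_x (f x + r) = \int[P]_x f x + r.
Proof.
move=> bf; rewrite (Rintegral_bdD P bf (bounded_measurable_cst r)).
by rewrite Rintegral_prob_cst.
Qed.

Lemma Rintegral_expR_gt0 P f : bounded_measurable f -> 0 < \int[P]_x expR (f x).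
Proof.
move=> bf; have [c c0 cP] := bounded_measurable_expR_lb bf.
apply: (lt_le_trans c0); rewrite -(Rintegral_prob_cst P c).
by apply: le_Rintegral_bd => //; [exact: bounded_measurable_cst|exact: bounded_measurable_expR].
Qed.

Lemma Rintegral_expR_normalized P f : bounded_measurable f ->
  \int[P]_x expR (f x - ln (\int[P]_x expR (f x))) = 1.
Proof.
move=> bf; have I0 := Rintegral_expR_gt0 P bf.
under eq_Rintegral do rewrite expRB mulrC.
rewrite (Rintegral_bdZ P _ (bounded_measurable_expR bf)) lnK ?posrE//.
by rewrite mulVf// gt_eqF.
Qed.

Lemma bounded_measurable_indic A : measurable A -> bounded_measurable (\1_A : T -> R).
Proof.
move=> mA; split; first exact: measurable_indic.
by exists 1 => x; rewrite indicE; case: (_ \in _); rewrite ?normr1 ?normr0.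
Qed.

Lemma Rintegral_indic P A : measurable A -> \int[P]_x (\1_A x : R) = fine (P A).
Proof. by move=> mA; rewrite /Rintegral integral_indic// setIT. Qed.

Lemma normr_Rintegral_bd P f M : bounded_measurable f -> (forall x, `|f x| <= M) ->
  `|\int[P]_x f x| <= M.
Proof.
move=> bf fM; rewrite ler_norml; apply/andP; split.
- rewrite -(Rintegral_prob_cst P (- M)); apply: le_Rintegral_bd => //.
    exact: bounded_measurable_cst.
  by move=> x; have := fM x; rewrite ler_norml => /andP[].
- rewrite -[leRHS](Rintegral_prob_cst P); apply: le_Rintegral_bd => //.
    exact: bounded_measurable_cst.
  by move=> x; have := fM x; rewrite ler_norml => /andP[].
Qed.

End bounded_measurable.

Lemma bounded_measurable_comp d1 d2 (T1 : measurableType d1) (T2 : measurableType d2)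
  (R : realType) (f : T2 -> R) (g : T1 -> T2) :
  bounded_measurable f -> measurable_fun [set: T1] g -> bounded_measurable (f \o g).
Proof.
move=> [mf [M fM]] mg; split; first exact: measurableT_comp.
by exists M => x /=.
Qed.

Lemma Rintegral_bd_distribution d1 d2 (T1 : measurableType d1) (T2 : measurableType d2)
  (R : realType) (P : probability T1 R) (X : {RV P >-> T2}) (f : T2 -> R) :
  bounded_measurable f -> \int[distribution P X]_y f y = \int[P]_x f (X x).
Proof.
move=> bf; congr fine; rewrite integral_distribution//.
  by case: bf => mf _; exact/measurable_EFinP.
by apply: (@bounded_measurable_integrable _ _ _ P (f \o X)); exact: bounded_measurable_comp.
Qed.

Section bounded_fubini.
Context d1 d2 (T1 : measurableType d1) (T2 : measurableType d2) (R : realType).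
Context (P : probability T1 R) (Q : probability T2 R).

Lemma bounded_measurable_pair1 (f : T1 * T2 -> R) x :
  bounded_measurable f -> bounded_measurable (fun y => f (x, y)).
Proof. by move=> bf; exact: (bounded_measurable_comp bf (pair1_measurable x)). Qed.

Lemma bounded_measurable_pair2 (f : T1 * T2 -> R) y :
  bounded_measurable f -> bounded_measurable (fun x => f (x, y)).
Proof. by move=> bf; exact: (bounded_measurable_comp bf (pair2_measurable y)). Qed.

Lemma bounded_Rintegral (f : T1 * T2 -> R) :
  bounded_measurable f -> bounded_measurable (fun x => \int[Q]_y f (x, y)).
Proof.
move=> bf; split; last first.
  case: (bf) => _ [M fM]; exists M => x.
  by apply: normr_Rintegral_bd => //; exact: bounded_measurable_pair1.
have := @measurable_fubini_F _ _ _ _ _ P Q (EFin \o f)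
  (bounded_measurable_integrable (P \x Q)%E bf).
by move=> mF; exact: (measurableT_comp (@fine_measurable R setT measurableT) mF).
Qed.

Lemma Rintegral_fubini (f : T1 * T2 -> R) : bounded_measurable f ->
  \int[(P \x Q)%E]_z f z = \int[P]_x \int[Q]_y f (x, y).
Proof.
move=> bf; congr fine.
rewrite -[LHS](@integral12_prod_meas1 _ _ _ _ _ P Q (EFin \o f)); last first.
  exact: bounded_measurable_integrable.
apply: eq_integral => x _; rewrite /fubini_F/=.
by rewrite RintegralE//; exact: bounded_measurable_pair1.
Qed.

Lemma Rintegral_fubini_swap (f : T1 * T2 -> R) : bounded_measurable f ->
  \int[P]_x \int[Q]_y f (x, y) = \int[Q]_y \int[P]_x f (x, y).
Proof.
move=> bf; rewrite -Rintegral_fubini//; congr fine.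
rewrite -[LHS](@integral21_prod_meas1 _ _ _ _ _ P Q (EFin \o f)); last first.
  exact: bounded_measurable_integrable.
apply: eq_integral => x _; rewrite /fubini_G/=.
by rewrite RintegralE//; exact: bounded_measurable_pair2.
Qed.

End bounded_fubini.

(** * The normal law on the line *)

Section normal.
Context (R : realType).
Local Notation leb := (@lebesgue_measure R).
Local Notation rR := (measurableTypeR R).

Lemma ge0_integral_normal_prob (m s : R) (f : R -> \bar R) :
  measurable_fun [set: R] f -> (forall x, 0 <= f x)%E ->
  (\int[normal_prob m s]_x f x = \int[leb]_x (f x * (normal_pdf m s x)%:E))%E.
Proof.
move=> mf f0.
by rewrite (@integral_density _ _ R leb (normal_prob m s) (normal_pdf m s) f
  (measurable_normal_pdf m s) (normal_pdf_ge0 m s)).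
Qed.

Lemma normal_peak_affine (s : R) : 0 < s -> normal_peak s * s = normal_peak 1.
Proof.
move=> s0; rewrite /normal_peak expr1n mul1r -mulrnAr sqrtrM ?sqr_ge0//.
by rewrite sqrtr_sqr gtr0_norm// invfM mulrC mulrA mulfV ?mul1r// gt_eqF.
Qed.

Lemma normal_pdf_affine (m s z : R) : 0 < s ->
  normal_pdf m s (m + s * z) * s = normal_pdf 0 1 z.
Proof.
move=> s0; have sn0 : s != 0 by rewrite gt_eqF.
rewrite !normal_pdfE ?oner_neq0// /normal_fun mulrAC normal_peak_affine//.
congr (_ * expR _); rewrite subr0 (addrC m) addrK expr1n.
by field; rewrite sn0.
Qed.

Lemma ge0_integral_affine (m s : R) (f : R -> \bar R) : 0 < s ->
  measurable_fun [set: R] f -> (forall x, 0 <= f x)%E ->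
  (\int[leb]_y f y = \int[leb]_x (f (m + s * x)%R * s%:E))%E.
Proof.
move=> s0 mf f0.
apply: (@ge0_integral_substitution R (fun x => m + s * x) (fun=> s) s) => //.
- move=> x.
  have h : is_derive (x : R) (1 : R) (cst m + s *: (@id R)) (0 + s *: (1 : R)).
    exact: (is_deriveD (is_derive_cst m x 1) (is_deriveZ s (is_derive_id x 1))).
  by apply: (is_derive_eq h); rewrite add0r /GRing.scale /= mulr1.
- by move=> x; exact: cvg_cst.
Qed.

Lemma ge0_integral_normal_prob_affine (m s : R) (f : R -> \bar R) : 0 < s ->
  measurable_fun [set: R] f -> (forall x, 0 <= f x)%E ->
  (\int[normal_prob m s]_y f y = \int[normal_prob 0 1]_z f (m + s * z)%R)%E.
Proof.
move=> s0 mf f0; rewrite ge0_integral_normal_prob//.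
have maff : measurable_fun [set: R] (fun z : R => m + s * z).
  by apply: measurable_funD => //; exact: measurable_funM.
rewrite [RHS](ge0_integral_normal_prob 0 1 (measurableT_comp mf maff) (fun z => f0 (m + s * z)))/=.
rewrite (@ge0_integral_affine m s)//; last 2 first.
- by apply: emeasurable_funM => //; apply/measurable_EFinP; exact: measurable_normal_pdf.
- by move=> x; rewrite mule_ge0// lee_fin normal_pdf_ge0.
by apply: eq_integral => x _; rewrite -muleA -EFinM normal_pdf_affine.
Qed.

Lemma Rintegral_normal_prob_affine (m s : R) (f : rR -> R) : 0 < s ->
  bounded_measurable f ->
  \int[normal_prob m s]_y f y = \int[normal_prob 0 1]_z f (m + s * z).
Proof.
move=> s0 bf; have [mf [M fM]] := bf.
have maff : measurable_fun [set: R] (fun z : R => m + s * z).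
  by apply: measurable_funD => //; exact: measurable_funM.
have bfa : bounded_measurable (fun z : rR => f (m + s * z)).
  exact: (bounded_measurable_comp bf maff).
have := @ge0_integral_normal_prob_affine m s (fun y => (f y + M)%:E) s0.
move=> /(_ _ _)/(congr1 fine) => h.
have : \int[normal_prob m s]_x (f x + M) = \int[normal_prob 0 1]_x (f (m + s * x) + M).
  apply: h; first by apply/measurable_EFinP; exact: measurable_funD.
  by move=> x; rewrite lee_fin; have := fM x; rewrite ler_norml => /andP[? _]; lra.
rewrite (Rintegral_bdDcst _ M bf) (Rintegral_bdDcst _ M bfa).
exact: addIr.
Qed.

Lemma Rintegral_normal_prob (m s : R) (f : rR -> R) :
  bounded_measurable f ->
  \int[normal_prob m s]_y f y = \int[leb]_y (f y * normal_pdf m s y).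
Proof.
move=> bf; have [mf [M fM]] := bf.
have h : \int[normal_prob m s]_x (f x + M) = \int[leb]_x ((f x + M) * normal_pdf m s x).
  congr fine; rewrite ge0_integral_normal_prob//.
  - by apply/measurable_EFinP; exact: measurable_funD.
  by move=> x; rewrite lee_fin; have := fM x; rewrite ler_norml => /andP[? _]; lra.
move: h; rewrite (Rintegral_bdDcst _ M bf).
under [in X in _ = X -> _]eq_Rintegral do rewrite mulrDl.
have ip := integrable_normal_pdf m s.
have ifp : leb.-integrable [set: R] (EFin \o (fun y => f y * normal_pdf m s y)).
  apply: (@le_integrable _ _ _ leb setT measurableT _ (fun x => M%:E * (normal_pdf m s x)%:E)%E).
  - by apply/measurable_EFinP; apply: measurable_funM => //; exact: measurable_normal_pdf.
  - move=> x _ /=; rewrite lee_fin !normrM ler_wpM2r// (le_trans (fM x))// ler_norm//.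
  - exact: integrableZl.
rewrite RintegralD//; last exact: (integrableZl measurableT M ip).
rewrite RintegralZl// [X in _ + M * X](_ : _ = 1) ?mulr1; first exact: addIr.
by rewrite /Rintegral integral_normal_pdf.
Qed.

(** Substituting y = a x + b z moves the dependence on x into the mean of a Gaussian
    density; for x near x0 these densities stay below a multiple of the density of standard
    deviation 2 b, so dominated convergence applies. *)
Lemma continuous_normal_smoothing (a b : R) (f : rR -> R) : 0 < b ->
  bounded_measurable f ->
  continuous (fun x => \int[normal_prob 0 1]_z f (a * x + b * z)).
Proof.
move=> b0 bf; have [mf [M fM]] := bf.
have bn0 : b != 0 by rewrite gt_eqF.
under eq_fun do rewrite -Rintegral_normal_prob_affine// Rintegral_normal_prob//.
move=> x0; pose N := `|x0| + 1.
(* 4 (y - a x)^2 + 4 (a x)^2 >= y^2 compares the exponents, and |x| <= N near x0 *)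
pose C := M * normal_peak b * expR (a ^+ 2 * N ^+ 2 / (2 * b ^+ 2)).
have b20 : 0 < 2 * b by rewrite mulr_gt0.
apply: (@continuity_under_integral R _ rR leb
  (fun x y => f y * normal_pdf (a * x) b y) setT measurableT (x0 - 1) (x0 + 1) _ _
  (fun y => C / normal_peak (2 * b) * normal_pdf 0 (2 * b) y)) => /=.
- move=> x _; apply: (@le_integrable _ _ _ leb setT measurableT _ (fun y => M%:E * (normal_pdf (a * x) b y)%:E)%E).
  + by apply/measurable_EFinP; apply: measurable_funM => //; exact: measurable_normal_pdf.
  + by move=> y _ /=; rewrite lee_fin !normrM ler_wpM2r// (le_trans (fM y))// ler_norm.
  + exact: (integrableZl measurableT M (integrable_normal_pdf _ _)).
- apply: aeW => y _ x _; apply: cvgM; first exact: cvg_cst.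
  rewrite normal_pdfE//.
  under eq_fun do rewrite normal_pdfE//.
  apply: cvgM; first exact: cvg_cst.
  rewrite /normal_fun; apply: (cvg_comp _ expR); last exact: continuous_expR.
  apply: cvgM; last exact: cvg_cst.
  apply: (@cvgN _ R^o).
  apply: (cvg_comp (fun x => y - a * x) (fun x => x ^+ 2)); last exact: sqr_continuous.
  apply: (@cvgB _ R^o); first exact: cvg_cst.
  by apply: cvgM; [exact: cvg_cst|exact: cvg_id].
- exact: (integrableZl measurableT _ (integrable_normal_pdf _ _)).
- move=> x xI; apply: aeW => y _.
  rewrite !normal_pdfE ?gt_eqF// !normrM.
  have p0 := normal_peak_ge0 b.
  rewrite (ger0_norm p0) (ger0_norm (normal_fun_ge0 _ _ _)) [leRHS]mulrA mulfVK ?gt_eqF ?normal_peak_gt0 ?gt_eqF//.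
  rewrite /C -!mulrA ler_pM ?mulr_ge0 ?expR_ge0// ler_wpM2l//.
  rewrite /normal_fun -expRD ler_expR subr0 -[b ^+ 2 *+ 2]mulr_natr -[(2 * b) ^+ 2 *+ 2]mulr_natr exprMn.
  have xN : x ^+ 2 <= N ^+ 2.
    rewrite -(ger0_norm (sqr_ge0 x)) normrX lerXn2r ?nnegrE ?addr_ge0//.
    move: xI; rewrite /= in_itv/= /N => /andP[h1 h2].
    rewrite ler_norml; have := ler_norm x0; have := ler_norm (- x0); rewrite normrN; lra.
  have a2 : a ^+ 2 * x ^+ 2 <= a ^+ 2 * N ^+ 2 by rewrite ler_wpM2l ?sqr_ge0.
  have bb : 0 < b ^+ 2 by rewrite exprn_gt0.
  rewrite (_ : - (y - a * x) ^+ 2 / (b ^+ 2 * 2) =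
    (- (4 * (y - a * x) ^+ 2)) / (8 * b ^+ 2)); last by field.
  rewrite [leRHS](_ : _ = (4 * (a ^+ 2 * N ^+ 2) - y ^+ 2) / (8 * b ^+ 2)); last by field.
  rewrite ler_pM2r ?invr_gt0 ?mulr_gt0//.
  have aN0 := sqr_ge0 (a * x).
  have key : 4 * (y - a * x) ^+ 2 + 4 * (a ^+ 2 * x ^+ 2) - y ^+ 2 =
    (3 * y - 4 * (a * x)) ^+ 2 / 3 + 8 / 3 * (a * x) ^+ 2 by field.
  have := sqr_ge0 (3 * y - 4 * (a * x)).
  lra.
- by rewrite inE /= in_itv/= gtrBl ltrDl ltr01.
Qed.
End normal.

(** The integral is the difference of the integrals of the positive and negative parts,
    which vary in opposite directions; subtraction of extended reals is monotone even at
    infinite values. *)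
Lemma le_integral_measurable d (T : measurableType d) (R : realType)
  (mu : {measure set T -> \bar R}) (f g : T -> \bar R) :
  measurable_fun [set: T] f -> measurable_fun [set: T] g ->
  (forall x, f x <= g x)%E -> (\int[mu]_x f x <= \int[mu]_x g x)%E.
Proof.
move=> mf mg fg; rewrite integralE [leRHS]integralE leeB//.
- apply: ge0_le_integral => //; [exact: measurable_funepos|exact: measurable_funepos|].
  move=> x _; by apply: (@funepos_le _ _ setT) => [y _|]; [exact: fg|rewrite inE].
- apply: ge0_le_integral => //; [exact: measurable_funeneg|exact: measurable_funeneg|].
  move=> x _; by apply: (@funeneg_le _ _ setT) => [y _|]; [exact: fg|rewrite inE].
Qed.

Lemma ge0_integral_lebesgueN (R : realType) (f : measurableTypeR R -> \bar R) :
  measurable_fun [set: measurableTypeR R] f -> (forall x, 0 <= f x)%E ->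
  (\int[lebesgue_measure]_x f x = \int[lebesgue_measure]_x f (- x)%R)%E.
Proof.
move=> mf f0.
have mN : measurable_fun [set: measurableTypeR R] (-%R : measurableTypeR R -> measurableTypeR R).
  exact: oppr_measurable.
rewrite -[RHS](@ge0_integral_pushforward _ _ (measurableTypeR R) (measurableTypeR R) R
  (-%R) mN lebesgue_measure setT f measurableT mf (fun y _ => f0 y)).
by apply: eq_measure_integral => A mA _; exact/esym/lebesgue_measureN.
Qed.

Section normal_moments.
Context (R : realType).
Local Notation gam := (@normal_prob R 0 1).
Local Notation leb := (@lebesgue_measure R).

(** As x^2 <= 4 exp (x^2 / 4), the integrand is below a multiple of the density of standard
    deviation 2. *)
Lemma integrable_normal_prob_sqr : gam.-integrable [set: R] (fun x => (x ^+ 2)%:E).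
Proof.
have mX2 : measurable_fun [set: R] (fun x : R => (x ^+ 2)%:E : \bar R).
  by apply/measurable_EFinP; exact: measurable_funX.
apply/integrableP; split => //.
under eq_integral do rewrite /= ger0_norm ?sqr_ge0//.
rewrite ge0_integral_normal_prob//; last by move=> x; rewrite lee_fin sqr_ge0.
pose c := 4 * normal_peak (1 : R) / normal_peak 2.
apply: (@le_lt_trans _ _ (\int[leb]_x (c%:E * (normal_pdf 0 2 x)%:E))%E); last first.
  by rewrite integralZl ?integral_normal_pdf ?mule1 ?ltry//; exact: integrable_normal_pdf.
apply: ge0_le_integral => //.
- by move=> x _; rewrite mule_ge0// lee_fin ?sqr_ge0 ?normal_pdf_ge0.
- by apply: emeasurable_funM => //; apply/measurable_EFinP; exact: measurable_normal_pdf.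
- by apply: emeasurable_funM => //; apply/measurable_EFinP; exact: measurable_normal_pdf.
- move=> x _; rewrite -!EFinM lee_fin !normal_pdfE ?oner_neq0 ?pnatr_eq0//.
  rewrite /c [leRHS]mulrA mulfVK ?gt_eqF ?normal_peak_gt0 ?pnatr_eq0//.
  rewrite mulrCA [4 * _]mulrC -[leRHS]mulrA ler_wpM2l ?normal_peak_ge0//.
  rewrite /normal_fun !subr0 -[1 ^+ 2 *+ 2]mulr_natr -[2 ^+ 2 *+ 2]mulr_natr expr1n.
  have h : x ^+ 2 <= 4 * expR (x ^+ 2 / 4).
    by have := expR_ge1Dx (x ^+ 2 / 4); lra.
  apply: (le_trans (ler_wpM2r (expR_ge0 _) h)).
  rewrite -mulrA ler_wpM2l// -expRD ler_expR.
  by have := sqr_ge0 x; lra.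
Qed.

Lemma integrable_normal_prob_id : gam.-integrable [set: R] (fun x => x%:E).
Proof.
have i1 : gam.-integrable [set: R] (fun=> 1%:E).
  by apply: (bounded_measurable_integrable gam); exact: bounded_measurable_cst.
apply: (@le_integrable _ _ _ gam setT measurableT _ (fun x => 1%:E + (x ^+ 2)%:E)%E).
- by apply/measurable_EFinP.
- move=> x _; rewrite -EFinD /= lee_fin ler_norml ger0_norm ?addr_ge0 ?sqr_ge0//.
  by have := sqr_ge0 (x + 1); have := sqr_ge0 (x - 1); have := sqr_ge0 x; lra.
- by apply: integrableD => //; exact: integrable_normal_prob_sqr.
Qed.

Lemma integral_normal_prob_id : (\int[gam]_x x%:E = 0)%E.
Proof.
have mid : measurable_fun [set: R] (fun x : R => x%:E : \bar R) by exact/measurable_EFinP.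
have sym (f : R -> \bar R) : measurable_fun [set: R] f -> (forall x, 0 <= f x)%E ->
    (\int[gam]_x f x = \int[gam]_x f (- x)%R)%E.
  move=> mf f0.
  have mfN : measurable_fun [set: R] (fun x : R => f (- x)) by exact: measurableT_comp.
  rewrite !ge0_integral_normal_prob//.
  rewrite (@ge0_integral_lebesgueN R (fun x => f x * (normal_pdf 0 1 x)%:E)%E).
  - by apply: eq_integral => x _; rewrite !normal_pdfE ?oner_neq0// /normal_fun !subr0 sqrrN.
  - by apply: emeasurable_funM => //; apply/measurable_EFinP; exact: measurable_normal_pdf.
  - by move=> x; rewrite mule_ge0// lee_fin normal_pdf_ge0.
rewrite integralE (sym (_^\+)%E)//; last exact: measurable_funepos.
rewrite (_ : (fun x : R => (EFin^\+)%E (- x)) = (EFin^\-)%E); last first.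
  by apply/funext => x; rewrite funeposE funenegE.
rewrite subee// ge0_fin_numE; last exact: integral_ge0.
exact: (integrable_lty measurableT (integrable_funeneg measurableT integrable_normal_prob_id)).
Qed.

End normal_moments.

(** * The exponential contraction inequality in dimension one *)

(** The weighted arithmetic-geometric mean inequality for the numbers e^u and 1. *)
Lemma expR_weighted (R : realType) (t u : R) : 0 <= t <= 1 ->
  expR (t * u) <= t * expR u + (1 - t).
Proof.
move=> /andP[t0 t1].
have h1 := expR_ge1Dx ((1 - t) * u).
have h2 := expR_ge1Dx (- (t * u)).
have e1 : expR u = expR (t * u) * expR ((1 - t) * u).
  by rewrite -expRD; congr expR; ring.
have e2 : 1 = expR (t * u) * expR (- (t * u)) by rewrite -expRD subrr expR0.
rewrite [X in _ <= X](_ : _ = expR (t * u) * (t * expR ((1 - t) * u) + (1 - t) * expR (- (t * u)))); last first.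
  rewrite mulrDr !(mulrCA (expR (t * u))) -e1; congr (_ + _).
  by rewrite -e2 mulr1.
rewrite ler_peMr ?expR_ge0//.
have t1' : 0 <= 1 - t by rewrite subr_ge0.
have := ler_wpM2l t0 h1; have := ler_wpM2l t1' h2; lra.
Qed.

Section contraction1.
Context (R : realType).
Local Notation gam := (@normal_prob R 0 1).
Local Notation leb := (@lebesgue_measure R).
Local Notation rR := (measurableTypeR R).
Local Notation g := (@normal_pdf R 0 1).

Let gE x : g x = normal_peak 1 * expR (- (x ^+ 2 / 2)).
Proof. by rewrite normal_pdfE ?oner_neq0// /normal_fun subr0 expr1n mulNr. Qed.

(** Integrate 1 + y <= e^y at y = h z + c z, of mean 0. *)
Lemma integral_expR_tilt (h : rR -> R) (c : R) : bounded_measurable h ->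
  \int[gam]_z h z = 0 ->
  (1 <= \int[gam]_z (expR (h z + c * z))%:E)%E.
Proof.
move=> bh h0; have [mh _] := bh.
have mid : measurable_fun [set: rR] (fun z : rR => c * z : R).
  exact: measurable_funM.
have -> : (1 = \int[gam]_z ((1 + h z)%:E + (c%:E * z%:E)))%E.
  rewrite integralD//; last 2 first.
  - apply: (bounded_measurable_integrable gam); apply: bounded_measurableD => //.
    exact: bounded_measurable_cst.
  - by apply: integrableZl => //; exact: integrable_normal_prob_id.
  rewrite integralZl//; last exact: integrable_normal_prob_id.
  rewrite integral_normal_prob_id mule0 adde0 RintegralE; last first.
    by apply: bounded_measurableD => //; exact: bounded_measurable_cst.
  rewrite (Rintegral_bdD gam (bounded_measurable_cst _ 1) bh) h0.
  by rewrite Rintegral_prob_cst addr0.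
apply: le_integral_measurable.
- apply: emeasurable_funD; apply/measurable_EFinP => //; exact: measurable_funD.
- by apply/measurable_EFinP; apply: measurableT_comp => //; exact: measurable_funD.
- move=> z; rewrite -EFinM -EFinD lee_fin -addrA; exact: expR_ge1Dx.
Qed.

Context (a b : R) (phi : rR -> R).
Context (a0 : 0 < a) (b0 : 0 < b) (ab1 : a ^+ 2 + b ^+ 2 = 1)
  (bphi : bounded_measurable phi).

Let Q x := \int[gam]_z phi (a * x + b * z).

Let bQ : bounded_measurable (Q : rR -> R).
Proof.
have [mphi [M phiM]] := bphi.
have cQ : continuous Q by exact: continuous_normal_smoothing.
split; first exact: continuous_measurable_fun.
exists M => x; apply: normr_Rintegral_bd => //.
apply: (bounded_measurable_comp bphi).
by apply: measurable_funD => //; exact: measurable_funM.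
Qed.

Let Z := \int[gam]_x expR (a ^- 2 * Q x).

Let beQ : bounded_measurable (fun x : rR => expR (a ^- 2 * Q x)).
Proof. by apply: bounded_measurable_expR; exact: bounded_measurableZ. Qed.

Let Z0 : 0 < Z. Proof. exact: (Rintegral_expR_gt0 gam (bounded_measurableZ (a ^- 2) bQ)). Qed.

Let rho x := expR (a ^- 2 * Q x) * g x / Z.

Let rho0 x : 0 < rho x.
Proof. by rewrite divr_gt0// mulr_gt0 ?expR_gt0// gE mulr_gt0 ?expR_gt0// normal_peak_gt0 ?oner_neq0. Qed.

Let g0 x : 0 < g x.
Proof. by rewrite gE mulr_gt0 ?expR_gt0// normal_peak_gt0 ?oner_neq0. Qed.

Let mg : measurable_fun [set: rR] g.
Proof. exact: measurable_normal_pdf. Qed.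

Let crho : continuous rho.
Proof.
move=> x; apply: cvgM; last exact: cvg_cst.
apply: cvgM; last by apply: continuous_normal_pdf; rewrite oner_neq0.
apply: (cvg_comp _ expR); last exact: continuous_expR.
by apply: cvgM; [exact: cvg_cst|exact: continuous_normal_smoothing].
Qed.

Let rho1 : (\int[leb]_x (rho x)%:E = 1)%E.
Proof.
rewrite (_ : (fun x => (rho x)%:E) = (fun x => (Z^-1)%:E * ((expR (a ^- 2 * Q x))%:E * (g x)%:E))%E); last first.
  by apply/funext => x; rewrite -!EFinM /rho mulrC.
have [mE _] := beQ.
rewrite ge0_integralZl//; last 3 first.
- by apply: emeasurable_funM; apply/measurable_EFinP.
- by move=> x _; rewrite mule_ge0// lee_fin ?expR_ge0 ?normal_pdf_ge0.
- by rewrite lee_fin invr_ge0 ltW.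
rewrite -(@ge0_integral_normal_prob R 0 1 (fun x => (expR (a ^- 2 * Q x))%:E)); last 2 first.
- exact/measurable_EFinP.
- by move=> x; rewrite lee_fin expR_ge0.
by rewrite (RintegralE gam beQ) -EFinM mulVf// gt_eqF.
Qed.

(** Transport the density g to rho = e^(a^-2 Q) g / Z by T, so that T' = t with t x = g x /
    rho (T x). For fixed x the function W (x, z) = phi (a T x + b z) - Q (T x) + a b (x - T
    x) z of z has mean 0, hence 1 <= E e^W. With S = a T x + b z and v = a z - b x,
    completing the square shows Z^(a^2) e^W g(x) g(z) = e^(phi S) g(S) g(v) t^(a^2), and
    t^(a^2) <= a^2 t + b^2. For fixed v the function (a^2 t + b^2) / a is the derivative of
    S in x, so that integrating in the variables (S, v) gives Z^(a^2) <= E e^phi <= 1. *)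
Lemma contraction1_normalized : \int[gam]_x expR (phi x) <= 1 -> Z <= 1.
Proof.
move=> phi1.
have [|T dT] := monotone_transport _ crho g0 rho0 (integral_normal_pdf 0 1) rho1.
  by apply: continuous_normal_pdf; rewrite oner_neq0.
pose t x := g x / rho (T x).
have cT : continuous T.
  move=> x; apply: differentiable_continuous; apply/derivable1_diffP.
  exact: (@ex_derive _ _ _ _ _ _ _ (dT x)).
have cQ : continuous Q by exact: continuous_normal_smoothing.
have crT : continuous (rho \o T).
  by move=> x; apply: continuous_comp; [exact: cT|exact: crho].
have ct : continuous t.
  move=> x; apply: cvgM; first by apply: continuous_normal_pdf; rewrite oner_neq0.
  by apply: cvgV; [rewrite gt_eqF|exact: crT].
have t0 x : 0 < t x by rewrite divr_gt0.
have mT : measurable_fun [set: rR] (T : _ -> rR).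
  exact: continuous_measurable_fun.
have mt : measurable_fun [set: rR] (t : _ -> rR).
  exact: continuous_measurable_fun.
have [mQ _] := bQ; have [mphi _] := bphi.
pose W (p : rR * rR) := phi (a * T p.1 + b * p.2) - Q (T p.1) + (a * b * (p.1 - T p.1)) * p.2.
have m1 : measurable_fun [set: rR * rR] (fst : _ -> rR) by exact: measurable_fst.
have m2 : measurable_fun [set: rR * rR] (snd : _ -> rR) by exact: measurable_snd.
have mT1 : measurable_fun [set: rR * rR] (fun p => T p.1 : rR).
  exact: (measurableT_comp mT m1).
have mS : measurable_fun [set: rR * rR] (fun p => a * T p.1 + b * p.2 : rR).
  by apply: measurable_funD; apply: measurable_funM.
have mW : measurable_fun [set: rR * rR] W.
  apply: measurable_funD; last first.
    apply: measurable_funM => //; apply: measurable_funM => //; exact: measurable_funB.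
  by apply: measurable_funB; [exact: (measurableT_comp mphi mS)|exact: (measurableT_comp mQ mT1)].
have meW : measurable_fun [set: rR * rR] (fun p => (expR (W p))%:E).
  by apply/measurable_EFinP; exact: measurableT_comp.
have step1 x : (1 <= \int[gam]_z (expR (W (x, z)))%:E)%E.
  apply: (@integral_expR_tilt (fun z => phi (a * T x + b * z) - Q (T x)) (a * b * (x - T x))).
    apply: bounded_measurableB; last exact: bounded_measurable_cst.
    apply: (bounded_measurable_comp bphi).
    by apply: measurable_funD => //; exact: measurable_funM.
  have bb : bounded_measurable (fun z : rR => phi (a * T x + b * z)).
    apply: (bounded_measurable_comp bphi).
    by apply: measurable_funD => //; exact: measurable_funM.
  rewrite (Rintegral_bdB gam bb (bounded_measurable_cst _ (Q (T x)))).
  by rewrite Rintegral_prob_cst subrr.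
have step2 : (1 <= \int[gam]_x \int[gam]_z (expR (W (x, z)))%:E)%E.
  have -> : (1 = \int[gam]_x 1)%E.
    by rewrite (RintegralE gam (bounded_measurable_cst _ 1)) Rintegral_prob_cst.
  apply: ge0_le_integral => //.
  exact: (@measurable_fun_fubini_tonelli_F _ _ _ _ R gam (fun p => (expR (W p))%:E)).
pose v (p : rR * rR) := a * p.2 - b * p.1.
pose S (p : rR * rR) := a * T p.1 + b * p.2.
pose H p := expR (phi (S p)) * g (S p) * g (v p) * (a ^+ 2 * t p.1 + b ^+ 2).
have H0 p : 0 <= H p.
  by rewrite /H !mulr_ge0 ?expR_ge0 ?normal_pdf_ge0// addr_ge0// mulr_ge0 ?sqr_ge0// ltW.
(* the square is completed here; expR (a ^+ 2 * ln Z) is Z^(a^2) *)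
have pointwise x z : expR (a ^+ 2 * ln Z) * (expR (W (x, z)) * g z * g x) <= H (x, z).
  pose u := ln Z - a ^- 2 * Q (T x) + (T x) ^+ 2 / 2 - x ^+ 2 / 2.
  have tE : t x = expR u.
    rewrite /t /rho /u !gE expRB expRD expRB lnK ?posrE// !expRN.
    have p1 : normal_peak (1 : R) != 0 by rewrite gt_eqF ?normal_peak_gt0 ?oner_neq0.
    by field; rewrite p1 !gt_eqF ?expR_gt0.
  have a21 : 0 <= a ^+ 2 <= 1.
    by rewrite sqr_ge0 /= -ab1 lerDl sqr_ge0.
  have := expR_weighted u a21; rewrite -tE.
  rewrite (_ : 1 - a ^+ 2 = b ^+ 2); last by rewrite -ab1; ring.
  move=> hw.
  apply: (@le_trans _ _ (expR (phi (S (x, z))) * g (S (x, z)) * g (v (x, z)) * expR (a ^+ 2 * u))); last first.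
    by rewrite /H ler_wpM2l// !mulr_ge0 ?expR_ge0 ?normal_pdf_ge0.
  rewrite !gE le_eqVlt; apply/orP; left; apply/eqP.
  set K := normal_peak 1.
  transitivity (K ^+ 2 * (expR (a ^+ 2 * ln Z + W (x, z) - z ^+ 2 / 2 - x ^+ 2 / 2))).
    by rewrite !expRD; ring.
  transitivity (K ^+ 2 * (expR (phi (S (x, z)) - (S (x, z)) ^+ 2 / 2 - (v (x, z)) ^+ 2 / 2 + a ^+ 2 * u))); last first.
    by rewrite !expRD; ring.
  congr (_ * expR _); rewrite /W /S /v /u /=.
  rewrite [LHS](_ : _ = a ^+ 2 * ln Z + (phi (a * T x + b * z) - Q (T x) + a * b * (x - T x) * z)
    - (a ^+ 2 + b ^+ 2) * z ^+ 2 / 2 - (a ^+ 2 + b ^+ 2) * x ^+ 2 / 2); last by rewrite ab1 !mul1r.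
  by field; rewrite gt_eqF.
have mg1 (f : rR * rR -> rR) :
    measurable_fun setT f -> measurable_fun setT (fun p => g (f p)).
  by move=> mf; exact: (measurableT_comp mg mf).
have mH : measurable_fun [set: rR * rR] H.
  apply: measurable_funM; last first.
    by apply: measurable_funD => //; apply: measurable_funM => //; exact: (measurableT_comp mt m1).
  apply: measurable_funM; last first.
    by apply: mg1; apply: measurable_funB; exact: measurable_funM.
  apply: measurable_funM; last exact: mg1.
  by apply: measurableT_comp => //; exact: (measurableT_comp mphi mS).
have meH : measurable_fun [set: rR * rR] (fun p => (H p)%:E).
  exact/measurable_EFinP.
have mge : measurable_fun [set: rR] (fun x => (g x)%:E) by exact/measurable_EFinP.
pose c := expR (a ^+ 2 * ln Z).
have step3 : (c%:E <= \int[leb]_x \int[leb]_z (H (x, z))%:E)%E.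
  apply: (@le_trans _ _ (c%:E * \int[gam]_x \int[gam]_z (expR (W (x, z)))%:E)%E).
    by rewrite -[leLHS]mule1 lee_wpmul2l// lee_fin expR_ge0.
  have mF := @measurable_fun_fubini_tonelli_F _ _ _ _ R gam (fun p => (expR (W p))%:E) meW
    (fun p => expR_ge0 (W p)).
  have F0 x : (0 <= fubini_F gam (fun p => (expR (W p))%:E) x)%E.
    by apply: integral_ge0 => z _; rewrite lee_fin expR_ge0.
  rewrite (ge0_integral_normal_prob 0 1 mF F0).
  rewrite -ge0_integralZl//; last 3 first.
  - by apply: emeasurable_funM.
  - by move=> x _; rewrite mule_ge0// lee_fin normal_pdf_ge0.
  - by rewrite lee_fin expR_ge0.
  apply: ge0_le_integral => //.
  - by move=> x _; rewrite !mule_ge0// lee_fin ?expR_ge0 ?normal_pdf_ge0.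
  - by apply: emeasurable_funM => //; exact: emeasurable_funM.
  - exact: (@measurable_fun_fubini_tonelli_F _ _ _ _ R leb (fun p => (H p)%:E)).
  move=> x _; rewrite /fubini_F.
  have mWx : measurable_fun [set: rR] (fun z => (expR (W (x, z)))%:E).
    exact: (measurableT_comp meW (pair1_measurable x)).
  rewrite (@ge0_integral_normal_prob R 0 1 (fun z => (expR (W (x, z)))%:E) mWx); last first.
    by move=> z; rewrite lee_fin expR_ge0.
  rewrite -ge0_integralZr//; last 3 first.
  - by apply: emeasurable_funM.
  - by move=> z _; rewrite mule_ge0// lee_fin ?expR_ge0 ?normal_pdf_ge0.
  - by rewrite lee_fin normal_pdf_ge0.
  rewrite -ge0_integralZl//; last 3 first.
  - by apply: emeasurable_funM => //; exact: emeasurable_funM.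
  - by move=> z _; rewrite !mule_ge0// lee_fin ?expR_ge0 ?normal_pdf_ge0.
  - by rewrite lee_fin expR_ge0.
  apply: ge0_le_integral => //.
  - by move=> z _; rewrite !mule_ge0// lee_fin ?expR_ge0 ?normal_pdf_ge0.
  - by apply: emeasurable_funM => //; apply: emeasurable_funM => //; exact: emeasurable_funM.
  - exact: (measurableT_comp meH (pair1_measurable x)).
  by move=> z _; rewrite -!EFinM lee_fin; exact: pointwise.
pose k (p : rR * rR) : rR := b / a * p.1 + a^-1 * p.2.
have mk : measurable_fun [set: rR * rR] k.
  by apply: measurable_funD; exact: measurable_funM.
have mH' : measurable_fun [set: rR * rR]
    (fun p => (H (p.1, k p) * a^-1)%:E).
  apply/measurable_EFinP; apply: measurable_funM => //.
  apply: (measurableT_comp mH); exact/measurable_fun_pair.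
(* first z -> v at fixed x, then x -> S at fixed v, where S has derivative (a^2 t + b^2) / a *)
have step4 : (\int[leb]_x \int[leb]_z (H (x, z))%:E = \int[gam]_y (expR (phi y))%:E)%E.
  transitivity (\int[leb]_x \int[leb]_v (H (x, k (x, v)) * a^-1)%:E)%E.
    apply: eq_integral => x _.
    rewrite (@ge0_integral_affine R (b / a * x) a^-1 (fun z => (H (x, z))%:E))//.
    - by rewrite invr_gt0.
    - exact: (measurableT_comp meH (pair1_measurable x)).
    - by move=> z; rewrite lee_fin.
  transitivity (\int[leb]_w \int[leb]_x (H (x, k (x, w)) * a^-1)%:E)%E.
    apply: (@fubini_tonelli _ _ _ _ R leb leb (fun p => (H (p.1, k p) * a^-1)%:E) mH').
    by move=> p; rewrite lee_fin mulr_ge0// invr_ge0 ltW.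
  have mf y0 : measurable_fun [set: rR]
      (fun y => (expR (phi y))%:E * (g y)%:E * (g y0)%:E)%E.
    apply: emeasurable_funM => //; apply: emeasurable_funM => //.
    by apply/measurable_EFinP; exact: measurableT_comp.
  transitivity (\int[leb]_w \int[leb]_y ((expR (phi y))%:E * (g y)%:E * (g w)%:E))%E.
    apply: eq_integral => w _; apply/esym.
    pose Sw x := a * T x + b * k (x, w).
    pose sw x := (a ^+ 2 * t x + b ^+ 2) / a.
    have dSw (x : R) : is_derive x (1 : R) Sw (sw x).
      have hk : is_derive (x : R) (1 : R) (cst (b * (a^-1 * w)) + (b * (b / a)) *: (@id R))
         (0 + (b * (b / a)) *: (1 : R)).
        exact: (is_deriveD (is_derive_cst _ x 1) (is_deriveZ _ (is_derive_id x 1))).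
      have hS := is_deriveD (is_deriveZ a (dT x)) hk.
      have -> : Sw = (a *: T + (cst (b * (a^-1 * w)) + (b * (b / a)) *: (@id R))).
        by apply/funext => y; rewrite /Sw /k /= !fctE /GRing.scale /=; ring.
      apply: (is_derive_eq hS); rewrite /sw /GRing.scale /= -/(t x).
      by field; rewrite gt_eqF.
    have ba0 : 0 < b ^+ 2 / a by rewrite divr_gt0// exprn_gt0.
    have csw : continuous sw.
      move=> x; apply: cvgM; last exact: cvg_cst.
      apply: (@cvgD _ R^o); last exact: cvg_cst.
      by apply: cvgM; [exact: cvg_cst|exact: ct].
    have bsw x : b ^+ 2 / a <= sw x.
      by rewrite /sw ler_pM2r ?invr_gt0// lerDr mulr_ge0 ?sqr_ge0// ltW.
    have f0 y : (0 <= (expR (phi y))%:E * (g y)%:E * (g w)%:E)%E.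
      by rewrite !mule_ge0// lee_fin ?expR_ge0 ?normal_pdf_ge0.
    rewrite (@ge0_integral_substitution R Sw sw (b ^+ 2 / a) _ ba0 dSw csw bsw (mf w) f0).
    apply: eq_integral => x _; rewrite -!EFinM; congr EFin.
    rewrite /H /S /v /k /sw /=.
    have -> : a * (b / a * x + a^-1 * w) - b * x = w by field; rewrite gt_eqF.
    by rewrite !mulrA.
  transitivity (\int[leb]_w ((\int[gam]_y (expR (phi y))%:E) * (g w)%:E))%E.
    apply: eq_integral => w _.
    rewrite (@ge0_integral_normal_prob R 0 1 (fun y => (expR (phi y))%:E)); last 2 first.
    - by apply/measurable_EFinP; exact: measurableT_comp.
    - by move=> y; rewrite lee_fin expR_ge0.
    rewrite -ge0_integralZr//.
    - apply: emeasurable_funM => //.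
      by apply/measurable_EFinP; exact: measurableT_comp.
    - by move=> y _; rewrite mule_ge0// lee_fin ?expR_ge0 ?normal_pdf_ge0.
    - by rewrite lee_fin normal_pdf_ge0.
  rewrite ge0_integralZl//.
  - by rewrite integral_normal_pdf mule1.
  - by move=> y _; rewrite lee_fin normal_pdf_ge0.
  - by apply: integral_ge0 => y _; rewrite lee_fin expR_ge0.
move: step3; rewrite step4 (RintegralE gam (bounded_measurable_expR bphi)) lee_fin /c => h.
have : expR (a ^+ 2 * ln Z) <= 1 by rewrite (le_trans h).
rewrite -expR0 ler_expR pmulr_rle0 ?exprn_gt0// => lnZ.
by rewrite -ler_ln ?posrE ?expR_gt0// expRK.
Qed.
End contraction1.

(** * Tensorization *)

(** The transition operator of x |-> A (x, Z) with Z of law mu; it is the Mehler operator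
    when mu is Gaussian and A an affine combination. *)
Definition smoothing d (T : measurableType d) (R : realType) (mu : probability T R)
  (A : T * T -> T) (phi : T -> R) (x : T) : R := \int[mu]_z phi (A (x, z)).

(** This is dual to a contraction of relative entropy by the factor r^-1, see
    [KL_contraction]; in this form it tensorizes. *)
Definition exp_contractive d (T : measurableType d) (R : realType)
    (mu : probability T R) (A : T * T -> T) (r : R) : Prop :=
  forall phi : T -> R, bounded_measurable phi -> \int[mu]_x expR (phi x) <= 1 ->
  \int[mu]_x expR (r * smoothing mu A phi x) <= 1.

Lemma smoothing_bounded_measurable d (T : measurableType d) (R : realType)
    (mu : probability T R) (A : T * T -> T) (phi : T -> R) :
  measurable_fun [set: T * T] A -> bounded_measurable phi ->
  bounded_measurable (smoothing mu A phi).
Proof.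
move=> mA bphi.
exact: (bounded_Rintegral mu mu (bounded_measurable_comp bphi mA)).
Qed.

(** Jensen's inequality for y |-> y^r, in the form that y^r lies above its tangent at the
    mean s, against the weight N of mass at most 1. *)
Lemma jensen_weighted d (T : measurableType d) (R : realType) (mu : probability T R)
    (h N : T -> R) (r : R) : 1 <= r ->
  bounded_measurable h -> bounded_measurable N -> (forall x, 0 <= N x) ->
  \int[mu]_x N x <= 1 -> 0 < \int[mu]_x (expR (h x) * N x) ->
  expR (r * ln (\int[mu]_x (expR (h x) * N x))) <= \int[mu]_x (expR (r * h x) * N x).
Proof.
move=> r1 bh bN N0 N1; set s := \int[mu]_x _ => s0.
have r0 : 0 < r by rewrite (lt_le_trans _ r1).
pose c := ln s.
have ec : expR c = s by rewrite lnK ?posrE.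
have beh : bounded_measurable (fun x => expR (h x)) by exact: bounded_measurable_expR.
have beN := bounded_measurableM beh bN.
have key x : (1 - r) * N x + r * expR (- c) * (expR (h x) * N x) <=
    expR (- (r * c)) * (expR (r * h x) * N x).
  have -> : expR (- (r * c)) * (expR (r * h x) * N x) = expR (r * (h x - c)) * N x.
    by rewrite mulrA -expRD; congr (expR _ * _); ring.
  have -> : (1 - r) * N x + r * expR (- c) * (expR (h x) * N x) =
      (1 - r + r * expR (h x - c)) * N x.
    by rewrite expRD; ring.
  rewrite ler_wpM2r//.
  have t01 : 0 <= r^-1 <= 1 by rewrite invr_ge0 ltW//= invf_le1.
  have := expR_weighted (r * (h x - c)) t01.
  rewrite mulKf ?gt_eqF// => hw.
  have := ler_wpM2l (ltW r0) hw.
  set E := expR (r * (h x - c)).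
  rewrite (_ : r * (r^-1 * E + (1 - r^-1)) = E + r - 1); first lra.
  by field; rewrite gt_eqF.
have brh : bounded_measurable (fun x => expR (r * h x) * N x).
  apply: bounded_measurableM => //; apply: bounded_measurable_expR.
  exact: bounded_measurableZ.
have /= := le_Rintegral_bd mu
  (bounded_measurableD (bounded_measurableZ (1 - r) bN) (bounded_measurableZ (r * expR (- c)) beN))
  (bounded_measurableZ (expR (- (r * c))) brh) key.
rewrite (Rintegral_bdD mu (bounded_measurableZ (1 - r) bN)
  (bounded_measurableZ (r * expR (- c)) beN)).
rewrite (Rintegral_bdZ mu _ bN) (Rintegral_bdZ mu _ beN) (Rintegral_bdZ mu _ brh).
rewrite -/s -mulrA -[X in expR (- c) * X]ec -expRD addNr expR0 mulr1 => hi.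
rewrite -[leLHS]mulr1 -[X in _ <= X]mul1r -(expRxMexpNx_1 (r * ln s)) -mulrA.
rewrite ler_pM2l ?expR_gt0//; apply: le_trans hi.
have := mulr_ge0 (_ : 0 <= r - 1) (_ : 0 <= 1 - \int[mu]_x N x); rewrite !subr_ge0.
by move=> /(_ r1 N1); rewrite expRxMexpNx_1; lra.
Qed.

Section tensorization.
Context d1 d2 (T1 : measurableType d1) (T2 : measurableType d2) (R : realType).
Context (mu1 : probability T1 R) (mu2 : probability T2 R).
Context (A1 : T1 * T1 -> T1) (A2 : T2 * T2 -> T2) (r : R).
Context (mA1 : measurable_fun [set: T1 * T1] A1)
        (mA2 : measurable_fun [set: T2 * T2] A2).

Definition product_action (p : (T1 * T2) * (T1 * T2)) : T1 * T2 :=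
  (A1 (p.1.1, p.2.1), A2 (p.1.2, p.2.2)).

Lemma measurable_product_action : measurable_fun [set: (T1 * T2) * (T1 * T2)] product_action.
Proof.
apply: measurable_fun_pair.
- apply: (measurableT_comp mA1); apply: measurable_fun_pair.
    exact: (measurableT_comp measurable_fst measurable_fst).
  exact: (measurableT_comp measurable_fst measurable_snd).
- apply: (measurableT_comp mA2); apply: measurable_fun_pair.
    exact: (measurableT_comp measurable_snd measurable_fst).
  exact: (measurableT_comp measurable_snd measurable_snd).
Qed.

(** Smooth in x first. Let N y be the integral of e^(psi (x, y)) over x, and P1 the
    smoothing in x of psi. At fixed y the first hypothesis, applied to psi - ln N, bounds
    the integral of e^(r (P1 - ln N)) over x by 1. At fixed x the second hypothesis bounds
    the integral of e^(r P1') over y, where P1' is the smoothing in y of P1, by M^r with M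
    the integral of e^P1 over y. Jensen's inequality with weight N bounds M^r by the
    integral of e^(r (P1 - ln N)) N over y, and it remains to integrate over x. *)
Lemma exp_contractive_product : 1 <= r ->
  exp_contractive mu1 A1 r -> exp_contractive mu2 A2 r ->
  exp_contractive (mu1 \x mu2)%E product_action r.
Proof.
move=> r1 c1 c2 psi bpsi psi1.
have bepsi := bounded_measurable_expR bpsi.
have msw : measurable_fun [set: T2 * T1] (fun p : T2 * T1 => (p.2, p.1)).
  exact: measurable_fun_pair.
have bpsiT : bounded_measurable (fun p : T2 * T1 => psi (p.2, p.1)).
  exact: (bounded_measurable_comp bpsi msw).
pose N (y : T2) := \int[mu1]_x expR (psi (x, y)).
have bN : bounded_measurable N.
  exact: (bounded_Rintegral mu2 mu1 (bounded_measurable_expR bpsiT)).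
have [c c0 cpsi] := bounded_measurable_expR_lb bpsi.
have cN y : c <= N y.
  rewrite -(Rintegral_prob_cst mu1 c); apply: le_Rintegral_bd => //.
  - exact: bounded_measurable_cst.
  - exact: (bounded_measurable_pair2 y bepsi).
have N0 y : 0 < N y by rewrite (lt_le_trans c0).
have bL : bounded_measurable (fun y => ln (N y)) := bounded_measurable_ln c0 bN cN.
have N1 : \int[mu2]_y N y <= 1.
  by rewrite /N -(Rintegral_fubini_swap mu1 mu2 bepsi) -(Rintegral_fubini mu1 mu2 bepsi).
pose P1 (p : T1 * T2) := \int[mu1]_z psi (A1 (p.1, z), p.2).
have bP1z : bounded_measurable (fun q : (T1 * T2) * T1 => psi (A1 (q.1.1, q.2), q.1.2)).
  apply: (bounded_measurable_comp bpsi (g := fun q : (T1 * T2) * T1 => (A1 (q.1.1, q.2), q.1.2))).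
  apply: measurable_fun_pair; last exact: (measurableT_comp measurable_snd measurable_fst).
  apply: (measurableT_comp mA1); apply: measurable_fun_pair => //.
  exact: (measurableT_comp measurable_fst measurable_fst).
have bP1 : bounded_measurable P1.
  exact: (bounded_Rintegral (mu1 \x mu2)%E mu1 bP1z).
have stepA y : \int[mu1]_x expR (r * (P1 (x, y) - ln (N y))) <= 1.
  have bp : bounded_measurable (fun x => psi (x, y) - ln (N y)).
    by apply: bounded_measurableB; [exact: (bounded_measurable_pair2 y bpsi)|exact: bounded_measurable_cst].
  have := c1 _ bp.
  rewrite (Rintegral_expR_normalized mu1 (bounded_measurable_pair2 y bpsi)) => /(_ (lexx 1)).
  suff -> : \int[mu1]_x expR (r * smoothing mu1 A1 (fun x => psi (x, y) - ln (N y)) x) =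
      \int[mu1]_x expR (r * (P1 (x, y) - ln (N y))) by [].
  apply: eq_Rintegral => x _; congr (expR (r * _)).
  have bz : bounded_measurable (fun z => psi (A1 (x, z), y)).
    exact: (bounded_measurable_pair1 (x, y) bP1z).
  by rewrite /smoothing (Rintegral_bdB mu1 bz (bounded_measurable_cst _ _)) Rintegral_prob_cst.
pose M (x : T1) := \int[mu2]_y expR (P1 (x, y)).
have bP1x x : bounded_measurable (fun y => P1 (x, y)) by exact: (bounded_measurable_pair1 x bP1).
have M0 x : 0 < M x := Rintegral_expR_gt0 mu2 (bP1x x).
have bS2 x : bounded_measurable (smoothing mu2 A2 (fun y => P1 (x, y))).
  exact: smoothing_bounded_measurable.
have stepB x : \int[mu2]_y expR (r * smoothing mu2 A2 (fun y => P1 (x, y)) y) <= expR (r * ln (M x)).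
  have bp : bounded_measurable (fun y => P1 (x, y) - ln (M x)).
    by apply: bounded_measurableB => //; exact: bounded_measurable_cst.
  have := c2 _ bp.
  rewrite (Rintegral_expR_normalized mu2 (bP1x x)) => /(_ (lexx 1)).
  have -> : \int[mu2]_y expR (r * smoothing mu2 A2 (fun y => P1 (x, y) - ln (M x)) y) =
      expR (- (r * ln (M x))) * \int[mu2]_y expR (r * smoothing mu2 A2 (fun y => P1 (x, y)) y).
    rewrite -Rintegral_bdZ; last first.
      by apply: bounded_measurable_expR; exact: bounded_measurableZ.
    apply: eq_Rintegral => y _; rewrite -expRD; congr expR.
    rewrite /smoothing Rintegral_bdB.
    - by rewrite Rintegral_prob_cst; ring.
    - apply: (bounded_measurable_comp (bP1x x)).
      exact: (measurableT_comp mA2 (pair1_measurable y)).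
    - exact: bounded_measurable_cst.
  by rewrite expRN -ler_pdivlMl ?invr_gt0 ?expR_gt0// invrK mulr1.
have bPL : bounded_measurable (fun p => P1 p - ln (N p.2)).
  by apply: bounded_measurableB => //; exact: (bounded_measurable_comp bL measurable_snd).
have stepC x : expR (r * ln (M x)) <= \int[mu2]_y (expR (r * (P1 (x, y) - ln (N y))) * N y).
  have ME : M x = \int[mu2]_y (expR (P1 (x, y) - ln (N y)) * N y).
    apply: eq_Rintegral => y _; rewrite expRB lnK ?posrE// mulrVK//.
    by rewrite unitfE gt_eqF.
  rewrite ME; apply: jensen_weighted => //.
  - exact: (bounded_measurable_pair1 x bPL).
  - by move=> y; exact: ltW.
  - by rewrite -ME.
have bD : bounded_measurable (fun p : T1 * T2 => expR (r * (P1 p - ln (N p.2))) * N p.2).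
  apply: bounded_measurableM; last exact: (bounded_measurable_comp bN measurable_snd).
  by apply: bounded_measurable_expR; exact: bounded_measurableZ.
have sE x y : smoothing (mu1 \x mu2)%E product_action psi (x, y) =
    smoothing mu2 A2 (fun y => P1 (x, y)) y.
  have bpa : bounded_measurable (fun z => psi (product_action ((x, y), z))).
    apply: (bounded_measurable_comp bpsi).
    exact: (measurableT_comp measurable_product_action (pair1_measurable (x, y))).
  rewrite /smoothing Rintegral_fubini// (Rintegral_fubini_swap mu1 mu2 bpa).
  by [].
have bsm : bounded_measurable (smoothing (mu1 \x mu2)%E product_action psi).
  apply: smoothing_bounded_measurable => //; exact: measurable_product_action.
have bes := bounded_measurable_expR (bounded_measurableZ r bsm).
rewrite (Rintegral_fubini mu1 mu2 bes).
apply: (@le_trans _ _ (\int[mu1]_x \int[mu2]_y (expR (r * (P1 (x, y) - ln (N y))) * N y))).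
  apply: le_Rintegral_bd.
  - exact: (bounded_Rintegral mu1 mu2 bes).
  - exact: (bounded_Rintegral mu1 mu2 bD).
  - move=> x; apply: le_trans (stepC x); apply: le_trans (stepB x).
    by under eq_Rintegral do rewrite sE.
rewrite (Rintegral_fubini_swap mu1 mu2 bD) /=.
apply: le_trans N1; apply: le_Rintegral_bd => //.
- exact: (bounded_Rintegral mu2 mu1 (f := fun p : T2 * T1 => expR (r * (P1 (p.2, p.1) - ln (N p.1))) * N p.1)
    (bounded_measurable_comp bD msw)).
- move=> y.
  under eq_Rintegral do rewrite mulrC.
  have by_ : bounded_measurable (fun x => expR (r * (P1 (x, y) - ln (N y)))).
    apply: bounded_measurable_expR; apply: bounded_measurableZ.
    exact: (bounded_measurable_pair2 y bPL).
  rewrite (Rintegral_bdZ mu1 _ by_) -[leRHS]mulr1 ler_wpM2l//; exact: ltW.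
Qed.

End tensorization.

(** * Gaussian measures on tuples *)

(** Only integrals of bounded functions are involved, so the property passes to the image of
    mu1 under a map that intertwines A1 and A2. *)
Lemma exp_contractive_transfer d1 d2 (T1 : measurableType d1) (T2 : measurableType d2)
    (R : realType) (mu1 : probability T1 R) (mu2 : probability T2 R)
    (A1 : T1 * T1 -> T1) (A2 : T2 * T2 -> T2) (iota : T1 -> T2) (r : R) :
  measurable_fun [set: T1] iota -> measurable_fun [set: T2 * T2] A2 ->
  (forall f, bounded_measurable f -> \int[mu2]_y f y = \int[mu1]_x f (iota x)) ->
  (forall x z, A2 (iota x, iota z) = iota (A1 (x, z))) ->
  exp_contractive mu1 A1 r -> exp_contractive mu2 A2 r.
Proof.
move=> mi mA2 mu12 A12 c1 phi bphi.
have bi : bounded_measurable (phi \o iota) by exact: bounded_measurable_comp.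
have be := bounded_measurable_expR bphi.
have bs := smoothing_bounded_measurable mu2 mA2 bphi.
have bes := bounded_measurable_expR (bounded_measurableZ r bs).
rewrite (mu12 _ be) (mu12 _ bes) => /(c1 _ bi).
suff -> : \int[mu1]_x expR (r * smoothing mu1 A1 (phi \o iota) x) =
    \int[mu1]_x expR (r * smoothing mu2 A2 phi (iota x)) by [].
apply: eq_Rintegral => x _; congr (expR (r * _)); rewrite /smoothing mu12.
  by apply: eq_Rintegral => z _; rewrite A12.
exact: (bounded_measurable_comp bphi (measurableT_comp mA2 (pair1_measurable (iota x)))).
Qed.

Section affine_tuple.
Context (R : realType).
Local Notation rR := (measurableTypeR R).

Definition affine_tuple (a b : R) n (p : n.-tuple R * n.-tuple R) : n.-tuple R :=
  [tuple a * tnth p.1 i + b * tnth p.2 i | i < n].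

Definition scale_tuple (a : R) n (x : n.-tuple R) : n.-tuple R :=
  [tuple a * tnth x i | i < n].

Lemma measurable_affine_tuple a b n :
  measurable_fun [set: n.-tuple R * n.-tuple R] (@affine_tuple a b n).
Proof.
apply/measurable_fun_tnthP => i.
rewrite (_ : _ \o _ = fun p => a * tnth p.1 i + b * tnth p.2 i); last first.
  by apply/funext => p; rewrite /= tnth_mktuple.
apply: measurable_funD; apply: measurable_funM => //.
- exact: (measurableT_comp (measurable_tnth i) measurable_fst).
- exact: (measurableT_comp (measurable_tnth i) measurable_snd).
Qed.

Lemma measurable_scale_tuple a n : measurable_fun [set: n.-tuple R] (@scale_tuple a n).
Proof.
apply/measurable_fun_tnthP => i.
rewrite (_ : _ \o _ = fun p => a * tnth p i); last first.
  by apply/funext => p; rewrite /= tnth_mktuple.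
by apply: measurable_funM => //; exact: measurable_tnth.
Qed.

Lemma affine_tuple_cons a b n (p q : rR * n.-tuple R) :
  affine_tuple a b (cons_pair p, cons_pair q) =
  cons_pair (a * p.1 + b * q.1, affine_tuple a b (p.2, q.2)).
Proof.
apply: eq_from_tnth => i; rewrite tnth_mktuple /=.
by case: (unliftP ord0 i) => [j ->|->]; rewrite ?tnthS ?tnth0// tnth_mktuple.
Qed.

Lemma scale_tuple_cons a n (p : rR * n.-tuple R) :
  scale_tuple a (cons_pair p) = cons_pair (a * p.1, scale_tuple a p.2).
Proof.
apply: eq_from_tnth => i; rewrite tnth_mktuple /=.
by case: (unliftP ord0 i) => [j ->|->]; rewrite ?tnthS ?tnth0// tnth_mktuple.
Qed.

Lemma Rintegral_gaussianS_prod (s : R) n (f : n.+1.-tuple R -> R) : bounded_measurable f ->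
  \int[gaussian s n.+1]_x f x =
  \int[(normal_prob 0 s \x gaussian s n)%E]_p f (cons_pair p).
Proof. by move=> bf; exact: Rintegral_bd_distribution. Qed.

Lemma bounded_measurable_cons n (f : n.+1.-tuple R -> R) : bounded_measurable f ->
  bounded_measurable (fun p : rR * n.-tuple R => f (cons_pair p)).
Proof. by move=> bf; exact: (bounded_measurable_comp bf (@measurable_cons_pair R n)). Qed.

Lemma Rintegral_gaussianS (s : R) n (f : n.+1.-tuple R -> R) : bounded_measurable f ->
  \int[gaussian s n.+1]_x f x =
  \int[normal_prob 0 s]_x \int[gaussian s n]_y f (cons_pair (x, y)).
Proof.
move=> bf; rewrite Rintegral_gaussianS_prod//.
exact: (Rintegral_fubini (normal_prob 0 s) (gaussian s n) (bounded_measurable_cons bf)).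
Qed.

Lemma Rintegral_gaussian0 (s : R) (f : 0.-tuple R -> R) : bounded_measurable f ->
  \int[gaussian s 0]_x f x = f [tuple].
Proof.
move=> [mf _]; rewrite /Rintegral integral_dirac//; last exact/measurable_EFinP.
by rewrite diracT mul1e.
Qed.

Lemma gaussian_exp_contractive1 (a b : R) n : 0 < a -> 0 < b -> a ^+ 2 + b ^+ 2 = 1 ->
  exp_contractive (gaussian 1 n) (@affine_tuple a b n) (a ^- 2).
Proof.
move=> a0 b0 ab1.
have a2 : 1 <= a ^- 2.
  by rewrite invf_ge1 ?exprn_gt0// -ab1 lerDl sqr_ge0.
elim: n => [phi bphi|n IH].
  have bs := smoothing_bounded_measurable (gaussian 1 0) (@measurable_affine_tuple a b 0) bphi.
  rewrite (Rintegral_gaussian0 1 (bounded_measurable_expR bphi)).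
  rewrite (Rintegral_gaussian0 1 (bounded_measurable_expR (bounded_measurableZ (a ^- 2) bs))).
  rewrite !expR_le1 => h; rewrite pmulr_rle0 ?invr_gt0 ?exprn_gt0//.
  rewrite /smoothing Rintegral_gaussian0; last first.
    exact: (bounded_measurable_comp bphi (measurableT_comp (@measurable_affine_tuple a b 0) (pair1_measurable ([tuple] : 0.-tuple R)))).
  by rewrite (tuple0 (affine_tuple _ _ _)).
pose A1 (p : rR * rR) : rR := a * p.1 + b * p.2.
have mA1 : measurable_fun setT A1.
  by apply: measurable_funD; exact: measurable_funM.
have c1 : exp_contractive (normal_prob 0 1) A1 (a ^- 2).
  by move=> phi bphi; exact: contraction1_normalized.
have := exp_contractive_product mA1 (@measurable_affine_tuple a b n) a2 c1 IH.
apply: (exp_contractive_transfer (iota := @cons_pair R n)).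
- exact: measurable_cons_pair.
- exact: measurable_affine_tuple.
- by move=> f bf; exact: Rintegral_gaussianS_prod.
- by move=> x z; rewrite affine_tuple_cons.
Qed.

Lemma Rintegral_gaussian_scale (s : R) n (f : n.-tuple R -> R) : 0 < s ->
  bounded_measurable f ->
  \int[gaussian s n]_x f x = \int[gaussian 1 n]_x f (scale_tuple s x).
Proof.
move=> s0; elim: n f => [|n IH] f bf.
  rewrite !Rintegral_gaussian0//.
    by rewrite (tuple0 (scale_tuple _ _)).
  exact: (bounded_measurable_comp bf (@measurable_scale_tuple s 0)).
have bfs : bounded_measurable (fun x => f (scale_tuple s x)).
  exact: (bounded_measurable_comp bf (@measurable_scale_tuple s n.+1)).
rewrite [LHS](Rintegral_gaussianS s bf) [RHS](Rintegral_gaussianS 1 bfs).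
have bc := bounded_measurable_cons bf.
rewrite (Rintegral_normal_prob_affine 0 s0 (bounded_Rintegral (normal_prob 0 1) (gaussian s n) bc)).
apply: eq_Rintegral => x _; rewrite add0r.
rewrite (IH _ (bounded_measurable_pair1 (s * x) bc)).
by apply: eq_Rintegral => y _; rewrite scale_tuple_cons.
Qed.

Lemma gaussian_exp_contractive (s a b : R) n : 0 < s -> 0 < a -> 0 < b ->
  a ^+ 2 + b ^+ 2 = 1 ->
  exp_contractive (gaussian s n) (@affine_tuple a b n) (a ^- 2).
Proof.
move=> s0 a0 b0 ab1; have := @gaussian_exp_contractive1 a b n a0 b0 ab1.
apply: (exp_contractive_transfer (iota := @scale_tuple s n)).
- exact: measurable_scale_tuple.
- exact: measurable_affine_tuple.
- by move=> f bf; exact: Rintegral_gaussian_scale.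
- move=> x z; apply: eq_from_tnth => i; rewrite /affine_tuple /scale_tuple !tnth_mktuple /=.
  by rewrite ?tnth_mktuple; ring.
Qed.

(** The joint density of (x, a x + b z) is symmetric because a^2 + b^2 = 1, so its two
    coordinates have the same law. *)
Lemma ge0_integral_normal_prob_convolution (a b : R) (f : rR -> \bar R) :
  0 < b -> a ^+ 2 + b ^+ 2 = 1 ->
  measurable_fun [set: rR] f -> (forall x, 0 <= f x)%E ->
  (\int[normal_prob 0 1]_x \int[normal_prob 0 1]_z f (a * x + b * z)%R =
   \int[normal_prob 0 1]_y f y)%E.
Proof.
move=> b0 ab1 mf f0.
pose leb := @lebesgue_measure R.
pose g := @normal_pdf R 0 1.
have mg : measurable_fun [set: rR] (fun x => (g x)%:E).
  by apply/measurable_EFinP; exact: measurable_normal_pdf.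
have g0 x : (0 <= (g x)%:E)%E by rewrite lee_fin normal_pdf_ge0.
have bn0 : b != 0 by rewrite gt_eqF.
have swap_pdf x y : normal_pdf (a * x) b y * g x = normal_pdf (a * y) b x * g y.
  rewrite /g !normal_pdfE ?oner_neq0// /normal_fun !subr0.
  rewrite mulrACA [RHS]mulrACA; congr (_ * _); rewrite -!expRD; congr expR.
  rewrite -[b ^+ 2 *+ 2]mulr_natr -[1 ^+ 2 *+ 2]mulr_natr expr1n.
  have -> : a ^+ 2 = 1 - b ^+ 2 -> - (y - a * x) ^+ 2 / (b ^+ 2 * 2) + - x ^+ 2 / (1 * 2) =
    - (x - a * y) ^+ 2 / (b ^+ 2 * 2) + - y ^+ 2 / (1 * 2).
    move=> a2.
    have -> : (y - a * x) ^+ 2 = y ^+ 2 - 2 * a * x * y + a ^+ 2 * x ^+ 2 by ring.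
    have -> : (x - a * y) ^+ 2 = x ^+ 2 - 2 * a * x * y + a ^+ 2 * y ^+ 2 by ring.
    by rewrite a2; field.
  by [].
  by rewrite -ab1; ring.
pose h (p : rR * rR) : R := normal_pdf (a * p.1) b p.2 * g p.1.
have mh : measurable_fun [set: rR * rR] (fun p => (h p)%:E).
  apply/measurable_EFinP; apply: measurable_funM; last first.
    by apply: (measurableT_comp (measurable_normal_pdf 0 1)); exact: measurable_fst.
  rewrite (_ : (fun _ => _) = fun p : rR * rR =>
    normal_pdf 0 1 ((p.2 - a * p.1) / b) / b); last first.
    apply/funext => p; rewrite -(normal_pdf_affine (a * p.1) _ b0) mulfK//.
    by congr normal_pdf; field.
  apply: measurable_funM => //.
  apply: (measurableT_comp (measurable_normal_pdf 0 1)).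
  apply: measurable_funM => //; apply: measurable_funB => //.
  by apply: measurable_funM.
have h0 p : (0 <= (h p)%:E)%E by rewrite lee_fin mulr_ge0 ?normal_pdf_ge0.
have mF : measurable_fun [set: rR * rR]
    (fun p => f (a * p.1 + b * p.2)).
  apply: (measurableT_comp mf); apply: measurable_funD; exact: measurable_funM.
rewrite (ge0_integral_normal_prob 0 1 (f := fun x => \int[normal_prob 0 1]_z f (a * x + b * z)%R)%E); last 2 first.
- exact: (measurable_fun_fubini_tonelli_F (m2 := normal_prob 0 1) (fun p => f (a * p.1 + b * p.2))).
- by move=> x; exact: integral_ge0.
transitivity (\int[leb]_x \int[leb]_y (f y * (h (x, y))%:E))%E.
  apply: eq_integral => x _.
  rewrite -(ge0_integral_normal_prob_affine (a * x) b0 mf f0).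
  rewrite (ge0_integral_normal_prob (a * x) b mf f0) -ge0_integralZr//.
  - by apply: eq_integral => y _; rewrite -muleA -EFinM.
  - by apply: emeasurable_funM => //; apply/measurable_EFinP; exact: measurable_normal_pdf.
  - by move=> y _; rewrite mule_ge0// lee_fin normal_pdf_ge0.
transitivity (\int[leb]_y \int[leb]_x (f y * (h (x, y))%:E))%E.
  apply: (@fubini_tonelli _ _ _ _ R leb leb (fun p => f p.2 * (h p)%:E)%E).
  - by apply: emeasurable_funM => //; exact: (measurableT_comp mf measurable_snd).
  - by move=> p; rewrite mule_ge0.
rewrite (ge0_integral_normal_prob 0 1 mf f0).
apply: eq_integral => y _.
transitivity (\int[leb]_x ((f y * (g y)%:E) * (normal_pdf (a * y) b x)%:E))%E.
  by apply: eq_integral => x _; rewrite /h /= swap_pdf mulrC EFinM muleA.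
rewrite ge0_integralZl//.
- by rewrite integral_normal_pdf mule1.
- by apply/measurable_EFinP; exact: measurable_normal_pdf.
- by move=> x _; rewrite lee_fin normal_pdf_ge0.
- by rewrite mule_ge0.
Qed.

Lemma Rintegral_normal_prob_convolution (a b : R) (f : rR -> R) :
  0 < b -> a ^+ 2 + b ^+ 2 = 1 -> bounded_measurable f ->
  \int[normal_prob 0 1]_x \int[normal_prob 0 1]_z f (a * x + b * z) =
  \int[normal_prob 0 1]_y f y.
Proof.
move=> b0 ab1 bf; have [mf [M fM]] := bf.
have bF : bounded_measurable (fun p : rR * rR => f (a * p.1 + b * p.2)).
  by apply: (bounded_measurable_comp bf); apply: measurable_funD; exact: measurable_funM.
have fM0 x : (0 <= (f x + M)%:E)%E.
  by rewrite lee_fin; have := fM x; rewrite ler_norml => /andP[? _]; lra.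
have mfM : measurable_fun [set: rR] (fun x => (f x + M)%:E).
  by apply/measurable_EFinP; exact: measurable_funD.
have := ge0_integral_normal_prob_convolution b0 ab1 mfM fM0.
have bfM : bounded_measurable (fun x => f x + M).
  by apply: bounded_measurableD => //; exact: bounded_measurable_cst.
rewrite (RintegralE (normal_prob 0 1) bfM) (Rintegral_bdDcst _ M bf).
have bI := bounded_Rintegral (normal_prob 0 1) (normal_prob 0 1) bF.
have -> : (\int[normal_prob 0 1]_x \int[normal_prob 0 1]_z (f (a * x + b * z)%R + M)%:E =
    (\int[normal_prob 0 1]_x \int[normal_prob 0 1]_z f (a * x + b * z) + M)%:E)%E.
  rewrite -(Rintegral_bdDcst _ M bI) -RintegralE; last first.
    by apply: bounded_measurableD => //; exact: bounded_measurable_cst.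
  apply: eq_integral => x _.
  have bx := bounded_measurable_pair1 x bF.
  rewrite -(Rintegral_bdDcst _ M bx) -RintegralE//.
  by apply: bounded_measurableD => //; exact: bounded_measurable_cst.
by move=> [] /addIr.
Qed.

End affine_tuple.

Section gaussian_convolution.
Context (R : realType).
Local Notation rR := (measurableTypeR R).

Lemma gaussian_convolution1 (a b : R) n (f : n.-tuple R -> R) : 0 < b ->
  a ^+ 2 + b ^+ 2 = 1 -> bounded_measurable f ->
  \int[gaussian 1 n]_x \int[gaussian 1 n]_z f (affine_tuple a b (x, z)) =
  \int[gaussian 1 n]_y f y.
Proof.
move=> b0 ab1; elim: n f => [|n IH] f bf.
  have bF := bounded_measurable_comp bf (@measurable_affine_tuple R a b 0).
  rewrite (Rintegral_gaussian0 1 (bounded_Rintegral (gaussian 1 0) (gaussian 1 0) bF)).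
  rewrite (Rintegral_gaussian0 1 (bounded_measurable_pair1 ([tuple] : 0.-tuple R) bF)).
  rewrite (Rintegral_gaussian0 1 bf).
  by rewrite /= (tuple0 (affine_tuple _ _ _)).
have bF := bounded_measurable_comp bf (@measurable_affine_tuple R a b n.+1).
have bc := bounded_measurable_cons bf.
rewrite [RHS](Rintegral_gaussianS 1 bf).
rewrite [LHS](Rintegral_gaussianS 1 (bounded_Rintegral (gaussian 1 n.+1) (gaussian 1 n.+1) bF)).
pose h (u : rR) := \int[gaussian 1 n]_w f (cons_pair (u, w)).
have bh : bounded_measurable h by exact: (bounded_Rintegral (normal_prob 0 1) _ bc).
transitivity (\int[normal_prob 0 1]_x \int[normal_prob 0 1]_z h (a * x + b * z)); last first.
  exact: Rintegral_normal_prob_convolution.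
apply: eq_Rintegral => x _.
pose G (p : n.-tuple R * rR) : R :=
  \int[gaussian 1 n]_z f (cons_pair (a * x + b * p.2, affine_tuple a b (p.1, z))).
have bG : bounded_measurable G.
  have bg : bounded_measurable (fun q : (n.-tuple R * rR) * n.-tuple R =>
    f (cons_pair (a * x + b * q.1.2, affine_tuple a b (q.1.1, q.2)))).
    apply: (bounded_measurable_comp bc (g := fun q : (n.-tuple R * rR) * n.-tuple R =>
      (a * x + b * q.1.2 : rR, affine_tuple a b (q.1.1, q.2)))).
    apply: measurable_fun_pair.
      apply: measurable_funD => //; apply: measurable_funM => //.
      exact: (measurableT_comp measurable_snd measurable_fst).
    apply: (measurableT_comp (@measurable_affine_tuple R a b n)).
    apply: measurable_fun_pair => //.
    exact: (measurableT_comp measurable_fst measurable_fst).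
  exact: (bounded_Rintegral (gaussian 1 n \x normal_prob 0 1)%E (gaussian 1 n) bg).
transitivity (\int[gaussian 1 n]_y \int[normal_prob 0 1]_z G (y, z)).
  apply: eq_Rintegral => y _.
  rewrite (Rintegral_gaussianS 1 (bounded_measurable_pair1 (cons_pair (x, y)) bF)).
  apply: eq_Rintegral => z _; rewrite /G /=; apply: eq_Rintegral => w _.
  by rewrite affine_tuple_cons.
rewrite (Rintegral_fubini_swap (gaussian 1 n) (normal_prob 0 1) bG).
apply: eq_Rintegral => z _.
exact: (IH _ (bounded_measurable_pair1 (a * x + b * z) bc)).
Qed.

(** The weights s / p and c t / p have squares of sum 1, and scaling reduces to standard
    Gaussian measures. *)
Lemma gaussian_convolution (s t c p : R) n (f : n.-tuple R -> R) :
  0 < s -> 0 < t -> 0 < c -> 0 < p -> p ^+ 2 = s ^+ 2 + (c * t) ^+ 2 ->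
  bounded_measurable f ->
  \int[gaussian s n]_x \int[gaussian t n]_z f (affine_tuple 1 c (x, z)) =
  \int[gaussian p n]_y f y.
Proof.
move=> s0 t0 c0 p0 pE bf.
have bF := bounded_measurable_comp bf (@measurable_affine_tuple R 1 c n).
rewrite [RHS](Rintegral_gaussian_scale p0 bf).
rewrite [LHS](Rintegral_gaussian_scale s0 (bounded_Rintegral (gaussian s n) (gaussian t n) bF)).
rewrite -(@gaussian_convolution1 (s / p) (c * t / p) n (fun x => f (scale_tuple p x))).
- apply: eq_Rintegral => x _.
  rewrite (Rintegral_gaussian_scale t0 (bounded_measurable_pair1 (scale_tuple s x) bF)).
  apply: eq_Rintegral => z _; congr f; apply: eq_from_tnth => i.
  rewrite /affine_tuple /scale_tuple /= !tnth_mktuple /= ?tnth_mktuple.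
  by field; rewrite gt_eqF.
- by rewrite divr_gt0// mulr_gt0.
- rewrite [in LHS]expr_div_n [X in _ + X]expr_div_n -mulrDl -pE mulfV//.
  by rewrite sqrf_eq0 gt_eqF.
- exact: (bounded_measurable_comp bf (@measurable_scale_tuple R p n)).
Qed.

End gaussian_convolution.

(** * Relative entropy: variational formula and contraction *)

Lemma measurable_lne_EFin d (T : measurableType d) (R : realType) (p : T -> R) :
  measurable_fun [set: T] p -> measurable_fun [set: T] (fun x => lne (p x)%:E).
Proof.
move=> mp; apply: measurable_fun_ifT => //.
- by apply: (measurable_fun_ler mp); exact: measurable_cst.
- by apply/measurable_EFinP; exact: measurableT_comp.
Qed.

Section relative_entropy.
Local Open Scope charge_scope.
Context d (T : measurableType d) (R : realType) (mu nu : probability T R).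

(** [KL] uses the derivative of a charge, an extended real function of no definite sign; it
    agrees almost everywhere with a nonnegative real density, with which one can compute. *)
Lemma KL_density : mu `<< nu -> exists p : T -> R,
  [/\ measurable_fun [set: T] p, (forall x, 0 <= p x),
      (forall A, measurable A -> mu A = \int[nu]_(x in A) (p x)%:E)%E &
      KL mu nu = (\int[mu]_x lne (p x)%:E)%E].
Proof.
move=> munu.
pose f := Radon_Nikodym_SigmaFinite.f mu nu.
pose g := 'd (charge_of_finite_measure mu) '/d nu.
have ffin x : f x \is a fin_num by exact: Radon_Nikodym_SigmaFinite.f_fin_num.
have gfin x : g x \is a fin_num by exact: Radon_Nikodym_fin_num.
have mf : measurable_fun [set: T] f.
  exact: (measurable_int nu (Radon_Nikodym_SigmaFinite.f_integrable munu)).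
have mg : measurable_fun [set: T] g.
  exact: (measurable_int nu (@Radon_Nikodym_integrable _ _ _ (charge_of_finite_measure mu) nu munu)).
have mfine (h : T -> \bar R) : measurable_fun [set: T] h -> measurable_fun [set: T] (fine \o h).
  by move=> mh; exact: (measurableT_comp (@fine_measurable R setT measurableT) mh).
exists (fine \o f); split.
- exact: mfine.
- by move=> x; rewrite /= fine_ge0//; exact: Radon_Nikodym_SigmaFinite.f_ge0.
- move=> A mA; rewrite (Radon_Nikodym_SigmaFinite.f_integral munu)//.
  by apply: eq_integral => x _; rewrite /= fineK.
- rewrite /KL ifT; last exact/asboolP.
  have fg : ae_eq mu setT f g.
    apply: (null_dominates_ae_eq measurableT munu).
    exact: ae_eq_Radon_Nikodym_SigmaFinite.
  apply: ae_eq_integral => //.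
  + rewrite (_ : (fun x => _) = (fun x => lne ((fine \o g) x)%:E)).
      by apply: measurable_lne_EFin; exact: mfine.
    by apply/funext => x; rewrite /comp (fineK (gfin x)).
  + by apply: measurable_lne_EFin; exact: mfine.
  + apply: filterS fg => x /(_ I) fgx _.
    by rewrite /comp (fineK (ffin x)) fgx.
Qed.

Lemma density_pos_ae (p : T -> R) : measurable_fun [set: T] p -> (forall x, 0 <= p x) ->
  (forall A, measurable A -> mu A = \int[nu]_(x in A) (p x)%:E)%E ->
  {ae mu, forall x, 0 < p x}.
Proof.
move=> mp p0 pE; exists [set x | p x = 0]; split.
- rewrite (_ : [set x | p x = 0] = p @^-1` [set 0]); last by [].
  by rewrite -[X in measurable X]setTI; exact: mp.
- rewrite pE; last first.
    rewrite (_ : [set x | p x = 0] = p @^-1` [set 0]); last by [].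
    by rewrite -[X in measurable X]setTI; exact: mp.
  by apply: integral0_eq => x /= ->.
- move=> x /= /negP; rewrite -leNgt => px; apply/eqP; rewrite eq_le px; exact: p0.
Qed.

(** With p the density and K the integral of e^psi, the inequality 1 + y <= e^y at y = psi -
    ln K - ln p reads psi - ln K - ln p <= e^psi / (K p) - 1, and the integral of the
    right-hand side against mu is at most 0. *)
Lemma gibbs_inequality (psi : T -> R) : bounded_measurable psi ->
  ((\int[mu]_x psi x)%:E <= KL mu nu + (ln (\int[nu]_x expR (psi x)))%:E)%E.
Proof.
move=> bpsi; have [munu|munu] := pselect (mu `<< nu); last first.
  by rewrite /KL ifF ?leey//; apply/asboolP.
have [p [mp p0 pE ->]] := KL_density munu.
have be := bounded_measurable_expR bpsi.
set K := \int[nu]_x expR (psi x).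
have K0 : 0 < K := Rintegral_expR_gt0 nu bpsi.
(* p is positive mu-almost everywhere; p' also avoids dividing by 0 elsewhere *)
pose p' x := if 0 < p x then p x else 1.
have mp' : measurable_fun [set: T] p'.
  apply: measurable_fun_ifT => //.
  by apply: (measurable_fun_ltr _ mp); exact: measurable_cst.
have p'0 x : 0 < p' x by rewrite /p'; case: ifP.
have -> : (\int[mu]_x lne (p x)%:E = \int[mu]_x (ln (p' x))%:E)%E.
  apply: ae_eq_integral => //.
  - exact: measurable_lne_EFin.
  - by apply/measurable_EFinP; exact: measurableT_comp.
  - apply: filterS (density_pos_ae mp p0 pE) => x px _.
    by rewrite lne_EFin// /p' px.
pose G x := expR (psi x) / K.
have mpsi := bpsi.1.
have mG : measurable_fun [set: T] G by apply: measurable_funM => //; exact: measurableT_comp.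
have mGp : measurable_fun [set: T] (fun x => G x / p' x).
  rewrite (_ : (fun x => _) = fun x => G x * expR (- ln (p' x))); last first.
    by apply/funext => x; rewrite expRN lnK ?posrE.
  apply: measurable_funM => //; apply: measurableT_comp => //.
  by apply: measurableT_comp => //; exact: measurableT_comp.
have G0 x : 0 <= G x / p' x by rewrite divr_ge0 ?ltW// divr_gt0// expR_gt0.
have IG : (\int[mu]_x (G x / p' x)%:E <= 1)%E.
  rewrite (integral_density mp p0 pE)//; last exact/measurable_EFinP.
  have -> : (1 = \int[nu]_x (G x)%:E)%E.
    have bG : bounded_measurable (fun x => K^-1 * expR (psi x)) by exact: bounded_measurableZ.
    under eq_integral do rewrite /G mulrC.
    by rewrite (RintegralE nu bG) (Rintegral_bdZ nu _ be) mulVf// gt_eqF.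
  apply: ge0_le_integral => //.
  - by move=> x _; rewrite mule_ge0// lee_fin.
  - by apply: emeasurable_funM; exact/measurable_EFinP.
  - exact/measurable_EFinP.
  - move=> x _; rewrite -EFinM lee_fin /p'.
    have G0' : 0 <= G x by rewrite divr_ge0 ?expR_ge0// ltW.
    case: ifPn => px; first by rewrite divfK// gt_eqF.
    have -> : p x = 0 by apply/eqP; rewrite eq_le p0 andbT leNgt.
    by rewrite mulr0.
have iG : mu.-integrable [set: T] (fun x => (G x / p' x)%:E).
  apply/integrableP; split; first exact/measurable_EFinP.
  under eq_integral do rewrite /= ger0_norm//.
  by rewrite (le_lt_trans IG)// ltry.
have bl : bounded_measurable (fun x => psi x + (1 - ln K)).
  by apply: bounded_measurableD => //; exact: bounded_measurable_cst.
apply: (@le_trans _ _ (\int[mu]_x ((psi x + (1 - ln K))%:E - (G x / p' x)%:E) + (ln K)%:E)%E).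
  rewrite integralB//; last exact: bounded_measurable_integrable.
  rewrite (RintegralE mu bl) (Rintegral_bdDcst mu _ bpsi).
  have Ifin : (\int[mu]_x (G x / p' x)%:E)%E \is a fin_num by exact: integrable_fin_num.
  move: IG; rewrite -(fineK Ifin) lee_fin => h.
  by rewrite -EFinB -EFinD lee_fin; lra.
apply: leeD => //; apply: le_integral_measurable.
- by apply: emeasurable_funB; apply/measurable_EFinP => //; case: bl.
- by apply/measurable_EFinP; exact: measurableT_comp.
- move=> x; rewrite -EFinB lee_fin.
  have := expR_ge1Dx (psi x - ln K - ln (p' x)).
  rewrite !expRB !lnK ?posrE// -/(G x) => h; lra.
Qed.

End relative_entropy.

Section relative_entropy_variational.
Context d (T : measurableType d) (R : realType) (mu nu : probability T R).

(** Test with large multiples of the indicator of a set that is null for nu. *)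
Lemma variational_dominates (c : R) :
  (forall phi : T -> R, bounded_measurable phi ->
    \int[mu]_x phi x <= c + ln (\int[nu]_x expR (phi x))) -> mu `<< nu.
Proof.
move=> H; apply/null_content_dominatesP => A mA nuA0.
have muA : mu A \is a fin_num by exact: fin_num_measure.
have bA := bounded_measurable_indic R mA.
have key n : n%:R * fine (mu A) <= c.
  have := H _ (bounded_measurableZ n%:R bA).
  rewrite (Rintegral_bdZ mu _ bA) (Rintegral_indic mu mA).
  have -> : \int[nu]_x expR (n%:R * \1_A x) = 1.
    rewrite (@eq_Rintegral _ _ _ nu setT (fun x => (expR n%:R - 1) * \1_A x + 1)); last first.
      move=> x _; rewrite indicE; case: (_ \in _); rewrite ?mulr1 ?mulr0 ?expR0 ?add0r//.
      by rewrite subrK.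
    rewrite (Rintegral_bdDcst nu _ (bounded_measurableZ _ bA)) (Rintegral_bdZ nu _ bA).
    by rewrite (Rintegral_indic nu mA) nuA0 mulr0 add0r.
  by rewrite ln1 addr0.
apply/eqP; rewrite -(fineK muA) eqe; apply/negPn/negP => mu0.
have m0 : 0 < fine (mu A) by rewrite lt0r mu0 fine_ge0.
have := key (Num.truncn (c / fine (mu A))).+1.
by apply/negP; rewrite -ltNge -ltr_pdivrMr// truncnS_gt.
Qed.

(** Test with the logarithm of the density truncated to values between e and n, let n grow
    by monotone convergence, then let e tend to 0. *)
Lemma KL_le_variational (c : R) :
  (forall phi : T -> R, bounded_measurable phi ->
    \int[mu]_x phi x <= c + ln (\int[nu]_x expR (phi x))) ->
  (KL mu nu <= c%:E)%E.
Proof.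
move=> H.
have [p [mp p0 pE ->]] := KL_density (variational_dominates H).
apply/lee_addgt0Pr => e e0.
pose phi (n : nat) x := ln (Num.max e (Num.min (p x) n%:R)).
have mmax n : measurable_fun [set: T] (fun x => Num.max e (Num.min (p x) n%:R)).
  by apply: measurable_maxr => //; apply: measurable_minr.
have bmax n : bounded_measurable (fun x => Num.max e (Num.min (p x) n%:R)).
  split => //; exists (e + n%:R) => x.
  rewrite ger0_norm; last by rewrite le_max (ltW e0).
  by rewrite ge_max lerDl ler0n/= ge_min [X in _ || X]lerDr (ltW e0) orbT.
have maxe n x : e <= Num.max e (Num.min (p x) n%:R) by rewrite le_max lexx.
have bphi n : bounded_measurable (phi n) := bounded_measurable_ln e0 (bmax n) (maxe n).
have nuexp n : \int[nu]_x expR (phi n x) <= 1 + e.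
  rewrite -lee_fin -RintegralE; last exact: bounded_measurable_expR.
  have -> : ((1 + e)%:E = \int[nu]_x ((p x)%:E + e%:E))%E.
    have mpe : measurable_fun [set: T] (fun x => (p x)%:E) by exact/measurable_EFinP.
    rewrite ge0_integralD//; last 2 first.
    - by move=> x _; rewrite lee_fin.
    - by move=> x _; rewrite lee_fin ltW.
    rewrite -pE// [X in (X + _)%E]probability_setT.
    by rewrite (RintegralE nu (bounded_measurable_cst _ e)) Rintegral_prob_cst.
  apply: ge0_le_integral => //.
  - by apply/measurable_EFinP; case: (bounded_measurable_expR (bphi n)).
  - by apply: emeasurable_funD => //; exact/measurable_EFinP.
  - move=> x _; rewrite -EFinD lee_fin /phi lnK ?posrE; last by rewrite (lt_le_trans e0).
    by rewrite ge_max lerDr p0/= ge_min lerDl (ltW e0).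
have e1 : 0 < 1 + e by rewrite addr_gt0.
have muphi n : \int[mu]_x phi n x <= c + e.
  apply: (le_trans (H _ (bphi n))); rewrite lerD2l.
  apply: (@le_trans _ _ (ln (1 + e))).
    by rewrite ler_ln ?posrE//; exact: Rintegral_expR_gt0.
  by apply: le_ln1Dx; rewrite (lt_trans _ e0)// ltrN10.
pose L x := ln (Num.max e (p x)).
have mL : measurable_fun [set: T] L.
  by apply: measurableT_comp => //; exact: measurable_maxr.
pose D x := L x - ln e.
have D0 x : 0 <= D x by rewrite subr_ge0 ler_ln ?posrE// ?lt_max ?e0// le_max lexx.
have mD : measurable_fun [set: T] D by exact: measurable_funB.
have ID : (\int[mu]_x (D x)%:E <= (c + e - ln e)%:E)%E.
  have cvgI : (\int[mu]_x (phi n x - ln e)%:E @[n --> \oo] --> \int[mu]_x (D x)%:E)%E.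
    have DE x : (D x)%:E = limn (fun n => (phi n x - ln e)%:E).
      apply/esym/cvg_lim => //; apply: cvg_near_cst.
      exists (Num.truncn (p x)).+1 => // n /= hn.
      rewrite /D /L /phi min_l// (le_trans (ltW (truncnS_gt _)))// ler_nat//.
    under eq_integral do rewrite DE.
    apply: cvg_monotone_convergence => //.
    - move=> n; apply/measurable_EFinP; apply: measurable_funB => //; exact: (bphi n).1.
    - by move=> n x _; rewrite lee_fin subr_ge0 ler_ln ?posrE// (lt_le_trans e0).
    - move=> x _ m n mn; rewrite lee_fin lerB// ler_ln ?posrE ?(lt_le_trans e0)//.
      rewrite ge_max maxe /= le_max; apply/orP; right.
      by rewrite le_min ge_min lexx/= ge_min ler_nat mn orbT.
  rewrite -(cvg_lim _ cvgI)//; apply: lime_le; first by apply/cvg_ex; eexists; exact: cvgI.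
  apply: nearW => n.
  have bn : bounded_measurable (fun x => phi n x - ln e).
    by apply: bounded_measurableB => //; exact: bounded_measurable_cst.
  rewrite (RintegralE mu bn) (Rintegral_bdB mu (bphi n) (bounded_measurable_cst _ _)).
  by rewrite Rintegral_prob_cst lee_fin lerB.
have iD : mu.-integrable [set: T] (fun x => (D x)%:E).
  apply/integrableP; split; first exact/measurable_EFinP.
  under eq_integral do rewrite /= ger0_norm//.
  by rewrite (le_lt_trans ID)// ltry.
have bcst := bounded_measurable_cst T (ln e).
apply: (@le_trans _ _ (\int[mu]_x ((D x)%:E + (ln e)%:E))%E).
  apply: le_integral_measurable.
  - exact: measurable_lne_EFin.
  - by apply: emeasurable_funD; exact/measurable_EFinP.
  - move=> x; rewrite -EFinD subrK.
    have [px|px] := ltP 0 (p x).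
      by rewrite lne_EFin// lee_fin ler_ln ?posrE// ?lt_max ?e0// le_max lexx orbT.
    by rewrite le0_lneNy ?lee_fin// leNye.
rewrite integralD//; last exact: (bounded_measurable_integrable mu bcst).
rewrite (RintegralE mu bcst) Rintegral_prob_cst.
apply: (@le_trans _ _ ((c + e - ln e)%:E + (ln e)%:E)%E); first exact: leeD.
by rewrite -!EFinD lee_fin; lra.
Qed.

End relative_entropy_variational.

(** By Gibbs' inequality for mu and r times the smoothing of phi, where phi is shifted so
    that the integral of e^phi against nu is 1, the integral of phi against mu' is at most
    KL mu nu / r; conclude by the variational formula. *)
Lemma KL_contraction d (T : measurableType d) (R : realType)
    (mu mu' nu : probability T R) (A : T * T -> T) (r : R) : 0 < r ->
  measurable_fun [set: T * T] A -> exp_contractive nu A r ->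
  (forall phi, bounded_measurable phi ->
    \int[mu']_x phi x = \int[mu]_x smoothing nu A phi x) ->
  (KL mu' nu <= KL mu nu * (r^-1)%:E)%E.
Proof.
move=> r0 mA cA mu'E.
have KL0 : (0 <= KL mu nu)%E.
  have := gibbs_inequality mu nu (bounded_measurable_cst T 0).
  by rewrite expR0 !Rintegral_prob_cst ln1 adde0.
case KLE : (KL mu nu) KL0 => [k| |//] KL0; last first.
  by rewrite mulyr gtr0_sg ?invr_gt0// mul1e leey.
rewrite -EFinM; apply: KL_le_variational => phi bphi.
set K := \int[nu]_x expR (phi x).
pose phi0 x := phi x - ln K.
have bphi0 : bounded_measurable phi0.
  by apply: bounded_measurableB => //; exact: bounded_measurable_cst.
have phi01 : \int[nu]_x expR (phi0 x) <= 1 by rewrite Rintegral_expR_normalized.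
have bs := smoothing_bounded_measurable nu mA bphi0.
have brs := bounded_measurableZ r bs.
have := gibbs_inequality mu nu brs.
rewrite KLE (Rintegral_bdZ mu _ bs) -EFinD lee_fin -(mu'E _ bphi0) => h.
have : ln (\int[nu]_x expR (r * smoothing nu A phi0 x)) <= 0.
  exact: ln_le0 (cA _ bphi0 phi01).
rewrite (Rintegral_bdB mu' bphi (bounded_measurable_cst _ _)) Rintegral_prob_cst in h => h2.
have h3 : r * (\int[mu']_x phi x - ln K) <= k by rewrite (le_trans h)// gerDl.
by rewrite -lerBlDr ler_pdivlMr// mulrC.
Qed.

(** * Independence and laws on tuples *)

Definition measurable_map d1 d2 (T1 : measurableType d1) (T2 : measurableType d2)
  (f : T1 -> T2) (mf : measurable_fun [set: T1] f) : {mfun T1 >-> T2} :=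
  HB.pack f (isMeasurableFun.Build _ _ _ _ f mf).

Lemma measurable_coordinate d (T : measurableType d) (R : realType) n
    (U : {mfun T >-> n.-tuple R}) (i : 'I_n) :
  measurable_fun [set: T] (fun w => tnth (U w) i).
Proof. by apply: (measurableT_comp (measurable_tnth i)); exact: measurable_funPT. Qed.

Section independence.
Context dO d1 d2 (Omega : measurableType dO) (T1 : measurableType d1)
  (T2 : measurableType d2) (R : realType) (P : probability Omega R).
Context (U : {RV P >-> T1}) (V : {RV P >-> T2}).
Context (indUV : forall A B, measurable A -> measurable B ->
  P (U @^-1` A `&` V @^-1` B) = (P (U @^-1` A) * P (V @^-1` B))%E).

Lemma measurable_pairRV : measurable_fun [set: Omega] (fun w => (U w, V w)).
Proof. exact: measurable_fun_pair. Qed.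

Lemma independent_joint_law E : measurable E ->
  distribution P (measurable_map measurable_pairRV) E =
  (distribution P U \x distribution P V)%E E.
Proof.
move=> mE; apply/esym.
apply: (@product_measure_unique _ _ T1 T2 R (distribution P U) (distribution P V)
  (distribution P (measurable_map measurable_pairRV)) _ E mE).
by move=> A B mA mB; exact: indUV.
Qed.

Lemma Rintegral_independent (f : T1 * T2 -> R) : bounded_measurable f ->
  \int[P]_w f (U w, V w) =
  \int[distribution P U]_x \int[distribution P V]_y f (x, y).
Proof.
move=> bf; rewrite -(Rintegral_fubini (distribution P U) (distribution P V) bf).
rewrite -(Rintegral_bd_distribution (measurable_map measurable_pairRV) bf).
congr fine; apply: eq_measure_integral => E mE _; exact: independent_joint_law.
Qed.

Lemma integral_independent_mul (f : T1 -> R) (g : T2 -> R) :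
  measurable_fun [set: T1] f -> measurable_fun [set: T2] g ->
  P.-integrable [set: Omega] (fun w => (f (U w) * g (V w))%:E) ->
  P.-integrable [set: Omega] (fun w => (g (V w))%:E) ->
  (\int[P]_w (g (V w))%:E = 0)%E ->
  (\int[P]_w (f (U w) * g (V w))%:E = 0)%E.
Proof.
move=> mf mg ifg ig g0.
pose W := measurable_map measurable_pairRV.
pose h (p : T1 * T2) := (f p.1 * g p.2)%:E : \bar R.
have mh : measurable_fun [set: T1 * T2] h.
  apply/measurable_EFinP; apply: measurable_funM.
  - exact: (measurableT_comp mf measurable_fst).
  - exact: (measurableT_comp mg measurable_snd).
have mge : measurable_fun [set: T2] (fun y => (g y)%:E) by exact/measurable_EFinP.
have iW : (distribution P W).-integrable [set: T1 * T2] h.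
  by apply: integrable_pushforward.
have ih : (distribution P U \x distribution P V)%E.-integrable [set: T1 * T2] h.
  apply/integrableP; split => //.
  move/integrableP : iW => [_]; apply: le_lt_trans.
  rewrite le_eqVlt; apply/orP; left; apply/eqP.
  by apply: eq_measure_integral => E mE _; exact/esym/independent_joint_law.
have igV : (distribution P V).-integrable [set: T2] (fun y => (g y)%:E).
  by apply: integrable_pushforward.
transitivity (\int[distribution P W]_p h p)%E.
  by rewrite integral_distribution.
transitivity (\int[(distribution P U \x distribution P V)]_p h p)%E.
  by apply: eq_measure_integral => E mE _; exact: independent_joint_law.
rewrite -(integral12_prod_meas1 ih) /fubini_F.
apply: integral0_eq => x _; rewrite /h /=.
under eq_integral do rewrite EFinM.
by rewrite integralZl// -[X in (_ * X)%E]/(\int[distribution P V]_y (g y)%:E)%E integral_distribution// g0 mule0.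
Qed.

End independence.

Section tuple_law.
Context (R : realType) (n : nat).

Definition open_box (q : 'I_n -> R) : set (n.-tuple R) :=
  [set x | forall i, tnth x i < q i].

Lemma measurable_open_box q : measurable (open_box q).
Proof.
rewrite (_ : open_box q = \bigcap_(i in [set: 'I_n]) ((fun x => tnth x i) @^-1` `]-oo, q i[)).
  apply: fin_bigcap_measurable => // i _; rewrite -[X in measurable X]setTI.
  exact: measurable_tnth.
apply/seteqP; split => x bx.
  by move=> i _ /=; rewrite in_itv/=; exact: bx.
by move=> i; have := bx i Logic.I; rewrite /= in_itv.
Qed.

(** Open boxes are stable under intersection and generate the sigma-algebra of the
    coordinates. *)
Lemma measure_open_box_unique (mu nu : probability (n.-tuple R) R) :
  (forall q, mu (open_box q) = nu (open_box q)) ->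
  forall A, measurable A -> mu A = nu A.
Proof.
move=> H; pose G := [set A | exists q, A = open_box q].
apply: (measure_unique G (fun k => open_box (fun=> k%:R))).
- apply/seteqP; split; last first.
    apply: smallest_sub; first exact: sigma_algebra_measurable.
    by move=> _ [q ->]; exact: measurable_open_box.
  have mcoord (i : 'I_n) : measurable_fun [set: g_sigma_algebraType G]
      ((fun x => tnth x i) : g_sigma_algebraType G -> measurableTypeR R).
    apply: (measurability _ (RGenInftyO.measurableE R)) => _ [_ [x ->] <-].
    rewrite setTI.
    rewrite (_ : _ @^-1` _ = \bigcup_k open_box (fun j => if j == i then x else k%:R)).
      by apply: bigcup_measurable => k _; apply: sub_sigma_algebra; eexists.
    apply/seteqP; split => y /=; rewrite in_itv/=.
      move=> yx; exists (Num.truncn (\sum_(i < n) `|tnth y i|)).+1 => // j.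
      case: eqP => [->//|_].
      rewrite (le_lt_trans _ (truncnS_gt _))// (le_trans (ler_norm _))//.
      by rewrite (bigD1 j)//= lerDl sumr_ge0.
    by move=> [k _ /(_ i)]; rewrite eqxx.
  apply: smallest_sub; first exact: smallest_sigma_algebra.
  elim/big_ind: _ => //=.
  - by move=> S1 S2 h1 h2; rewrite subUset.
  - move=> i _ _ [B mB <-].
    exact: (mcoord i measurableT B mB).
- move=> _ _ [p ->] [q ->]; exists (fun i => Num.min (p i) (q i)).
  apply/seteqP; split => x.
    by move=> [xp xq] i; rewrite lt_min xp xq.
  by move=> xpq; split => i; have := xpq i; rewrite lt_min => /andP[].
- by move=> k; exists (fun=> k%:R).
- apply/seteqP; split => // x _.
  exists (Num.truncn (\sum_(i < n) `|tnth x i|)).+1 => // i.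
  rewrite (le_lt_trans _ (truncnS_gt _))// (le_trans (ler_norm _))//.
  by rewrite (bigD1 i)//= lerDl sumr_ge0.
- by move=> _ [q ->]; exact: H.
- by move=> k; rewrite (le_lt_trans (probability_le1 _ _)) ?ltry//; exact: measurable_open_box.
Qed.

End tuple_law.

(** * Second moments of Brownian motion *)

Section square_integrable.
Context d (T : measurableType d) (R : realType) (mu : {measure set T -> \bar R}).
Implicit Types f g : T -> R.

Definition square_integrable f :=
  measurable_fun [set: T] f /\ mu.-integrable [set: T] (fun x => (f x ^+ 2)%:E).

Definition sqnorm f : \bar R := (\int[mu]_x (f x ^+ 2)%:E)%E.

Lemma sqnorm_ge0 f : (0 <= sqnorm f)%E.
Proof. by apply: integral_ge0 => x _; rewrite lee_fin sqr_ge0. Qed.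

Let msq f : measurable_fun [set: T] f -> measurable_fun [set: T] (fun x => (f x ^+ 2)%:E : \bar R).
Proof. by move=> mf; apply/measurable_EFinP; exact: measurable_funX. Qed.

Lemma square_integrable_ltyP f : measurable_fun [set: T] f ->
  square_integrable f <-> (sqnorm f < +oo)%E.
Proof.
move=> mf; have e : (\int[mu]_x `|(f x ^+ 2)%:E| = sqnorm f)%E.
  by apply: eq_integral => x _; rewrite /= ger0_norm ?sqr_ge0.
split=> [[_ /integrableP[_]]|fy]; first by rewrite e.
by split => //; apply/integrableP; split; [exact: msq|rewrite e].
Qed.

Lemma square_integrable_mul f g : square_integrable f -> square_integrable g ->
  mu.-integrable [set: T] (fun x => (f x * g x)%:E).
Proof.
move=> [mf f2] [mg g2].
apply: (@le_integrable _ _ _ mu setT measurableT _ (fun x => (f x ^+ 2)%:E + (g x ^+ 2)%:E)%E).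
- by apply/measurable_EFinP; exact: measurable_funM.
- move=> x _; rewrite /= lee_fin normrM [leRHS]ger0_norm ?addr_ge0 ?sqr_ge0//.
  rewrite -(real_normK (num_real (f x))) -(real_normK (num_real (g x))).
  have := sqr_ge0 (`|f x| - `|g x|); have := normr_ge0 (f x); have := normr_ge0 (g x).
  by have := mulr_ge0 (normr_ge0 (f x)) (normr_ge0 (g x)); rewrite sqrrB; lra.
- exact: integrableD.
Qed.

Lemma sqnormD f g : measurable_fun [set: T] f -> measurable_fun [set: T] g ->
  (sqnorm (fun x => f x + g x)%R <= 2%:E * (sqnorm f + sqnorm g))%E.
Proof.
move=> mf mg; rewrite /sqnorm -ge0_integralD//; last 4 first.
- by move=> x _; rewrite lee_fin sqr_ge0.
- exact: msq.
- by move=> x _; rewrite lee_fin sqr_ge0.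
- exact: msq.
have mD : measurable_fun [set: T] (fun x => (f x ^+ 2)%:E + (g x ^+ 2)%:E : \bar R)%E.
  by apply: emeasurable_funD; exact: msq.
rewrite -ge0_integralZl//; last by move=> x _; rewrite -EFinD lee_fin addr_ge0 ?sqr_ge0.
apply: ge0_le_integral => //.
- by move=> x _; rewrite lee_fin sqr_ge0.
- by apply: msq; exact: measurable_funD.
- exact: measurable_funeM.
- move=> x _; rewrite -EFinD -EFinM lee_fin.
  by have := sqr_ge0 (f x - g x); rewrite sqrrB sqrrD; lra.
Qed.

Lemma sqnormZ c f : measurable_fun [set: T] f ->
  (sqnorm (fun x => c * f x)%R = (c ^+ 2)%:E * sqnorm f)%E.
Proof.
move=> mf; rewrite /sqnorm -ge0_integralZl//.
- by apply: eq_integral => x _; rewrite exprMn EFinM.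
- exact: msq.
- by move=> x _; rewrite lee_fin sqr_ge0.
- by rewrite lee_fin sqr_ge0.
Qed.

End square_integrable.

Section gaussian_coordinate.
Context (R : realType).
Local Notation rR := (measurableTypeR R).

Lemma ge0_integral_gaussian_coord (s : R) n (i : 'I_n) (f : rR -> \bar R) :
  measurable_fun [set: rR] f -> (forall x, 0 <= f x)%E ->
  (\int[gaussian s n]_x f (tnth x i) = \int[normal_prob 0 s]_y f y)%E.
Proof.
move=> mf f0; elim: n i => [[]//|n IH] i.
have mft m (j : 'I_m) : measurable_fun [set: m.-tuple R] (fun x => f (tnth x j)).
  by apply: (measurableT_comp mf); exact: measurable_tnth.
transitivity (\int[(normal_prob 0 s \x gaussian s n)]_p f (tnth (cons_pair p) i))%E.
  exact: (@ge0_integral_distribution _ _ _ _ _ (normal_prob 0 s \x gaussian s n)%E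
    (@cons_pair R n) (fun x => f (tnth x i)) (mft _ i) (fun x => f0 _)).
pose h (p : rR * n.-tuple R) := f (tnth (cons_pair p) i).
have mh : measurable_fun [set: rR * n.-tuple R] h.
  exact: (measurableT_comp (mft _ i) (@measurable_cons_pair R n)).
transitivity (\int[normal_prob 0 s]_x \int[gaussian s n]_y h (x, y))%E.
  exact: (@fubini_tonelli1 _ _ _ _ _ (normal_prob 0 s) (gaussian s n) h mh (fun p => f0 _)).
case: (unliftP ord0 i) => [j|] ij.
- transitivity (\int[normal_prob 0 s]_x (cst (\int[normal_prob 0 s]_y f y) x))%E.
    by apply: eq_integral => x _; rewrite /h ij /= -(IH j); apply: eq_integral => y _; rewrite tnthS.
  by rewrite integral_cst//= [X in (_ * X)%E]probability_setT mule1.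
- apply: eq_integral => x _.
  transitivity (\int[gaussian s n]_y (cst (f x) y))%E.
    by apply: eq_integral => y _; rewrite /h ij /= tnth0.
  by rewrite integral_cst//= [X in (_ * X)%E]probability_setT mule1.
Qed.

(** Kept as a symbol: the isometry below needs one finite constant, equal for all times. *)
Definition normal_variance : R := fine (\int[normal_prob 0 1]_x (x ^+ 2)%:E)%E.

Lemma normal_varianceE :
  (\int[normal_prob 0 1]_x (x ^+ 2)%:E = (normal_variance)%:E :> \bar R)%E.
Proof.
by rewrite /normal_variance fineK//; exact/integrable_fin_num/integrable_normal_prob_sqr.
Qed.

Lemma normal_variance_ge0 : 0 <= normal_variance.
Proof. by rewrite fine_ge0//; apply: integral_ge0 => x _; rewrite lee_fin sqr_ge0. Qed.

End gaussian_coordinate.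

Section brownian_coordinate.
Context dO (Omega : measurableType dO) (R : realType) (P : probability Omega R) (n : nat).
Local Notation rR := (measurableTypeR R).
Context (B : R -> {RV P >-> n.-tuple R}) (hB : standard_brownian_motion B) (i : 'I_n).

Local Notation W := (fun t w => tnth (B t w) i).

Lemma measurable_increment s t : measurable_fun [set: Omega] (increment B s t).
Proof.
apply/measurable_fun_tnthP => j.
rewrite (_ : _ \o _ = fun w => tnth (B t w) j - tnth (B s w) j); last first.
  by apply/funext => w; rewrite /= tnth_mktuple.
by apply: measurable_funB; exact: measurable_coordinate.
Qed.

Definition incrementRV s t : {RV P >-> n.-tuple R} := measurable_map (measurable_increment s t).

Lemma ge0_integral_increment s t (f : rR -> \bar R) : 0 <= s -> s < t ->
  measurable_fun [set: rR] f -> (forall x, 0 <= f x)%E ->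
  (\int[P]_w f (W t w - W s w)%R = \int[normal_prob 0 1]_z f (Num.sqrt (t - s) * z)%R)%E.
Proof.
move=> s0 st mf f0.
have r0 : 0 < Num.sqrt (t - s) by rewrite sqrtr_gt0 subr_gt0.
transitivity (\int[normal_prob 0 (Num.sqrt (t - s))]_y f y)%E; last first.
  rewrite (ge0_integral_normal_prob_affine 0 r0 mf f0).
  by apply: eq_integral => z _; rewrite add0r.
rewrite -(@ge0_integral_gaussian_coord R _ n i f mf f0).
transitivity (\int[distribution P (incrementRV s t)]_x f (tnth x i))%E.
  rewrite ge0_integral_distribution//.
  - by apply: eq_integral => w _; rewrite /= tnth_mktuple.
  - by apply: (measurableT_comp mf); exact: measurable_tnth.
by apply: eq_measure_integral => A mA _; exact: (brownian_gaussian hB).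
Qed.

Lemma sqnorm_increment s t : 0 <= s -> s < t ->
  sqnorm P (fun w => W t w - W s w) = (normal_variance R * (t - s))%:E.
Proof.
move=> s0 st; rewrite /sqnorm.
rewrite (@ge0_integral_increment s t (fun x => (x ^+ 2)%:E) s0 st); last 2 first.
- by apply/measurable_EFinP; exact: measurable_funX.
- by move=> x; rewrite lee_fin sqr_ge0.
under eq_integral do rewrite exprMn sqr_sqrtr ?subr_ge0 ?(ltW st)// EFinM.
rewrite integralZl//; last exact: integrable_normal_prob_sqr.
by rewrite normal_varianceE -EFinM mulrC.
Qed.

Lemma square_integrable_increment s t : 0 <= s -> s < t ->
  square_integrable P (fun w => W t w - W s w).
Proof.
move=> s0 st; apply/square_integrable_ltyP.
  by apply: measurable_funB; exact: measurable_coordinate.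
by rewrite sqnorm_increment// ltry.
Qed.

Lemma integral_increment s t : 0 <= s -> s < t ->
  (\int[P]_w (W t w - W s w)%:E = 0)%E.
Proof.
move=> s0 st.
have mid : measurable_fun [set: rR] (fun x : rR => x%:E : \bar R).
  exact/measurable_EFinP.
rewrite integralE.
have -> : (\int[P]_w (fun w => (W t w - W s w)%:E)^\+ w)%E =
    (\int[normal_prob 0 1]_z ((fun z => (Num.sqrt (t - s) * z)%:E)^\+ z))%E.
  transitivity (\int[P]_w ((fun x : rR => x%:E)^\+ (W t w - W s w)%R))%E.
    by apply: eq_integral => w _; rewrite !funeposE.
  rewrite ge0_integral_increment//; last exact: measurable_funepos.
  by apply: eq_integral => w _; rewrite !funeposE.
have -> : (\int[P]_w (fun w => (W t w - W s w)%:E)^\- w)%E =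
    (\int[normal_prob 0 1]_z ((fun z => (Num.sqrt (t - s) * z)%:E)^\- z))%E.
  transitivity (\int[P]_w ((fun x : rR => x%:E)^\- (W t w - W s w)%R))%E.
    by apply: eq_integral => w _; rewrite !funenegE.
  rewrite ge0_integral_increment//; last exact: measurable_funeneg.
  by apply: eq_integral => w _; rewrite !funenegE.
rewrite -integralE.
under eq_integral do rewrite EFinM.
rewrite integralZl//; last exact: integrable_normal_prob_id.
by rewrite integral_normal_prob_id mule0.
Qed.

Lemma brownian_coord0 : {ae P, forall w, W 0 w = 0}.
Proof. by apply: filterS (brownian_start hB) => w; exact. Qed.

Lemma square_integrable_cst (c : R) : square_integrable P (fun=> c).
Proof.
split => //.
exact: (bounded_measurable_integrable P (bounded_measurable_cst Omega (c ^+ 2))).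
Qed.

Lemma sqnorm_brownian t : 0 <= t -> sqnorm P (W t) = (normal_variance R * t)%:E.
Proof.
rewrite le_eqVlt => /predU1P[<-|t0].
  rewrite mulr0 /sqnorm; transitivity (\int[P]_w (cst 0 w))%E; last exact: integral0.
  apply: ae_eq_integral => //.
  - by apply/measurable_EFinP; apply: measurable_funX; exact: measurable_coordinate.
  - by apply: filterS brownian_coord0 => w /= -> _; rewrite expr0n.
rewrite -[X in _ * X]subr0 -(sqnorm_increment (lexx 0) t0) /sqnorm.
apply: ae_eq_integral => //.
- by apply/measurable_EFinP; apply: measurable_funX; exact: measurable_coordinate.
- apply/measurable_EFinP; apply: measurable_funX.
  by apply: measurable_funB; exact: measurable_coordinate.
- by apply: filterS brownian_coord0 => w /= -> _; rewrite subr0.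
Qed.

Lemma square_integrable_brownian t : 0 <= t -> square_integrable P (W t).
Proof.
move=> t0; apply/square_integrable_ltyP; first exact: measurable_coordinate.
by rewrite sqnorm_brownian// ltry.
Qed.

Lemma brownian_independent_coord s t A A' : 0 <= s -> s < t ->
  measurable A -> measurable A' ->
  P (B s @^-1` A `&` incrementRV s t @^-1` A') =
  (P (B s @^-1` A) * P (incrementRV s t @^-1` A'))%E.
Proof.
move=> s0 st mA mA'; rewrite setIC muleC.
apply: (brownian_independent hB s0 st).
- by exists A' => //; rewrite setTI.
- apply: sub_sigma_algebra; exists s => /=; first by rewrite in_itv/= s0 lexx.
  by exists A => //; rewrite setTI.
Qed.

(** Write B_t = B_s + (B_t - B_s), where the increment is centred and independent of B_s. *)
Lemma brownian_covariance s t : 0 <= s -> s <= t ->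
  (\int[P]_w (W s w * W t w)%:E = (normal_variance R * s)%:E)%E.
Proof.
move=> s0; rewrite le_eqVlt => /predU1P[<-|st].
  by rewrite -(sqnorm_brownian s0); apply: eq_integral => w _; rewrite expr2.
have t0 : 0 <= t by rewrite (le_trans s0)// ltW.
have sW := square_integrable_brownian s0.
have sI := square_integrable_increment s0 st.
have i1 := square_integrable_mul sW sW.
have i2 := square_integrable_mul sW sI.
transitivity (\int[P]_w ((W s w * W s w)%:E + (W s w * (W t w - W s w))%:E))%E.
  by apply: eq_integral => w _; rewrite -EFinD; congr EFin; ring.
rewrite integralD//.
have -> : (\int[P]_w (W s w * W s w)%:E = (normal_variance R * s)%:E)%E.
  by rewrite -(sqnorm_brownian s0); apply: eq_integral => w _; rewrite expr2.
suff -> : (\int[P]_w (W s w * (W t w - W s w))%:E = 0)%E by rewrite adde0.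
have eI w : tnth (incrementRV s t w) i = W t w - W s w by rewrite /= tnth_mktuple.
under eq_integral do rewrite -eI.
apply: (@integral_independent_mul _ _ _ _ _ _ R P (B s) (incrementRV s t) _
  (fun x => tnth x i) (fun x => tnth x i)).
- by move=> A A' mA mA'; exact: brownian_independent_coord.
- exact: measurable_tnth.
- exact: measurable_tnth.
- by under eq_fun do rewrite eI.
- under eq_fun do rewrite eI -[X in X%:E]mul1r.
  exact: (square_integrable_mul (square_integrable_cst 1) sI).
- by under eq_integral do rewrite eI; exact: integral_increment.
Qed.

End brownian_coordinate.

(** * The Wiener isometry and its closure *)

Lemma indic_itv_diff (R : realType) (a b s : R) : 0 <= a -> a <= b ->
  \1_(`]0, b] : set R) s - \1_(`]0, a] : set R) s = \1_(`]a, b] : set R) s :> R.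
Proof.
move=> a0 ab; rewrite !indicE !mem_setE !in_itv/=.
have [sa|sa] := leP s a.
  by rewrite (le_trans sa ab) subrr.
by rewrite (le_lt_trans a0 sa)/= subr0.
Qed.

Lemma measurable_mul_indic d (T : measurableType d) (R : realType) (D E : set T) (g : T -> R) :
  measurable D -> measurable E -> E `<=` D -> measurable_fun D g ->
  measurable_fun [set: T] (fun x => g x * \1_E x).
Proof.
move=> mD mE ED mg; rewrite (_ : (fun x => _) = g \_ E).
  by apply/(measurable_restrictT _ _).1 => //; exact: measurable_funS mg.
by apply/funext => x; rewrite patchE indicE; case: ifP; rewrite ?mulr1 ?mulr0.
Qed.

Lemma ereal_cvg0_le (R : realType) (u : nat -> \bar R) (e : R) : 0 < e ->
  u m @[m --> \oo] --> 0%E -> \forall m \near \oo, (u m <= e%:E)%E.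
Proof.
move=> e0 /fine_cvgP[f /cvgrPdist_lt/(_ _ e0)]; move: f; apply: filterS2 => m f.
by rewrite /= sub0r normrN -(fineK f) lee_fin => /ltW; exact: le_trans (ler_norm _).
Qed.

Section wiener_isometry.
Context dO (Omega : measurableType dO) (R : realType) (P : probability Omega R) (n : nat).
Context (B : R -> {RV P >-> n.-tuple R}) (hB : standard_brownian_motion B) (i : 'I_n).

Local Notation leb := (@lebesgue_measure R).
Local Notation rR := (measurableTypeR R).
Let W t w := tnth (B t w) i.
Local Notation kappa := (normal_variance R).

(** A list of pairs (c, t) stands for the sum of the step functions c on ]0, t], and this is
    its integral against the path. Every step function is of this form by differences.
    Reading times in absolute value makes every list admissible. *)
Definition path_sum (l : seq (R * R)) (w : Omega) : R :=
  \sum_(p <- l) p.1 * W `|p.2| w.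

Definition kernel_sum (l : seq (R * R)) (s : rR) : R :=
  \sum_(p <- l) p.1 * \1_(`]0, `|p.2|] : set R) s.

Lemma square_integrable_indic_itv (t : R) :
  square_integrable leb (\1_(`]0, t] : set R) : rR -> R).
Proof.
apply/square_integrable_ltyP; first exact: measurable_indic.
rewrite /sqnorm; apply: (@le_lt_trans _ _ (leb `]0, t])).
  rewrite -[X in leb X]setIT -integral_indic//= le_eqVlt; apply/orP; left; apply/eqP.
  by apply: eq_integral => x _; rewrite indicE; case: (_ \in _); rewrite ?expr1n ?expr0n.
by rewrite /= lebesgue_measure_itv/=; case: ifP; rewrite ?ltry// -EFinD ltry.
Qed.

Lemma integral_indic_itv_mul (s t : R) : 0 <= s -> s <= t ->
  (\int[leb]_x (\1_(`]0%R, s] : set R) x * \1_(`]0%R, t] : set R) x)%:E = s%:E :> \bar R)%E.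
Proof.
move=> s0 st.
transitivity (\int[leb]_x (\1_(`]0%R, s] : set R) x)%:E)%E.
  apply: eq_integral => x _; congr EFin; rewrite !indicE !mem_setE !in_itv/=.
  case: (boolP (0 < x)) => //= x0; last by rewrite mul0r.
  case: (boolP (x <= s)) => //= xs; last by rewrite mul0r.
  by rewrite (le_trans xs st) mulr1.
rewrite integral_indic//= setIT lebesgue_measure_itv/= lte_fin.
case: ltP => [_|h]; first by rewrite -EFinD subr0.
by congr EFin; apply/eqP; rewrite eq_le s0 h.
Qed.

Lemma measurable_path_sum l : measurable_fun [set: Omega] (path_sum l).
Proof.
apply: measurable_sum => p; apply: measurable_funM => //.
exact: measurable_coordinate.
Qed.

Lemma measurable_kernel_sum l : measurable_fun [set: rR] (kernel_sum l).
Proof.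
by apply: measurable_sum => p; apply: measurable_funM.
Qed.

(** Both sides are quadratic forms in the coefficients c, with matrices proportional to min
    (s, t). *)
Lemma wiener_isometry l :
  sqnorm P (path_sum l) = (kappa%:E * sqnorm leb (kernel_sum l))%E.
Proof.
pose mm (p q : R * R) := Num.min `|p.2| `|q.2|.
have cov (p q : R * R) : (\int[P]_w (W `|p.2| w * W `|q.2| w)%:E = (kappa * mm p q)%:E)%E.
  rewrite /mm; have [pq|/ltW qp] := leP `|p.2| `|q.2|.
    exact: (brownian_covariance hB).
  by under eq_integral do rewrite mulrC; exact: (brownian_covariance hB).
have lov (p q : R * R) : (\int[leb]_x (\1_(`]0%R, `|p.2|] : set R) x *
    \1_(`]0%R, `|q.2|] : set R) x)%:E = (mm p q)%:E)%E.
  rewrite /mm; have [pq|/ltW qp] := leP `|p.2| `|q.2|.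
    exact: integral_indic_itv_mul.
  by under eq_integral do rewrite mulrC; exact: integral_indic_itv_mul.
have iP (p q : R * R) : P.-integrable [set: Omega]
    (fun w => (p.1 * q.1)%:E * (W `|p.2| w * W `|q.2| w)%:E)%E.
  apply: integrableZl => //.
  by apply: square_integrable_mul; exact: square_integrable_brownian.
have iL (p q : R * R) : leb.-integrable [set: rR]
    (fun x => (p.1 * q.1)%:E * (\1_(`]0%R, `|p.2|] : set R) x * \1_(`]0%R, `|q.2|] : set R) x)%:E)%E.
  apply: integrableZl => //.
  by apply: square_integrable_mul; exact: square_integrable_indic_itv.
transitivity (\sum_(p <- l) \sum_(q <- l) \int[P]_w ((p.1 * q.1)%:E * (W `|p.2| w * W `|q.2| w)%:E))%E.
  rewrite /sqnorm.
  transitivity (\int[P]_w (\sum_(p <- l) \sum_(q <- l) ((p.1 * q.1)%:E * (W `|p.2| w * W `|q.2| w)%:E)))%E.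
    apply: eq_integral => w _; rewrite expr2 /path_sum big_distrlr/= -sumEFin.
    apply: eq_bigr => p _; rewrite -sumEFin; apply: eq_bigr => q _.
    by rewrite -EFinM; congr EFin; ring.
  rewrite integral_sum//; last by move=> p; exact: integrable_sum.
  by apply: eq_bigr => p _; rewrite integral_sum.
transitivity (kappa%:E * \sum_(p <- l) \sum_(q <- l)
    \int[leb]_x ((p.1 * q.1)%:E * (\1_(`]0%R, `|p.2|] : set R) x * \1_(`]0%R, `|q.2|] : set R) x)%:E))%E.
  transitivity ((kappa * \sum_(p <- l) \sum_(q <- l) (p.1 * q.1 * mm p q))%:E).
    rewrite big_distrr/= -sumEFin; apply: eq_bigr => p _.
    rewrite big_distrr/= -sumEFin; apply: eq_bigr => q _.
    rewrite integralZl//; last by apply: square_integrable_mul; exact: square_integrable_brownian.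
    by rewrite cov -EFinM; congr EFin; ring.
  rewrite EFinM; congr (_ * _)%E; rewrite -sumEFin; apply: eq_bigr => p _.
  rewrite -sumEFin; apply: eq_bigr => q _.
  rewrite integralZl//; last by apply: square_integrable_mul; exact: square_integrable_indic_itv.
  by rewrite lov -EFinM.
congr (_ * _)%E; rewrite /sqnorm.
transitivity (\int[leb]_x (\sum_(p <- l) \sum_(q <- l)
    ((p.1 * q.1)%:E * (\1_(`]0%R, `|p.2|] : set R) x * \1_(`]0%R, `|q.2|] : set R) x)%:E)))%E.
  rewrite integral_sum//; last by move=> p; exact: integrable_sum.
  by apply: eq_bigr => p _; rewrite integral_sum.
apply: eq_integral => x _; rewrite expr2 /kernel_sum big_distrlr/= -sumEFin.
apply: eq_bigr => p _; rewrite -sumEFin; apply: eq_bigr => q _.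
by rewrite -EFinM; congr EFin; ring.
Qed.

(** (I, g) lies in the closure of the graph of the elementary integral. The closure is a
    vector space, and the isometry extends to it up to the constant 4 of
    [wiener_approx_bound]. *)
Definition wiener_approx (I : Omega -> R) (g : rR -> R) : Prop :=
  [/\ measurable_fun [set: Omega] I, measurable_fun [set: rR] g &
  forall e : R, 0 < e -> exists l,
    (sqnorm P (fun w => path_sum l w - I w)%R <= e%:E)%E /\
    (sqnorm leb (fun s => kernel_sum l s - g s)%R <= e%:E)%E].

Lemma path_sum_cat l l' w : path_sum (l ++ l') w = path_sum l w + path_sum l' w.
Proof. by rewrite /path_sum big_cat. Qed.

Lemma kernel_sum_cat l l' s : kernel_sum (l ++ l') s = kernel_sum l s + kernel_sum l' s.
Proof. by rewrite /kernel_sum big_cat. Qed.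

Lemma path_sumZ c l w : path_sum [seq (c * p.1, p.2) | p <- l] w = c * path_sum l w.
Proof. by rewrite /path_sum big_map big_distrr/=; apply: eq_bigr => p _; rewrite mulrA. Qed.

Lemma kernel_sumZ c l s : kernel_sum [seq (c * p.1, p.2) | p <- l] s = c * kernel_sum l s.
Proof. by rewrite /kernel_sum big_map big_distrr/=; apply: eq_bigr => p _; rewrite mulrA. Qed.

Lemma sqnorm0 d (T : measurableType d) (mu : {measure set T -> \bar R}) :
  sqnorm mu (fun=> 0) = 0%E.
Proof. by apply: integral0_eq => x _; rewrite expr0n. Qed.

Lemma wiener_approx_elementary l : wiener_approx (path_sum l) (kernel_sum l).
Proof.
split; [exact: measurable_path_sum|exact: measurable_kernel_sum|] => e e0.
exists l; split.
- under eq_fun do rewrite subrr.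
  by rewrite sqnorm0 lee_fin ltW.
- under eq_fun do rewrite subrr.
  by rewrite sqnorm0 lee_fin ltW.
Qed.

Lemma sqnormD_le d (T : measurableType d) (mu : {measure set T -> \bar R}) (f g : T -> R) (e : R) :
  measurable_fun [set: T] f -> measurable_fun [set: T] g ->
  (sqnorm mu f <= (e / 4)%:E)%E -> (sqnorm mu g <= (e / 4)%:E)%E ->
  (sqnorm mu (fun x => f x + g x)%R <= e%:E)%E.
Proof.
move=> mf mg fe ge; apply: (le_trans (sqnormD mu mf mg)).
apply: (@le_trans _ _ (2%:E * ((e / 4)%:E + (e / 4)%:E))%E).
  by rewrite lee_wpmul2l ?lee_fin// leeD.
by rewrite -EFinD -EFinM lee_fin; lra.
Qed.

Lemma wiener_approxD I g I' g' : wiener_approx I g -> wiener_approx I' g' ->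
  wiener_approx (fun w => I w + I' w) (fun s => g s + g' s).
Proof.
move=> [mI mg H] [mI' mg' H']; split.
- exact: measurable_funD.
- exact: measurable_funD.
move=> e e0; have e4 : 0 < e / 4 by rewrite divr_gt0.
have [l [h1 h2]] := H _ e4; have [l' [h1' h2']] := H' _ e4.
exists (l ++ l'); split.
- rewrite (_ : (fun w => _) = fun w => (path_sum l w - I w) + (path_sum l' w - I' w)); last first.
    by apply/funext => w; rewrite path_sum_cat; ring.
  by apply: sqnormD_le => //; apply: measurable_funB => //; exact: measurable_path_sum.
- rewrite (_ : (fun s => _) = fun s => (kernel_sum l s - g s) + (kernel_sum l' s - g' s)); last first.
    by apply/funext => s; rewrite kernel_sum_cat; ring.
  by apply: sqnormD_le => //; apply: measurable_funB => //; exact: measurable_kernel_sum.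
Qed.

Lemma wiener_approxZ c I g : wiener_approx I g ->
  wiener_approx (fun w => c * I w) (fun s => c * g s).
Proof.
move=> [mI mg H]; split; [exact: measurable_funM|exact: measurable_funM|].
move=> e e0; have c1 : 0 < c ^+ 2 + 1 by rewrite ltr_wpDl ?sqr_ge0.
have ec : 0 < e / (c ^+ 2 + 1) by rewrite divr_gt0.
have [l [h1 h2]] := H _ ec.
have key : ((c ^+ 2)%:E * (e / (c ^+ 2 + 1))%:E <= e%:E)%E.
  by rewrite -EFinM lee_fin mulrA ler_pdivrMr// mulrC ler_wpM2l ?(ltW e0)// lerDl.
exists [seq (c * p.1, p.2) | p <- l]; split.
- rewrite (_ : (fun w => _) = fun w => c * (path_sum l w - I w)); last first.
    by apply/funext => w; rewrite path_sumZ; ring.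
  rewrite sqnormZ; last by apply: measurable_funB => //; exact: measurable_path_sum.
  by apply: le_trans key; rewrite lee_wpmul2l// lee_fin sqr_ge0.
- rewrite (_ : (fun s => _) = fun s => c * (kernel_sum l s - g s)); last first.
    by apply/funext => s; rewrite kernel_sumZ; ring.
  rewrite sqnormZ; last by apply: measurable_funB => //; exact: measurable_kernel_sum.
  by apply: le_trans key; rewrite lee_wpmul2l// lee_fin sqr_ge0.
Qed.

Lemma wiener_approx_sum m (I : nat -> Omega -> R) (g : nat -> rR -> R) :
  (forall k, (k < m)%N -> wiener_approx (I k) (g k)) ->
  wiener_approx (fun w => \sum_(k < m) I k w) (fun s => \sum_(k < m) g k s).
Proof.
elim: m => [_|m IH H].
  have := wiener_approx_elementary [::].
  congr wiener_approx; apply/funext => x; by rewrite /path_sum /kernel_sum big_nil big_ord0.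
have := wiener_approxD (IH (fun k km => H k (ltnW km))) (H m (leqnn _)).
by congr wiener_approx; apply/funext => x; rewrite big_ord_recr.
Qed.

(** Apply (x + y)^2 <= 2 (x^2 + y^2) on both sides of the isometry for an approximating step
    function. *)
Lemma wiener_approx_bound I g : wiener_approx I g ->
  (sqnorm P I <= (4 * kappa)%:E * sqnorm leb g)%E.
Proof.
move=> [mI mg H]; apply/lee_addgt0Pr => e e0.
have k0 := normal_variance_ge0 R.
(* chosen so that 2 (e' + kappa (2 (e' + r))) = 4 kappa r + e *)
pose e' := e / (2 + 4 * kappa).
have k1 : 0 < 2 + 4 * kappa by rewrite ltr_pwDl// mulr_ge0.
have e'0 : 0 < e' by rewrite divr_gt0.
have [l [h1 h2]] := H _ e'0.
have mJ := measurable_path_sum l; have mh := measurable_kernel_sum l.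
have hI : (sqnorm P I <= 2%:E * (e'%:E + kappa%:E * sqnorm leb (kernel_sum l)))%E.
  rewrite -wiener_isometry.
  rewrite (_ : I = fun w => (-1) * (path_sum l w - I w) + path_sum l w); last first.
    by apply/funext => w; ring.
  apply: le_trans.
    apply: sqnormD => //; apply: measurable_funM => //; exact: measurable_funB.
  rewrite lee_wpmul2l ?lee_fin// leeD2r//.
  rewrite sqnormZ; last exact: measurable_funB.
  by rewrite sqrrN expr1n mul1e.
have hg : (sqnorm leb (kernel_sum l) <= 2%:E * (e'%:E + sqnorm leb g))%E.
  rewrite [X in sqnorm leb X](_ : _ = fun s => (kernel_sum l s - g s) + g s); last first.
    by apply/funext => s; ring.
  apply: le_trans; first by apply: sqnormD => //; exact: measurable_funB.
  by rewrite lee_wpmul2l ?lee_fin// leeD2r.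
apply: (le_trans hI).
have := sqnorm_ge0 leb g.
case: (sqnorm leb g) hg => [r| |] //.
- move=> hg _.
  have hg' : (sqnorm leb (kernel_sum l) <= (2 * (e' + r))%:E)%E by rewrite EFinM EFinD.
  apply: (@le_trans _ _ (2%:E * (e'%:E + kappa%:E * (2 * (e' + r))%:E))%E).
    by rewrite lee_wpmul2l ?lee_fin// leeD2l// lee_wpmul2l ?lee_fin.
  rewrite (_ : (2%:E * _)%E = (2 * (e' + kappa * (2 * (e' + r))))%:E) // (_ : (_ + e%:E)%E = (4 * kappa * r + e)%:E)// lee_fin.
  have -> : e = e' * (2 + 4 * kappa) by rewrite /e' divfK// gt_eqF.
  by rewrite le_eqVlt; apply/orP; left; apply/eqP; ring.
- move=> _ _; have [k00|kn0] := eqVneq kappa 0.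
    rewrite k00 mulr0 !mul0e adde0 add0e -EFinM lee_fin /e' k00.
    by rewrite mulr0 addr0 mulrCA mulfV ?mulr1.
  rewrite mulry gtr0_sg ?mul1e ?addye ?leey//.
  by rewrite mulr_gt0// lt0r kn0.
Qed.

(** The approximating step functions of an Ito integral over [0, t] vanish off ]0, t], so
    they also approximate g cut off to ]0, t] on the whole line. *)
Lemma ito_wiener_approx (g : R -> R) (t T : R) (I : Omega -> R) : 0 <= t -> t <= T ->
  measurable_fun `[0, T]%classic (g : rR -> R) ->
  measurable_fun [set: Omega] I ->
  is_ito_integral P (fun s w => tnth (B s w) i) g t I ->
  wiener_approx I (fun s : rR => g s * \1_(`]0, t] : set R) s).
Proof.
move=> t0 tT mg mI [N [u [c [Hu Hg HI]]]].
have mg' : measurable_fun [set: rR] (fun s : rR => g s * \1_(`]0, t] : set R) s).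
  apply: (@measurable_mul_indic _ _ _ `[0, T]) => // s /=.
  by rewrite !in_itv/= => /andP[s0 st]; rewrite ltW//= (le_trans st).
split => // e e0.
have [j [hj1 hj2]] : exists j,
   (\int[leb]_(s in `[0%R, t]) ((g s - step_fun (N j) (u j) (c j) s) ^+ 2)%:E <= e%:E)%E /\
   (sqnorm P (fun w => step_integral (N j) (u j) (c j) (fun s w => tnth (B s w) i) w - I w)%R <= e%:E)%E.
  have [m _ Hm] := filterI (ereal_cvg0_le e0 Hg) (ereal_cvg0_le e0 HI).
  have /= [h1] := Hm m (leqnn m); rewrite unlock => h2.
  by exists m; split.
have [uj0 ujN ujm] := Hu j.
have u0 k : 0 <= u j k by rewrite -uj0 ujm.
have ut k : (k <= N j)%N -> u j k <= t by move=> kN; rewrite -ujN ujm.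
(* the indicator of ]u, v] is the difference of those of ]0, v] and ]0, u] *)
pose l := [seq (c j k, u j k.+1) | k <- index_iota 0 (N j)] ++
  [seq (- c j k, u j k) | k <- index_iota 0 (N j)].
exists l.
have -> : path_sum l = step_integral (N j) (u j) (c j) (fun s w => tnth (B s w) i).
  apply/funext => w; rewrite /path_sum /l big_cat !big_map/= /step_integral.
  rewrite -big_split/= big_mkord; apply: eq_bigr => k _.
  by rewrite !ger0_norm// mulNr mulrBr.
have -> : kernel_sum l = step_fun (N j) (u j) (c j).
  apply/funext => s; rewrite /kernel_sum /l big_cat !big_map/= /step_fun.
  rewrite -big_split/= big_mkord; apply: eq_bigr => k _.
  by rewrite !ger0_norm// mulNr -mulrBr indic_itv_diff//; exact: ujm.
split => //.
apply: le_trans hj1; rewrite [leRHS]integral_mkcond /sqnorm.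
apply: ge0_le_integral => //.
- by move=> s _; rewrite lee_fin sqr_ge0.
- apply/measurable_EFinP; apply: measurable_funX; apply: measurable_funB => //.
  by apply: measurable_sum => k; apply: measurable_funM.
- apply/(measurable_restrictT _ _).1 => //.
  apply/measurable_EFinP; apply: measurable_funX; apply: measurable_funB.
    apply: measurable_funS mg => //; apply: subset_itvl; rewrite bnd_simp//.
  by apply: measurable_funTS; apply: measurable_sum => k; apply: measurable_funM.
- move=> s _; rewrite patchE; case: ifPn => sI.
    rewrite lee_fin indicE mem_setE in_itv/=.
    move: sI; rewrite inE /= in_itv/= => /andP[s0 st]; rewrite st andbT.
    case: (ltP 0 s) => s00; first by rewrite mulr1 -[leRHS]sqrrN opprB.
    rewrite mulr0 subr0 (_ : step_fun _ _ _ s = 0) ?expr0n ?sqr_ge0//.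
    rewrite /step_fun big1// => k _; rewrite indicE memNset ?mulr0//=; rewrite in_itv/= => /andP[us _].
    by have := lt_le_trans us (le_trans s00 (u0 k)); rewrite ltxx.
  rewrite (_ : step_fun _ _ _ s = 0).
    rewrite indicE memNset ?mulr0 ?subrr ?expr0n//= in_itv/= => /andP[s0 st].
    by move/negP: sI; apply; rewrite inE /= in_itv/= ltW.
  rewrite /step_fun big1// => k _; rewrite indicE memNset ?mulr0//=; rewrite in_itv/= => /andP[us su].
  move/negP: sI; apply; rewrite inE /= in_itv/= (le_trans (u0 k) (ltW us))/=.
  by rewrite (le_trans su)// ut//; case: k {us su}.
Qed.

End wiener_isometry.

(** * Deterministic estimates on the schedule *)

Lemma heine_segment (R : realType) (f : R -> R) (a b e : R) :
  {within `[a, b], continuous f} -> 0 < e ->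
  exists2 eta, 0 < eta & forall s t, s \in `[a, b] -> t \in `[a, b] ->
    `|s - t| < eta -> `|f s - f t| < e.
Proof.
move=> cf e0.
have /compact_near_coveringP cov := @segment_compact R a b.
have : \forall eta \near (0 : R)^'+, forall s, `[a, b]%classic s ->
    forall t, `[a, b]%classic t -> `|s - t| < eta -> `|f s - f t| < e.
  suff : \forall eta \near (0 : R)^'+, forall s, `[a, b]%classic s -> `[a, b]%classic s ->
    forall t, `[a, b]%classic t -> `|s - t| < eta -> `|f s - f t| < e.
    by apply: filterS => eta h s sI; exact: h.
  apply: cov => s sI.
  have e2 : 0 < e / 2 by rewrite divr_gt0.
  have /subspace_continuousP/(_ s sI)/cvgrPdist_lt/(_ _ e2) := cf.
  move=> [r /= r0 hr]; have r2 : 0 < r / 2 by rewrite divr_gt0.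
  exists (ball s (r / 2), [set eta | 0 < eta < r / 2]).
    split; first exact: nbhsx_ballx.
    exists (r / 2) => //= y; rewrite /= sub0r normrN => yr y0.
    by rewrite y0 (le_lt_trans (ler_norm _)).
  move=> [s' eta] /= [ss' /andP[eta0 etar]] s'I t tI st.
  have h1 : `|f s - f s'| < e / 2.
    apply: hr => //=; rewrite (lt_le_trans ss')// ler_pdivrMr// ler_peMr ?ltW//.
    by rewrite ltr1n.
  have h2 : `|f s - f t| < e / 2.
    apply: hr => //=; rewrite -[s](subrK s') -addrA (le_lt_trans (ler_normD _ _))//.
    by rewrite [r]splitr ltrD// (lt_trans st).
  rewrite -[f s'](subrK (f s)) -addrA (le_lt_trans (ler_normD _ _))//.
  by rewrite [e]splitr ltrD// distrC.
move=> [r /= r0 hr]; exists (r / 2); first by rewrite divr_gt0.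
move=> s t sI tI st.
apply: (hr (r / 2)) => //=.
- rewrite sub0r normrN ger0_norm ?ltW ?divr_gt0// ltr_pdivrMr// ltr_pMr// ltr1n//.
- by rewrite divr_gt0.
Qed.

Lemma expR_sqr_shift (R : realType) (a b c : R) :
  expR (a - c) ^+ 2 = expR (b - c) ^+ 2 * expR (2 * (a - b)).
Proof. by rewrite -!expRM_natl -expRD; congr expR; ring. Qed.

Section schedule.
Context (R : realType) (T sigma : R) (beta : R -> R).
Context (sigma0 : 0 < sigma) (hbeta : noise_schedule T beta).
Local Notation leb := (@lebesgue_measure R).

Let al s := beta s / (2 * sigma ^+ 2).

Let s20 : 0 < 2 * sigma ^+ 2.
Proof. by rewrite mulr_gt0// exprn_gt0. Qed.

Lemma continuous_beta : {within `[0, T], continuous beta}.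
Proof. exact: schedule_continuous hbeta. Qed.

Lemma continuous_rate : {within `[0, T], continuous al}.
Proof.
apply/subspace_continuousP => x xI; apply: cvgM; last exact: cvg_cst.
by move/subspace_continuousP : continuous_beta; apply.
Qed.

Lemma continuous_segment_integrable (f : R -> R) (D : set R) :
  {within `[0, T], continuous f} -> measurable (D : set (measurableTypeR R)) -> D `<=` `[0, T] ->
  leb.-integrable D (EFin \o f).
Proof.
move=> cf mD DT; apply: (@integrableS _ _ _ leb `[0, T]) => //.
by apply: continuous_compact_integrable => //; exact: segment_compact.
Qed.

Definition rate_integral (t : R) : R := \int[leb]_(s in `[0, t]) (beta s / (2 * sigma ^+ 2)).
Local Notation A := rate_integral.

(** The integrating factor of the equation, normalized to be 1 at time T. *)
Definition decay (t : R) : R := expR (A t - A T).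
Local Notation w := decay.

Lemma itv_sub (s t : R) : 0 <= s -> t <= T -> `]s, t] `<=` `[0, T].
Proof.
move=> s0 tT x /=; rewrite !in_itv/= => /andP[sx xt].
by rewrite (le_trans s0 (ltW sx)) (le_trans xt).
Qed.

Lemma itvcc_sub (t : R) : t <= T -> `[0, t] `<=` `[0, T].
Proof. by move=> tT x /=; rewrite !in_itv/= => /andP[-> xt]; rewrite (le_trans xt). Qed.

Lemma Rintegral_segment_diff (f : R -> R) (s t : R) :
  {within `[0, T], continuous f} -> 0 <= s -> s <= t -> t <= T ->
  \int[leb]_(x in `[0, t]) f x - \int[leb]_(x in `[0, s]) f x =
  \int[leb]_(x in `]s, t]) f x.
Proof.
move=> cf s0 st tT; rewrite Rintegral_itvB//.
- by apply: continuous_segment_integrable => //; exact: itvcc_sub.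
Qed.

Lemma Rintegral_itv_cst (c s t : R) : s <= t -> \int[leb]_(x in `]s, t]) c = c * (t - s).
Proof.
move=> st; rewrite Rintegral_cst//= lebesgue_measure_itv/= lte_fin.
move: st; rewrite le_eqVlt => /predU1P[->|st]; first by rewrite ltxx subrr.
by rewrite st -EFinD.
Qed.

Lemma cst_integrable_itv (c s t : R) : leb.-integrable `]s, t] (EFin \o (fun=> c)).
Proof.
apply: measurable_bounded_integrable => //.
  by rewrite /= lebesgue_measure_itv/=; case: ifP; rewrite ?ltry// -EFinD ltry.
exact: bounded_cst.
Qed.

Lemma schedule_gt0 s : 0 <= s <= T -> 0 < beta s.
Proof. by move=> sT; apply: (schedule_positive hbeta); rewrite in_itv. Qed.

Lemma beta_mono s t : 0 <= s -> s <= t -> t <= T -> beta s <= beta t.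
Proof.
move=> s0 st tT; apply: (schedule_nondecreasing hbeta) => //; rewrite in_itv/=.
  by rewrite s0 (le_trans st).
by rewrite (le_trans s0).
Qed.

Lemma rate_diff s t : 0 <= s -> s <= t -> t <= T ->
  A t - A s = \int[leb]_(x in `]s, t]) al x.
Proof. by move=> s0 st tT; exact: (Rintegral_segment_diff continuous_rate). Qed.

Lemma rate_diff_bounds s t : 0 <= s -> s <= t -> t <= T ->
  beta s * (t - s) <= 2 * sigma ^+ 2 * (A t - A s) <= beta t * (t - s).
Proof.
move=> s0 st tT; rewrite rate_diff//.
have iC c := cst_integrable_itv c s t.
have ial : leb.-integrable `]s, t] (EFin \o al).
  by apply: (continuous_segment_integrable continuous_rate) => //; exact: itv_sub.
apply/andP; split.
- rewrite -ler_pdivrMl// mulrA [_^-1 * _]mulrC -/(al s) -(@Rintegral_itv_cst (al s) s t)//.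
  apply: le_Rintegral => // x /=; rewrite in_itv/= => /andP[sx xt].
  by rewrite ler_pM2r ?invr_gt0//; apply: beta_mono; rewrite ?(ltW sx)// (le_trans xt).
- rewrite -ler_pdivlMl// mulrA [_^-1 * _]mulrC -/(al t) -(@Rintegral_itv_cst (al t) s t)//.
  apply: le_Rintegral => // x /=; rewrite in_itv/= => /andP[sx xt].
  by rewrite ler_pM2r ?invr_gt0//; apply: beta_mono; rewrite ?(le_trans s0 (ltW sx)).
Qed.

Lemma rate_le s t : 0 <= s -> s <= t -> t <= T -> A s <= A t.
Proof.
move=> s0 st tT; have /andP[h _] := rate_diff_bounds s0 st tT.
rewrite -subr_ge0 -(pmulr_rge0 _ s20) (le_trans _ h)// mulr_ge0 ?subr_ge0//.
by rewrite ltW// schedule_gt0// s0 (le_trans st).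
Qed.

Lemma rate_lt s t : 0 <= s -> s < t -> t <= T -> A s < A t.
Proof.
move=> s0 st tT; have /andP[h _] := rate_diff_bounds s0 (ltW st) tT.
rewrite -subr_gt0 -(pmulr_rgt0 _ s20) (lt_le_trans _ h)// mulr_gt0 ?subr_gt0//.
by rewrite schedule_gt0// s0 (le_trans (ltW st)).
Qed.

Lemma rate0 : A 0 = 0.
Proof. by rewrite /A set_itv1 Rintegral_set1. Qed.

Lemma decayT : w T = 1. Proof. by rewrite /w subrr expR0. Qed.

Lemma decay_gt0 t : 0 < w t. Proof. exact: expR_gt0. Qed.

Lemma decay_le s t : 0 <= s -> s <= t -> t <= T -> w s <= w t.
Proof. by move=> s0 st tT; rewrite ler_expR lerD2r rate_le. Qed.

Lemma decay_lt s t : 0 <= s -> s < t -> t <= T -> w s < w t.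
Proof. by move=> s0 st tT; rewrite ltr_expR ltrD2r rate_lt. Qed.

Lemma decay0 : w 0 ^+ 2 = expR (- (1 / sigma ^+ 2 * \int[leb]_(s in `[0, T]) beta s)).
Proof.
rewrite /w rate0 sub0r -expRM_natl; congr expR.
rewrite /A RintegralZr//; last first.
  by apply: continuous_segment_integrable => //; exact: continuous_beta.
by field; rewrite gt_eqF.
Qed.

(** A step of this height over ]s, t] has the variance sigma^2 (w_t^2 - w_s^2) of the Ito
    integral of [ito_weight] over ]s, t]: sums of such steps have exactly the law of the
    limit. *)
Definition step_height (s t : R) : R := sigma * Num.sqrt ((w t ^+ 2 - w s ^+ 2) / (t - s)).

(** X_T - w_0 X_0 is the Ito integral of this function over [0, T]. *)
Definition ito_weight (t : R) : R := w t * Num.sqrt (beta t).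

Lemma decay_sqr_le s t : 0 <= s -> s <= t -> t <= T -> w s ^+ 2 <= w t ^+ 2.
Proof. by move=> s0 st tT; rewrite lerXn2r ?nnegrE ?(ltW (decay_gt0 _)) ?decay_le. Qed.

Lemma decay_sqr_lt s t : 0 <= s -> s < t -> t <= T -> w s ^+ 2 < w t ^+ 2.
Proof. by move=> s0 st tT; rewrite ltrXn2r ?nnegrE ?(ltW (decay_gt0 _)) ?decay_lt. Qed.

Lemma step_height_gt0 s t : 0 <= s -> s < t -> t <= T -> 0 < step_height s t.
Proof.
move=> s0 st tT; rewrite mulr_gt0// sqrtr_gt0 divr_gt0 ?subr_gt0//.
exact: decay_sqr_lt.
Qed.

Lemma step_height_sqr s t : 0 <= s -> s < t -> t <= T ->
  step_height s t ^+ 2 * (t - s) = sigma ^+ 2 * (w t ^+ 2 - w s ^+ 2).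
Proof.
move=> s0 st tT; have ts : 0 < t - s by rewrite subr_gt0.
have wts : 0 <= w t ^+ 2 - w s ^+ 2 by rewrite subr_ge0; exact: (decay_sqr_le s0 (ltW st) tT).
rewrite exprMn sqr_sqrtr; last exact: (divr_ge0 wts (ltW ts)).
by rewrite -!mulrA mulVf ?mulr1// gt_eqF// subr_gt0.
Qed.

Let lower_alg (sg W W' D b dt : R) :
  sg * (W * (1 + 2 * D)) <= sg * W' -> W * (b * dt) <= W * (2 * sg * D) ->
  W * b * dt <= sg * (W' - W).
Proof. lra. Qed.

Let upper_alg (sg W W' D b dt : R) :
  sg * (W' * (1 + - (2 * D))) <= sg * W -> W' * (2 * sg * D) <= W' * (b * dt) ->
  sg * (W' - W) <= W' * b * dt.
Proof. lra. Qed.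

(** The step height is a quadratic mean of the nondecreasing function [ito_weight]; both
    bounds follow from 1 + x <= e^x and the monotonicity of beta. *)
Lemma step_height_bounds s t : 0 <= s -> s < t -> t <= T ->
  ito_weight s <= step_height s t <= ito_weight t.
Proof.
move=> s0 st tT.
have ts : 0 < t - s by rewrite subr_gt0.
have bs : 0 < beta s by rewrite schedule_gt0// s0 (le_trans (ltW st)).
have bt : 0 < beta t by rewrite schedule_gt0// (le_trans s0 (ltW st)).
have /andP[h1 h2] := rate_diff_bounds s0 (ltW st) tT.
have sh := step_height_sqr s0 st tT.
have ws : w s ^+ 2 = w t ^+ 2 * expR (- (2 * (A t - A s))).
  by rewrite -mulrN opprB; exact: expR_sqr_shift.
have wt : w t ^+ 2 = w s ^+ 2 * expR (2 * (A t - A s)).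
  exact: expR_sqr_shift.
have wt0 : 0 <= w t ^+ 2 by rewrite sqr_ge0.
have ws0 : 0 <= w s ^+ 2 by rewrite sqr_ge0.
have sg0 : 0 <= sigma ^+ 2 by rewrite sqr_ge0.
apply/andP; split.
- rewrite -(@ler_pXn2r _ 2) ?nnegrE ?mulr_ge0 ?sqrtr_ge0 ?(ltW (decay_gt0 _)) ?(ltW sigma0)//.
  rewrite -(ler_pM2r ts) sh exprMn sqr_sqrtr ?(ltW bs)//.
  have e1 := expR_ge1Dx (2 * (A t - A s)).
  have := ler_wpM2l ws0 e1; rewrite -wt => h3.
  exact: lower_alg (ler_wpM2l sg0 h3) (ler_wpM2l ws0 h1).
- rewrite -(@ler_pXn2r _ 2) ?nnegrE ?mulr_ge0 ?sqrtr_ge0 ?(ltW (decay_gt0 _)) ?(ltW sigma0)//.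
  rewrite -(ler_pM2r ts) sh exprMn sqr_sqrtr ?(ltW bt)//.
  have e1 := expR_ge1Dx (- (2 * (A t - A s))).
  have := ler_wpM2l wt0 e1; rewrite -ws => h3.
  exact: upper_alg (ler_wpM2l sg0 h3) (ler_wpM2l wt0 h2).
Qed.

Lemma ito_weight_le s t : 0 <= s -> s <= t -> t <= T -> ito_weight s <= ito_weight t.
Proof.
move=> s0 st tT; apply: ler_pM; [exact: ltW (decay_gt0 _)|exact: sqrtr_ge0|exact: decay_le|].
by rewrite ler_wsqrtr// beta_mono.
Qed.

End schedule.

(** The values j k are those of disjoint indicators: at most one term survives, and its
    square is at most b k * b k <= Q * b k. *)
Lemma sqr_indicator_sum_le (R : realType) m (a b j : nat -> R) (Q : R) :
  (forall k, (k < m)%N -> `|a k| <= b k) ->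
  \sum_(k < m) b k <= Q ->
  (forall k, (k < m)%N -> j k = 0 \/ j k = 1) ->
  (forall k l, (k < m)%N -> (l < m)%N -> k <> l -> j k * j l = 0) ->
  (\sum_(k < m) a k * j k) ^+ 2 <= \sum_(k < m) Q * b k * j k.
Proof.
move=> ab bQ j01 jd.
have b0 k : (k < m)%N -> 0 <= b k by move=> km; rewrite (le_trans _ (ab k km)).
have j0 k : (k < m)%N -> 0 <= j k by move=> km; case: (j01 k km) => ->.
have Q0 : 0 <= Q by rewrite (le_trans _ bQ)// sumr_ge0// => k _; exact: b0.
have [/existsP[k /eqP jk]|/existsPn nj] := boolP [exists k : 'I_m, j k == 1]; last first.
  rewrite big1 ?expr0n/= ?sumr_ge0// => k _; first by rewrite mulr_ge0 ?j0// mulr_ge0// b0.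
  by case: (j01 k (ltn_ord k)) => [->|/eqP jk]; [rewrite mulr0|have := nj k; rewrite jk].
have jl (l : 'I_m) : l != k -> j l = 0.
  move=> lk; have := @jd k l (ltn_ord k) (ltn_ord l); rewrite jk mul1r; apply.
  by move=> kl; move: lk; rewrite -val_eqE/= kl eqxx.
rewrite (bigD1 k)//= big1 ?addr0; last by move=> l lk; rewrite jl// mulr0.
rewrite (bigD1 k)//= big1 ?addr0; last by move=> l lk; rewrite jl// mulr0.
rewrite jk !mulr1 -real_normK ?num_real// expr2.
apply: (@le_trans _ _ (b k * b k)); first by rewrite ler_pM// ab.
rewrite ler_wpM2r ?b0//; apply: le_trans bQ.
by rewrite (bigD1 k)//= lerDl sumr_ge0// => l _; exact: b0.
Qed.

Section grid.
Context (R : realType) (T sigma : R) (beta : R -> R).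
Context (T0 : 0 < T) (sigma0 : 0 < sigma) (hbeta : noise_schedule T beta).
Local Notation leb := (@lebesgue_measure R).
Local Notation rR := (measurableTypeR R).
Local Notation A := (rate_integral sigma beta).
Local Notation w := (decay T sigma beta).
Local Notation q := (ito_weight T sigma beta).

Definition grid (n k : nat) : R := k%:R * (T / n.+1%:R).

Lemma mesh_gt0 n : 0 < T / n.+1%:R. Proof. exact: divr_gt0. Qed.

Lemma grid0 n : grid n 0 = 0. Proof. by rewrite /grid mul0r. Qed.

Lemma gridT n : grid n n.+1 = T.
Proof. by rewrite /grid mulrCA mulfV ?mulr1// pnatr_eq0. Qed.

Lemma gridS n k : grid n k.+1 - grid n k = T / n.+1%:R.
Proof. by rewrite /grid -mulrBl -natrB// subSnn mul1r. Qed.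

Lemma grid_ge0 n k : 0 <= grid n k.
Proof. by rewrite mulr_ge0// ltW// mesh_gt0. Qed.

Lemma grid_ltS n k : grid n k < grid n k.+1.
Proof. by rewrite -subr_gt0 gridS mesh_gt0. Qed.

Lemma grid_le n k l : (k <= l)%N -> grid n k <= grid n l.
Proof. by move=> kl; rewrite /grid ler_pM2r ?mesh_gt0// ler_nat. Qed.

Lemma grid_leT n k : (k <= n.+1)%N -> grid n k <= T.
Proof. by move=> kn; rewrite -[leRHS](gridT n) grid_le. Qed.

Lemma grid_mem n k : (k <= n.+1)%N -> grid n k \in `[0, T].
Proof. by move=> kn; rewrite in_itv/= grid_ge0 grid_leT. Qed.

Lemma cvg_mesh (c : R) : (c * (T / n.+1%:R)) @[n --> \oo] --> (0 : R).
Proof.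
rewrite -(mulr0 (c * T)); under eq_cvg do rewrite mulrA.
by apply: cvgM; [exact: cvg_cst|exact: cvg_harmonic].
Qed.

(** The integrand of sum_k w_k (I_(k+1) - I_k), for I the Ito integral of the square root of
    beta, minus the step function of the step heights. *)
Definition kernel_error n (s : R) : R :=
  \sum_(k < n.+1)
    (w (grid n k) * Num.sqrt (beta s) - step_height T sigma beta (grid n k) (grid n k.+1))
    * \1_(`]grid n k, grid n k.+1] : set R) s.

Lemma measurable_sqrt_beta :
  measurable_fun `[0, T]%classic ((fun s => Num.sqrt (beta s)) : rR -> R).
Proof.
apply: subspace_continuous_measurable_fun => //.
apply/subspace_continuousP => x xI; apply: (@cvg_comp _ _ _ beta (@Num.sqrt R)).
  by move/subspace_continuousP : (continuous_beta hbeta); apply.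
exact: sqrt_continuous.
Qed.

Lemma measurable_kernel_error n :
  measurable_fun [set: rR] (kernel_error n : rR -> R).
Proof.
have := @measurable_sum _ _ R setT 'I_n.+1 (index_enum 'I_n.+1)
  (fun k (s : rR) =>
    (w (grid n k) * Num.sqrt (beta s) - step_height T sigma beta (grid n k) (grid n k.+1))
    * \1_(`]grid n k, grid n k.+1] : set R) s).
apply => k; apply: (@measurable_mul_indic _ _ _ `[0, T]) => //.
- by apply: itv_sub; [exact: grid_ge0|exact: grid_leT].
- by apply: measurable_funB => //; apply: measurable_funM => //; exact: measurable_sqrt_beta.
Qed.

(** On each cell of the grid the error is at most the increase of [ito_weight] over the
    cell. These increases add up to a constant, which leaves one factor of the mesh. *)
Lemma sqnorm_kernel_error n :
  (sqnorm leb (kernel_error n : rR -> R) <= ((q T - q 0) ^+ 2 * (T / n.+1%:R))%:E)%E.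
Proof.
pose b k := q (grid n k.+1) - q (grid n k).
pose Q := q T - q 0.
have sb : \sum_(k < n.+1) b k = Q.
  by rewrite -(big_mkord xpredT b) (telescope_sumr (fun k => q (grid n k)))// gridT grid0.
have b0 k : (k < n.+1)%N -> 0 <= b k.
  move=> kn; rewrite subr_ge0; apply: ito_weight_le => //; [exact: grid_ge0| |exact: grid_leT].
  exact/ltW/grid_ltS.
have Q0 : 0 <= Q by rewrite -sb sumr_ge0// => k _; exact: b0.
pose g k (s : rR) : \bar R := (Q * b k * \1_(`]grid n k, grid n k.+1] : set R) s)%:E.
have mg k : measurable_fun [set: rR] (g k).
  by apply/measurable_EFinP; apply: measurable_funM.
have g0 k s : (k < n.+1)%N -> (0 <= g k s)%E.
  by move=> kn; rewrite lee_fin mulr_ge0 ?indicE// mulr_ge0// b0.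
apply: (@le_trans _ _ (\int[leb]_s (\sum_(k < n.+1) g k s))%E); last first.
  rewrite (@ge0_integral_sum _ _ _ leb setT measurableT 'I_n.+1 (fun k : 'I_n.+1 => g k)) //; last first.
    by move=> k s _; exact: g0.
  rewrite (eq_bigr (fun k : 'I_n.+1 => (Q * b k * (T / n.+1%:R))%:E)).
    by rewrite sumEFin lee_fin -mulr_suml -mulr_sumr sb expr2.
  move=> k _; rewrite /g; under eq_integral do rewrite EFinM.
  rewrite ge0_integralZl//; last 2 first.
  - exact/measurable_EFinP.
  - by rewrite lee_fin mulr_ge0// b0.
  rewrite integral_indic// setIT [RHS]EFinM; congr (_ * _)%E.
  apply: (etrans (lebesgue_measure_itv _)).
  by rewrite /= lte_fin grid_ltS -EFinD gridS.
apply: ge0_le_integral => //.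
- by move=> s _; rewrite lee_fin sqr_ge0.
- by apply/measurable_EFinP; apply: measurable_funX; exact: measurable_kernel_error.
- by apply: emeasurable_sum => k; exact: mg.
move=> s _; rewrite /g sumEFin lee_fin.
have [sT|sT] := boolP (s \in `]0, T]); last first.
  have js k : (k < n.+1)%N -> \1_(`]grid n k, grid n k.+1] : set R) s = 0 :> R.
    move=> kn; rewrite indicE mem_setE; case: (boolP (_ \in _)) => //.
    rewrite in_itv/= => /andP[h1 h2]; move: sT; rewrite in_itv/=.
    by rewrite (le_lt_trans (grid_ge0 n k) h1) (le_trans h2 (grid_leT kn)).
  rewrite /kernel_error big1 ?expr0n/= ?sumr_ge0// => k _; rewrite js// mulr0//.
pose a k := (w (grid n k) * Num.sqrt (beta s) - step_height T sigma beta (grid n k) (grid n k.+1))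
  * \1_(`]grid n k, grid n k.+1] : set R) s.
rewrite /kernel_error (eq_bigr (fun k : 'I_n.+1 => a k * \1_(`]grid n k, grid n k.+1] : set R) s)); last first.
  move=> k _; rewrite /a -mulrA; congr (_ * _).
  by rewrite indicE; case: (_ \in _); rewrite ?mulr1 ?mulr0.
apply: (@sqr_indicator_sum_le R n.+1 a b (fun k => \1_(`]grid n k, grid n k.+1] : set R) s) Q).
- move=> k kn; rewrite /a indicE mem_setE; case: (boolP (_ \in _)) => [|_]; last by rewrite mulr0 normr0 b0.
  rewrite in_itv/= mulr1 => /andP[h1 h2].
  have k0 := grid_ge0 n k; have kT := grid_leT kn.
  have /andP[b1 b2] := step_height_bounds sigma0 hbeta k0 (grid_ltS n k) kT.
  have c1 : q (grid n k) <= w (grid n k) * Num.sqrt (beta s).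
    rewrite ler_pM2l ?decay_gt0// ler_wsqrtr//.
    exact: (beta_mono hbeta k0 (ltW h1) (le_trans h2 kT)).
  have c2 : w (grid n k) * Num.sqrt (beta s) <= q (grid n k.+1).
    apply: ler_pM; [exact/ltW/decay_gt0|exact: sqrtr_ge0| |].
      exact: (decay_le sigma0 hbeta k0 (ltW (grid_ltS n k)) kT).
    by rewrite ler_wsqrtr// (beta_mono hbeta (le_trans k0 (ltW h1)) h2 kT).
  rewrite /b ler_norml; move: b1 b2 c1 c2.
  clear; move: (w _ * _) (step_height _ _ _ _ _) (q _) (q _) => x y z t *.
  by apply/andP; split; lra.
- by rewrite sb.
- by move=> k _; rewrite indicE; case: (_ \in _); [right|left].
- move=> k l _ _ kl; rewrite !indicE !mem_setE !in_itv/=.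
  have [klt|lkt|//] := ltngtP k l.
  + case: (boolP (s <= grid n k.+1)) => h; last by rewrite andbF mul0r.
    by rewrite [X in _ * (X && _)%:R]ltNge (le_trans h (grid_le n klt)) /= mulr0.
  + case: (boolP (s <= grid n l.+1)) => h; last by rewrite andbF mulr0.
    by rewrite [X in (X && _)%:R * _]ltNge (le_trans h (grid_le n lkt)) /= mul0r.
Qed.

(** On a solution path this recovers the Ito integral of the square root of beta. *)
Definition martingale_part (x : R -> R) (t : R) : R :=
  x t - x 0 - \int[leb]_(s in `[0, t]) (- (beta s / (2 * sigma ^+ 2)) * x s).

Let step_alg (ws wt d K om C dt xt J : R) :
  0 <= wt - ws - ws * d -> wt - ws - ws * d <= (wt - ws) * d -> d <= C * dt ->
  0 <= wt - ws -> 0 <= K -> 0 <= om -> `|xt| <= K -> `|J| <= om * d -> 0 <= ws ->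
  `|ws * (- (d * xt - J)) + (wt - ws) * xt| <= (wt - ws) * (K * (C * dt) + om).
Proof.
move=> h1 h2 h3 h4 K0 om0 hx hJ w0.
rewrite (_ : _ + _ = (wt - ws - ws * d) * xt + ws * J); last by ring.
rewrite (le_trans (ler_normD _ _))// mulrDr lerD// normrM.
  rewrite ger0_norm//; apply: (@le_trans _ _ (((wt - ws) * d) * K)); first exact: ler_pM.
  by rewrite -mulrA ler_wpM2l// mulrC ler_wpM2l.
rewrite ger0_norm//.
apply: (@le_trans _ _ (ws * (om * d))); first exact: ler_wpM2l.
rewrite mulrCA mulrC ler_wpM2r//.
by move: h1; rewrite subr_ge0.
Qed.

Let diff_alg (ws wt xs xt e : R) :
  wt * xt - ws * xs - ws * (xt - xs - e) = ws * e + (wt - ws) * xt.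
Proof. ring. Qed.

Let lo_alg (a b D : R) : a * (1 + D) <= b -> 0 <= b - a - a * D.
Proof. lra. Qed.

Let up_alg (a b D : R) : b * (1 + - D) <= a -> b - a - a * D <= (b - a) * D.
Proof. lra. Qed.

Let exp_lower (a b D : R) : 0 < a -> b = a * expR D -> a * (1 + D) <= b.
Proof. by move=> a0 ->; rewrite ler_pM2l// expR_ge1Dx. Qed.

(** Let d be the increment of the rate integral and J the integral of the rate against x t -
    x r. The left-hand side is (w_t - w_s - w_s d) x_t + w_s J; its first factor is of
    second order, 0 <= w_t - w_s - w_s d <= (w_t - w_s) d, and w_s d <= w_t - w_s. *)
Lemma decay_step_error (x : R -> R) (K om s t : R) :
  {within `[0, T], continuous x} -> 0 <= s -> s < t -> t <= T -> 0 <= om ->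
  (forall r, r \in `[0, T] -> `|x r| <= K) ->
  (forall r, r \in `[s, t] -> `|x t - x r| <= om) ->
  `|w t * x t - w s * x s - w s * (martingale_part x t - martingale_part x s)| <=
    (w t - w s) * (K * (beta T / (2 * sigma ^+ 2) * (t - s)) + om).
Proof.
move=> cx s0 st tT om0 hK hom.
have tI : t \in `[0, T] by rewrite in_itv/= tT (le_trans s0 (ltW st)).
have s20 : 0 < 2 * sigma ^+ 2 by rewrite mulr_gt0// exprn_gt0.
have /andP[_ h2] := rate_diff_bounds sigma0 hbeta s0 (ltW st) tT.
have hA := rate_diff sigma hbeta s0 (ltW st) tT.
have cb := @continuous_rate R T sigma beta hbeta.
have cbx : {within `[0, T], continuous (fun s => - (beta s / (2 * sigma ^+ 2)) * x s)}.
  apply/subspace_continuousP => y yI; apply: cvgM.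
    by apply: cvgN; move/subspace_continuousP : cb; apply.
  by move/subspace_continuousP : cx; apply.
have ib : leb.-integrable `]s, t] (EFin \o (fun s => beta s / (2 * sigma ^+ 2))).
  by apply: (continuous_segment_integrable cb) => //; exact: itv_sub.
have ibx : leb.-integrable `]s, t] (EFin \o (fun s => - (beta s / (2 * sigma ^+ 2)) * x s)).
  by apply: (continuous_segment_integrable cbx) => //; exact: itv_sub.
have ibt : leb.-integrable `]s, t] (EFin \o (fun s => (beta s / (2 * sigma ^+ 2)) * x t)).
  exact: (integrableZr _ (x t) ib).
pose J := \int[leb]_(r in `]s, t]) (beta r / (2 * sigma ^+ 2) * (x t - x r)).
set d := A t - A s in h2 hA.
have JE : \int[leb]_(r in `]s, t]) (- (beta r / (2 * sigma ^+ 2)) * x r) = - (d * x t - J).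
  rewrite hA -RintegralZr// /J.
  rewrite (_ : \int[leb]_(r in `]s, t]) (beta r / (2 * sigma ^+ 2) * (x t - x r)) =
     \int[leb]_(r in `]s, t]) (beta r / (2 * sigma ^+ 2) * x t) +
     \int[leb]_(r in `]s, t]) (- (beta r / (2 * sigma ^+ 2)) * x r)).
    by rewrite opprB addrAC subrr add0r.
  rewrite -RintegralD//; apply: eq_Rintegral => r _; ring.
have d0 : 0 <= d by rewrite subr_ge0; exact: (rate_le sigma0 hbeta s0 (ltW st) tT).
have ba r : r \in `]s, t] -> 0 <= beta r / (2 * sigma ^+ 2).
  rewrite in_itv/= => /andP[sr rt]; rewrite divr_ge0 ?(ltW s20)// ltW//.
  by apply: (schedule_gt0 hbeta); rewrite (le_trans s0 (ltW sr)) (le_trans rt).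
have hJ : `|J| <= om * d.
  have iJ : leb.-integrable `]s, t] (EFin \o (fun r => beta r / (2 * sigma ^+ 2) * (x t - x r))).
    rewrite (_ : _ \o _ = ((EFin \o (fun s => (beta s / (2 * sigma ^+ 2)) * x t)%R) \+
       (EFin \o (fun s => - (beta s / (2 * sigma ^+ 2)) * x s)%R))%E).
      exact: integrableD.
    by apply/funext => r /=; rewrite -EFinD; congr EFin; ring.
  apply: (le_trans (le_normr_Rintegral _ iJ)) => //.
  rewrite [leRHS]mulrC hA -RintegralZr//; apply: le_Rintegral => //.
  - exact: integrable_norm iJ.
  - exact: (integrableZr _ om ib).
  move=> r rI; have r0 := ba r rI; rewrite normrM ger0_norm//.
  rewrite ler_wpM2l// hom//; move: rI; rewrite /= !in_itv/= => /andP[h ->].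
  by rewrite (ltW h).
rewrite (_ : martingale_part x t - martingale_part x s =
   x t - x s - \int[leb]_(r in `]s, t]) (- (beta r / (2 * sigma ^+ 2)) * x r)); last first.
  rewrite -(Rintegral_segment_diff cbx s0 (ltW st) tT) /martingale_part.
  move: (\int[_]_(_ in _) _) (\int[_]_(_ in _) _) => I1 I2; ring.
rewrite JE.
rewrite diff_alg.
have wd : w t = w s * expR d by rewrite -expRD; congr expR; rewrite /d; ring.
have wd' : w s = w t * expR (- d) by rewrite -expRD; congr expR; rewrite /d; ring.
have ws0 := decay_gt0 T sigma beta s; have wt0 := decay_gt0 T sigma beta t.
have l1 := exp_lower ws0 wd; have l2 := exp_lower wt0 wd'.
have K0 : 0 <= K by rewrite (le_trans _ (hK _ tI)).
have rb : d <= beta T / (2 * sigma ^+ 2) * (t - s).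
  rewrite mulrAC ler_pdivlMr// mulrC (le_trans h2)// ler_wpM2r ?subr_ge0 ?(ltW st)//.
  exact: (beta_mono hbeta (le_trans s0 (ltW st)) tT).
have wst : 0 <= w t - w s by rewrite subr_ge0; exact: (decay_le sigma0 hbeta s0 (ltW st) tT).
exact: (step_alg (lo_alg l1) (up_alg l2) rb wst K0 om0 (hK _ tI) hJ (ltW ws0)).
Qed.

(** The discrete form of d (w x) = w dM along a continuous path; by [decay_step_error] the
    errors are small against the total variation of w, which is at most 1. *)
Lemma decay_sum_cvg (x : R -> R) : {within `[0, T], continuous x} ->
  (\sum_(k < n.+1) w (grid n k) * (martingale_part x (grid n k.+1) - martingale_part x (grid n k)))
    @[n --> \oo] --> x T - w 0 * x 0.
Proof.
move=> cx; apply/cvgrPdist_le => e e0.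
have [K hK] : exists K, forall r, r \in `[0, T] -> `|x r| <= K.
  have cnx : {within `[0, T], continuous (fun r => `|x r|)}.
    apply/subspace_continuousP => y yI; apply: (@cvg_norm _ R^o).
    by move/subspace_continuousP : cx; apply.
  by have [c _ hc] := EVT_max (ltW T0) cnx; exists `|x c|.
have e2 : 0 < e / 2 by rewrite divr_gt0.
have [eta eta0 heta] := heine_segment cx e2.
pose C := K * (beta T / (2 * sigma ^+ 2)).
have /cvgrPdist_lt/(_ _ eta0) [N1 _ h1] := cvg_mesh 1.
have /cvgrPdist_lt/(_ _ e2) [N2 _ h2] := cvg_mesh C.
exists (maxn N1 N2) => // n; rewrite /= geq_max => /andP[/h1 h1n /h2 h2n].
rewrite /= mul1r sub0r normrN gtr0_norm ?mesh_gt0// in h1n.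
have CD : C * (T / n.+1%:R) <= e / 2.
  by rewrite (le_trans (ler_norm _))//; move: h2n; rewrite /= sub0r normrN => /ltW.
have tel : x T - w 0 * x 0 =
    \sum_(k < n.+1) (w (grid n k.+1) * x (grid n k.+1) - w (grid n k) * x (grid n k)).
  rewrite -(big_mkord xpredT (fun k => w (grid n k.+1) * x (grid n k.+1) - w (grid n k) * x (grid n k))).
  rewrite (telescope_sumr (fun k => w (grid n k) * x (grid n k)) (leq0n _)) gridT grid0 decayT.
  by congr (_ - _); rewrite mul1r.
have telw : 1 - w 0 = \sum_(k < n.+1) (w (grid n k.+1) - w (grid n k)).
  rewrite -(big_mkord xpredT (fun k => w (grid n k.+1) - w (grid n k))).
  by rewrite (telescope_sumr (fun k => w (grid n k)) (leq0n _)) gridT grid0 decayT.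
rewrite tel -sumrB (le_trans (ler_norm_sum _ _ _))//.
apply: (@le_trans _ _ (\sum_(k < n.+1) (w (grid n k.+1) - w (grid n k)) * e)); last first.
  rewrite -mulr_suml -telw ler_piMl ?(ltW e0)// lerBlDr lerDl.
  exact/ltW/decay_gt0.
apply: ler_sum => k _.
have k0 := grid_ge0 n k; have kT := grid_leT (ltn_ord k); have kk := grid_ltS n k.
have err : forall r, r \in `[grid n k, grid n k.+1] -> `|x (grid n k.+1) - x r| <= e / 2.
  move=> r; rewrite in_itv/= => /andP[r1 r2].
  apply/ltW/heta; rewrite ?in_itv/=.
  - by rewrite kT (le_trans k0 (ltW kk)).
  - by rewrite (le_trans k0 r1) (le_trans r2 kT).
  - rewrite ger0_norm ?subr_ge0//; apply: le_lt_trans h1n.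
    by rewrite -(gridS n k) lerD2l lerN2.
apply: (le_trans (decay_step_error cx k0 kk kT (ltW e2) hK err)).
apply: ler_wpM2l; first by rewrite subr_ge0; exact: (decay_le sigma0 hbeta k0 (ltW kk) kT).
by rewrite gridS mulrA [leRHS]splitr lerD2r.
Qed.

End grid.

(** * Step integrals of Brownian motion *)

Definition step_tuple (Om : Type) (R : realType) (n : nat) (Z : R -> Om -> n.-tuple R)
  (u c : nat -> R) (m : nat) (w : Om) : n.-tuple R :=
  [tuple \sum_(k < m) c k * (tnth (Z (u k.+1) w) i - tnth (Z (u k) w) i) | i < n].

Lemma measurable_step_tuple dE (E : measurableType dE) (R : realType) (n : nat)
  (Z : R -> E -> n.-tuple R) (u c : nat -> R) (m : nat) :
  (forall k, (k <= m)%N -> measurable_fun [set: E] (Z (u k))) ->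
  measurable_fun [set: E] (step_tuple Z u c m).
Proof.
move=> mZ; apply/measurable_fun_tnthP => i.
have mZi k : (k <= m)%N -> measurable_fun [set: E] (fun w => tnth (Z (u k) w) i).
  by move=> km; apply: (measurableT_comp (measurable_tnth i)); exact: mZ.
rewrite (_ : _ \o _ = fun w => \sum_(k < m) c k * (tnth (Z (u k.+1) w) i - tnth (Z (u k) w) i)).
  apply: measurable_sum => k; apply: measurable_funM => //; apply: measurable_funB; apply: mZi => //.
  exact: ltnW.
by apply/funext => w; rewrite /= tnth_mktuple.
Qed.

Lemma step_tupleS (Om : Type) (R : realType) (n : nat) (Z : R -> Om -> n.-tuple R)
  (u c : nat -> R) (m : nat) (w : Om) :
  step_tuple Z u c m.+1 w =
  affine_tuple 1 (c m) (step_tuple Z u c m w, increment Z (u m) (u m.+1) w).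
Proof.
by apply: eq_from_tnth => i; rewrite !tnth_mktuple /= ?tnth_mktuple big_ord_recr/= mul1r.
Qed.

Section step_tuple_law.
Context dO (Omega : measurableType dO) (R : realType) (P : probability Omega R) (n : nat).
Context (B : R -> {RV P >-> n.-tuple R}) (hB : standard_brownian_motion B).

(** Read B u k as maps on Omega with the sigma-algebra generated by the process: they are
    measurable for it, hence so is the step integral. *)
Lemma process_sigma_step_tuple (J : set R) (u c : nat -> R) (m : nat) (A : set (n.-tuple R)) :
  (forall k, (k <= m)%N -> J (u k)) -> measurable A ->
  process_sigma J B (step_tuple B u c m @^-1` A).
Proof.
move=> Ju mA.
pose E := g_sigma_algebraType (\bigcup_(u in J) g_sigma_algebra_preimage (B u)).
have mB k : (k <= m)%N -> measurable_fun [set: E] (B (u k) : E -> n.-tuple R).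
  move=> km _ F mF; apply: sub_sigma_algebra; exists (u k); first exact: Ju.
  by exists F.
have := @measurable_step_tuple _ E R n (fun t => (B t : E -> n.-tuple R)) u c m mB.
by move=> /(_ measurableT A mA); rewrite setTI.
Qed.

Context (u c : nat -> R) (u0 : u 0%N = 0) (uS : forall k, u k < u k.+1).

Let ule k l : (k <= l)%N -> u k <= u l.
Proof.
move=> kl; have := @homo_leq _ u (fun a b => a <= b) (@lexx _ _) (@le_trans _ _).
by apply => // k'; exact/ltW/uS.
Qed.

Let u_ge0 k : 0 <= u k. Proof. by rewrite -u0 ule. Qed.

Definition step_tupleRV m : {RV P >-> n.-tuple R} :=
  measurable_map (@measurable_step_tuple _ Omega R n (fun t => B t) u c m
    (fun k _ => measurable_funPT (B (u k)))).

Lemma Rintegral_increment s t (phi : n.-tuple R -> R) : 0 <= s -> s < t ->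
  bounded_measurable phi ->
  \int[distribution P (incrementRV B s t)]_z phi z = \int[gaussian (Num.sqrt (t - s)) n]_z phi z.
Proof.
move=> s0 st bphi; congr fine; apply: eq_measure_integral => A mA _.
exact: (brownian_gaussian hB).
Qed.

(** Induction on the number of steps: each new increment is independent of the previous sum,
    and Gaussian laws convolve. The recursion on p adds up the variances. *)
Lemma step_tuple_law (m : nat) (p : nat -> R) (phi : n.-tuple R -> R) :
  (forall k, (k <= m)%N -> 0 < c k) ->
  (forall k, (0 < k <= m.+1)%N -> 0 < p k) -> p 0%N = 0 ->
  (forall k, (k <= m)%N -> p k.+1 ^+ 2 = p k ^+ 2 + c k ^+ 2 * (u k.+1 - u k)) ->
  bounded_measurable phi ->
  \int[P]_w phi (step_tuple B u c m.+1 w) = \int[gaussian (p m.+1) n]_x phi x.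
Proof.
move=> c_gt0 p_gt0 p0 pS.
have r_gt0 k : 0 < Num.sqrt (u k.+1 - u k) by rewrite sqrtr_gt0 subr_gt0.
have rE k : Num.sqrt (u k.+1 - u k) ^+ 2 = u k.+1 - u k.
  by rewrite sqr_sqrtr// subr_ge0 ltW.
elim: m phi c_gt0 p_gt0 pS => [|m IH] phi c_gt0 p_gt0 pS bphi.
  have p1 : p 1%N = c 0%N * Num.sqrt (u 1%N - u 0%N).
    apply/eqP; rewrite -(@eqrXn2 _ 2) ?ltW ?mulr_gt0 ?c_gt0 ?p_gt0//.
    by rewrite pS// p0 expr0n add0r exprMn rE.
  have bs k : bounded_measurable (fun x => phi (scale_tuple k x)).
    exact: (bounded_measurable_comp bphi (@measurable_scale_tuple R k n)).
  rewrite (Rintegral_gaussian_scale (p_gt0 1%N isT) bphi).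
  transitivity (\int[P]_w phi (scale_tuple (c 0%N) (incrementRV B (u 0%N) (u 1%N) w))).
    apply: eq_Rintegral => w _; congr phi; apply: eq_from_tnth => i.
    by rewrite !tnth_mktuple big_ord1.
  rewrite -(Rintegral_bd_distribution (incrementRV B (u 0%N) (u 1%N)) (bs _)).
  rewrite (Rintegral_increment (u_ge0 0) (uS 0) (bs _)) (Rintegral_gaussian_scale (r_gt0 _) (bs _)).
  apply: eq_Rintegral => x _; congr phi; apply: eq_from_tnth => i.
  by rewrite !tnth_mktuple p1 mulrA.
have bF := bounded_measurable_comp bphi (@measurable_affine_tuple R 1 (c m.+1) n).
have pE : p m.+2 ^+ 2 = p m.+1 ^+ 2 + (c m.+1 * Num.sqrt (u m.+2 - u m.+1)) ^+ 2.
  by rewrite pS// exprMn rE.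
rewrite -(gaussian_convolution (p_gt0 m.+1 (leqnSn _)) (r_gt0 m.+1) (c_gt0 m.+1 (leqnn _)) (p_gt0 m.+2 (leqnn _)) pE bphi).
have bG := bounded_Rintegral (gaussian (p m.+1) n) (gaussian (Num.sqrt (u m.+2 - u m.+1)) n) bF.
rewrite -(IH _ _ _ _ bG); last 3 first.
- by move=> k km; rewrite c_gt0// ltnW.
- by move=> k /andP[k0 km]; rewrite p_gt0// k0 ltnW.
- by move=> k km; rewrite pS// ltnW.
transitivity (\int[P]_w (phi \o @affine_tuple R 1 (c m.+1) n)
    (step_tupleRV m.+1 w, incrementRV B (u m.+1) (u m.+2) w)).
  by apply: eq_Rintegral => w _; rewrite /= -step_tupleS.
rewrite (Rintegral_independent _ bF); last first.
  move=> A A' mA mA'; rewrite setIC muleC.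
  apply: (brownian_independent hB (u_ge0 m.+1) (uS m.+1)).
    by exists A' => //; rewrite setTI.
  apply: process_sigma_step_tuple => // k km.
  by rewrite /= in_itv/= u_ge0 ule.
rewrite -(Rintegral_bd_distribution (step_tupleRV m.+1) bG).
apply: eq_Rintegral => x _.
exact: (Rintegral_increment (u_ge0 _) (uS _) (bounded_measurable_pair1 x bF)).
Qed.

End step_tuple_law.

(** * Limits in probability and laws *)

Section boxes.
Context (R : realType) (n : nat).

(** The open box of corner q is the increasing union of the boxes of corners q - 1 / k. *)
Lemma open_box_le (mu nu : probability (n.-tuple R) R) :
  (forall (q : 'I_n -> R) (e : R), 0 < e -> (mu (open_box (fun i => q i - e)%R) <= nu (open_box q))%E) ->
  forall q, (mu (open_box q) <= nu (open_box q))%E.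
Proof.
move=> H q; pose F k := open_box (fun i => q i - k.+1%:R^-1).
have mF k : measurable (F k) by exact: measurable_open_box.
have FE : open_box q = \bigcup_k F k.
  apply/seteqP; split => [x xq|x [k _ xk] i]; last first.
    by apply: (lt_le_trans (xk i)); rewrite gerBl invr_ge0.
  have [e e0 xe] : exists2 e, 0 < e & forall i, e <= q i - tnth x i.
    exists (\big[Order.min/1]_(i < n) (q i - tnth x i)).
      by apply: lt_bigmin => [|i _]; [exact: ltr01|rewrite subr_gt0; exact: xq].
    by move=> i; exact: bigmin_le.
  have [k ke] : exists k : nat, k.+1%:R^-1 < e.
    exists (Num.truncn e^-1); rewrite invf_plt ?posrE//; exact: truncnS_gt.
  exists k => // i; rewrite ltrBrDl -ltrBrDr (lt_le_trans ke)//.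
have ndF : nondecreasing_seq F.
  move=> k l kl; apply/subsetPset => x xk i; apply: (lt_le_trans (xk i)).
  by rewrite lerD2l lerN2 lef_pV2 ?posrE// ler_nat.
have : mu (F k) @[k --> \oo] --> mu (open_box q).
  by rewrite FE; apply: nondecreasing_cvg_mu => //; rewrite -FE; exact: measurable_open_box.
move=> /cvg_lim <-//; apply: lime_le; last by apply: nearW => k; apply: H; rewrite invr_gt0.
by apply: ereal_nondecreasing_is_cvgn => k l kl; apply: le_measure; rewrite ?inE//; exact/subsetPset/ndF.
Qed.

End boxes.

Lemma measurable_normr_ge d (T : measurableType d) (R : realType) (f : T -> R) (c : R) :
  measurable_fun [set: T] f -> measurable [set x | c <= `|f x|].
Proof.
move=> mf; rewrite -[X in measurable X]setTI; apply: measurable_fun_le => //.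
exact: (measurableT_comp (@normr_measurable R setT)).
Qed.

Section limit_law.
Context dO (Omega : measurableType dO) (R : realType) (P : probability Omega R) (n : nat).

Let box_shift (U V : {RV P >-> n.-tuple R}) (q : 'I_n -> R) (e r : R) :
  (forall i, P [set w | (e <= `|tnth (U w) i - tnth (V w) i|)%R] <= r%:E)%E ->
  (distribution P U (open_box (fun i => q i - e)%R) <= distribution P V (open_box q) + (r *+ n)%:E)%E.
Proof.
move=> bad; pose G i := [set w | e <= `|tnth (U w) i - tnth (V w) i|].
have mtn (W : {RV P >-> n.-tuple R}) i := measurable_coordinate W i.
have mG i : measurable (G i) by apply: measurable_normr_ge; exact: measurable_funB.
have mV : measurable (V @^-1` open_box q).
  by rewrite -[X in measurable X]setTI; apply: (measurable_funPT V) => //; exact: measurable_open_box.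
have sub : U @^-1` open_box (fun i => q i - e) `<=` V @^-1` open_box q `|` \big[setU/set0]_(i < n) G i.
  move=> w Uw; have [Vw|nV] := pselect (open_box q (V w)); first by left.
  right; move: nV => /existsNP[i /negP]; rewrite -leNgt => qV.
  rewrite (bigD1 i)//=; left => /=.
  have := Uw i; rewrite ltrBrDr => Uq.
  by rewrite /G /= distrC (le_trans _ (ler_norm _))// lerBrDr addrC ltW// (lt_le_trans Uq).
apply: (le_trans (le_measure P _ _ sub)); rewrite ?inE.
- by rewrite -[X in measurable X]setTI; apply: (measurable_funPT U) => //; exact: measurable_open_box.
- by apply: measurableU => //; exact: bigsetU_measurable.
apply: (le_trans (measureU2 _ _ _)) => //; first exact: bigsetU_measurable.
rewrite leeD2l// (_ : (r *+ n)%:E = \sum_(i < n) r%:E)%E; last by rewrite sumEFin sumr_const card_ord.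
suff [] : measurable (\big[setU/set0]_(i < n) G i) /\
    (P (\big[setU/set0]_(i < n) G i) <= \sum_(i < n) r%:E)%E by [].
apply: (@big_ind2 (set Omega) (\bar R) (fun A x => measurable A /\ (P A <= x)%E)).
- by rewrite measure0.
- move=> A x A' x' [mA Ax] [mA' Ax']; split; first exact: measurableU.
  by rewrite (le_trans (measureU2 _ _ _))// leeD.
- by move=> i _; split => //; exact: bad.
Qed.

(** If U lies in the box shifted by e and V m does not lie in the box, some coordinates of U
    and V m differ by at least e. With this inclusion in both directions, the two laws agree
    on open boxes when e and r tend to 0. *)
Lemma law_limit (U : {RV P >-> n.-tuple R}) (V : nat -> {RV P >-> n.-tuple R})
    (Q : probability (n.-tuple R) R) :
  (forall m A, measurable A -> distribution P (V m) A = Q A) ->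
  (forall e r : R, 0 < e -> 0 < r -> exists m, forall i,
    (P [set w | (e <= `|tnth (U w) i - tnth (V m w) i|)%R] <= r%:E)%E) ->
  forall A, measurable A -> distribution P U A = Q A.
Proof.
move=> VQ UV; apply: measure_open_box_unique => q; apply/eqP; rewrite eq_le.
have split_r (r : R) : 0 < r -> exists2 r', 0 < r' & r' *+ n <= r.
  move=> r0; exists (r / n.+1%:R); first by rewrite divr_gt0.
  rewrite -[_ *+ n]mulr_natr mulrAC ler_pdivrMr// ler_pM2l// ler_nat//.
apply/andP; split; move: q; apply: open_box_le => q e e0; apply/lee_addgt0Pr => r /split_r[r' r'0 rr'].
- have [m hm] := UV e r' e0 r'0.
  rewrite -(VQ m _ (measurable_open_box q)); apply: (le_trans (box_shift q hm)).
  by rewrite leeD2l// lee_fin.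
- have [m hm] := UV e r' e0 r'0.
  rewrite -(VQ m _ (measurable_open_box _)).
  have hm' i : (P [set w | (e <= `|tnth (V m w) i - tnth (U w) i|)%R] <= r'%:E)%E.
    by under eq_set do rewrite distrC; exact: hm.
  apply: (le_trans (box_shift q hm')); by rewrite leeD2l// lee_fin.
Qed.

Lemma chebyshev_sqnorm (f : Omega -> R) (e r : R) : 0 < e -> measurable_fun [set: Omega] f ->
  (sqnorm P f <= (r * e ^+ 2)%:E)%E -> (P [set w | (e <= `|f w|)%R] <= r%:E)%E.
Proof.
move=> e0 mf fr.
have mG := measurable_normr_ge e mf.
have e2 : 0 < e ^+ 2 by rewrite exprn_gt0.
rewrite -(lee_pmul2r (x := (e ^+ 2)%:E)) ?lte_fin// -EFinM (le_trans _ fr)//.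
rewrite muleC -[X in P X]setIT -integral_indic// -ge0_integralZl//; last 2 first.
- exact/measurable_EFinP.
- by rewrite lee_fin ltW.
apply: ge0_le_integral => //.
- by move=> w _; rewrite mule_ge0// lee_fin ltW.
- by apply: measurable_funeM; exact/measurable_EFinP.
- by apply/measurable_EFinP; exact: measurable_funX.
move=> w _; rewrite -EFinM lee_fin indicE; case: (boolP (_ \in _)) => [|_]; last by rewrite mulr0 sqr_ge0.
rewrite inE /= mulr1 => ew; rewrite -[leRHS]real_normK ?num_real//.
by rewrite lerXn2r ?nnegrE ?(ltW e0).
Qed.

(** Dominated convergence for the indicators of the deviation events. *)
Lemma ae_cvg_in_probability (Z : nat -> Omega -> R) (Y : Omega -> R) (e r : R) :
  0 < e -> 0 < r ->
  (forall m, measurable_fun [set: Omega] (Z m)) -> measurable_fun [set: Omega] Y ->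
  {ae P, forall w, Z m w @[m --> \oo] --> Y w} ->
  \forall m \near \oo, (P [set w | (e <= `|Y w - Z m w|)%R] <= r%:E)%E.
Proof.
move=> e0 r0 mZ mY ZY.
pose G m := [set w | e <= `|Y w - Z m w|].
have mG m : measurable (G m) by apply: measurable_normr_ge; exact: measurable_funB.
have : (\int[P]_w (\1_(G m) w)%:E)%E @[m --> \oo] --> (0 : \bar R).
  have [| | | | |_ _] := @dominated_convergence _ _ _ P setT measurableT
    (fun m w => (\1_(G m) w)%:E) (fun=> 0%E) (fun=> 1%E).
  - by move=> m; apply/measurable_EFinP; exact: measurable_indic.
  - exact: measurable_cst.
  - apply: filterS ZY => w Zw _; apply/fine_cvgP; split; first by apply: nearW.
    have /cvgrPdist_lt/(_ _ e0) Zw' := Zw.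
    apply/cvgrPdist_lt => t t0; apply: filterS Zw' => m /= wm.
    by rewrite indicE memNset ?subrr ?normr0// /G /=; apply/negP; rewrite -ltNge.
  - exact: (bounded_measurable_integrable P (bounded_measurable_cst Omega 1)).
  - by apply: nearW => w m _; rewrite /= lee_fin indicE; case: (_ \in _); rewrite ?normr1 ?normr0.
  by rewrite integral0.
move=> /(ereal_cvg0_le r0); apply: filterS => m.
by rewrite integral_indic// setIT.
Qed.

End limit_law.

(** * The law of the forward process *)

Lemma eq_probability_Rintegral d (E : measurableType d) (R : realType) (mu nu : probability E R) :
  (forall phi, bounded_measurable phi -> \int[mu]_x phi x = \int[nu]_x phi x) ->
  forall A, measurable A -> mu A = nu A.
Proof.
move=> H A mA; have := H _ (bounded_measurable_indic R mA).
rewrite !Rintegral_indic// => h.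
by rewrite -(fineK (fin_num_measure mu A mA)) h fineK// fin_num_measure.
Qed.

Lemma Rintegral_gaussian_scaleM (R : realType) (s b : R) n (f : n.-tuple R -> R) :
  0 < s -> 0 < b -> bounded_measurable f ->
  \int[gaussian (s * b) n]_x f x = \int[gaussian s n]_x f (scale_tuple b x).
Proof.
move=> s0 b0 bf.
have bs : bounded_measurable (fun x => f (scale_tuple b x)).
  exact: (bounded_measurable_comp bf (@measurable_scale_tuple R b n)).
rewrite (Rintegral_gaussian_scale (mulr_gt0 s0 b0) bf) (Rintegral_gaussian_scale s0 bs).
apply: eq_Rintegral => x _; congr f; apply: eq_from_tnth => i.
by rewrite !tnth_mktuple mulrA [b * s]mulrC.
Qed.

Section forward_process.
Context (R : realType) (d : nat) (sigma T : R) (sigma0 : 0 < sigma) (T0 : 0 < T).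
Context (beta : R -> R) (hbeta : noise_schedule T beta).
Context (dO : measure_display) (Omega : measurableType dO) (P : probability Omega R).
Context (B X : R -> {RV P >-> d.-tuple R}).
Context (hB : standard_brownian_motion B) (hX : forward_sde sigma T beta B X).
Context (hindep : independent_systems P (g_sigma_algebra_preimage (X 0))
       (process_sigma [set t : R | 0 <= t] B)).

Local Notation w := (decay T sigma beta).
Local Notation t_ := (grid T).
Local Notation c_ n := (fun k => step_height T sigma beta (grid T n k) (grid T n k.+1)).
Local Notation a := (w 0).
Local Notation b := (Num.sqrt (1 - w 0 ^+ 2)).

Lemma decay0_lt1 : a < 1.
Proof. by rewrite -(decayT T sigma beta); exact: (decay_lt sigma0 hbeta (lexx 0) T0 (lexx T)). Qed.

Lemma noise_gt0 : 0 < b.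
Proof.
rewrite sqrtr_gt0 subr_gt0 -(expr1n _ 2) ltrXn2r ?nnegrE ?ler01//; last exact: decay0_lt1.
exact/ltW/decay_gt0.
Qed.

Lemma signal_noise : a ^+ 2 + b ^+ 2 = 1.
Proof.
rewrite sqr_sqrtr; first by rewrite addrC subrK.
by rewrite ltW// -sqrtr_gt0 noise_gt0.
Qed.

(** Its law is the same for every n, see [discretized_law]. *)
Definition discretized (n : nat) : {RV P >-> d.-tuple R} := step_tupleRV B (t_ n) (c_ n) n.+1.

Let telescope_alg (v x y z : R) : v * (x - z) = v * (y - z) + v * (x - y).
Proof. ring. Qed.

Lemma discretized_law n (phi : d.-tuple R -> R) : bounded_measurable phi ->
  \int[P]_o phi (discretized n o) = \int[gaussian (sigma * b) d]_x phi x.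
Proof.
move=> bphi.
pose p k := sigma * Num.sqrt (w (t_ n k) ^+ 2 - w 0 ^+ 2).
have pT : p n.+1 = sigma * b by rewrite /p gridT decayT expr1n.
have dec k : (k <= n.+1)%N -> 0 <= w (t_ n k) ^+ 2 - w 0 ^+ 2.
  move=> kn; rewrite subr_ge0.
  exact: (decay_sqr_le sigma0 hbeta (lexx 0) (grid_ge0 T0 n k) (@grid_leT _ _ T0 n _ kn)).
have pE k : (k <= n.+1)%N -> p k ^+ 2 = sigma ^+ 2 * (w (t_ n k) ^+ 2 - w 0 ^+ 2).
  by move=> kn; rewrite /p exprMn (sqr_sqrtr (dec k kn)).
have p_gt0 k : (0 < k <= n.+1)%N -> 0 < p k.
  move=> /andP[k0 kn]; rewrite mulr_gt0// sqrtr_gt0 subr_gt0.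
  apply: (decay_sqr_lt sigma0 hbeta (lexx 0) _ (@grid_leT _ _ T0 n k kn)).
  by case: k k0 {kn} => // k _; rewrite (le_lt_trans (grid_ge0 T0 n k) (grid_ltS T0 n k)).
have p0 : p 0%N = 0 by rewrite /p grid0 subrr sqrtr0 mulr0.
clearbody p; rewrite -pT.
apply: (step_tuple_law hB (grid0 T n) (grid_ltS T0 n) _ p_gt0 p0 _ bphi).
- move=> k kn; exact: (step_height_gt0 sigma0 hbeta (grid_ge0 T0 n k) (grid_ltS T0 n k) (@grid_leT _ _ T0 n k.+1 kn)).
- move=> k kn; apply: (etrans (pE k.+1 kn)); apply: (etrans (telescope_alg _ _ (w (t_ n k) ^+ 2) _)).
  congr (_ + _); first exact/esym/(pE k)/leqW.
  exact/esym/(step_height_sqr sigma0 hbeta (grid_ge0 T0 n k) (grid_ltS T0 n k) (@grid_leT _ _ T0 n k.+1 kn)).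
Qed.

Definition discretized_terminal (n : nat) : {RV P >-> d.-tuple R} :=
  measurable_map (measurableT_comp (@measurable_affine_tuple R a 1 d)
    (measurable_pairRV (X 0) (discretized n))).

Lemma discretized_terminal_law (pi0 : probability (d.-tuple R) R) n (phi : d.-tuple R -> R) :
  (forall A, measurable A -> distribution P (X 0) A = pi0 A) ->
  bounded_measurable phi ->
  \int[P]_o phi (discretized_terminal n o) =
  \int[pi0]_x smoothing (gaussian sigma d) (@affine_tuple R a b d) phi x.
Proof.
move=> hX0 bphi.
have bF := bounded_measurable_comp bphi (@measurable_affine_tuple R a 1 d).
transitivity (\int[P]_o (phi \o @affine_tuple R a 1 d) (X 0 o, discretized n o)) => //.
rewrite (Rintegral_independent _ bF); last first.
  move=> A A' mA mA'; apply: hindep.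
    by exists A => //; rewrite setTI.
  by apply: process_sigma_step_tuple => // k _; exact: grid_ge0.
transitivity (\int[pi0]_x \int[distribution P (discretized n)]_z (phi \o @affine_tuple R a 1 d) (x, z)).
  by congr fine; apply: eq_measure_integral => A mA _; exact: hX0.
apply: eq_Rintegral => x _.
have bx := bounded_measurable_pair1 x bF.
rewrite (Rintegral_bd_distribution (discretized n) bx) (discretized_law n bx).
rewrite (Rintegral_gaussian_scaleM sigma0 noise_gt0 bx).
apply: eq_Rintegral => z _; congr phi; apply: eq_from_tnth => i.
by rewrite !tnth_mktuple /= ?tnth_mktuple mul1r.
Qed.

Section coordinate.
Context (i : 'I_d).

Lemma wiener_approx_brownian t : 0 <= t ->
  wiener_approx B i (fun o => tnth (B t o) i) (fun s => \1_(`]0, t] : set R) s).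
Proof.
move=> t0; have := @wiener_approx_elementary _ _ _ P d B i [:: (1, t)].
by congr wiener_approx; apply/funext => x; rewrite /path_sum /kernel_sum big_seq1/= ger0_norm// mul1r.
Qed.

Let cancel_alg (x0 j v : R) : v = x0 + j + v - x0 - j.
Proof. ring. Qed.

Lemma sde_integrals : exists J : R -> {RV P >-> R},
  (forall t, t \in `[0, T] -> is_ito_integral P (fun s o => tnth (B s o) i)
        (fun s => Num.sqrt (beta s)) t (J t)) /\
  (forall t, t \in `[0, T] ->
    {ae P, forall o, J t o = martingale_part sigma beta (fun s => tnth (X s o) i) t}).
Proof.
have /choice[J HJ] : forall t, exists I : {RV P >-> R}, t \in `[0, T] ->
   is_ito_integral P (fun s o => tnth (B s o) i) (fun s => Num.sqrt (beta s)) t I /\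
   {ae P, forall o, I o = martingale_part sigma beta (fun s => tnth (X s o) i) t}.
  move=> t; have [tT|tT] := boolP (t \in `[0, T]); last first.
    by exists (measurable_map (@measurable_cst _ _ Omega R setT 0)).
  have [I hI eI] := sde_equation hX tT i; exists I => _; split => //.
  by apply: filterS eI => o e; rewrite /martingale_part e; exact: cancel_alg.
by exists J; split=> t /HJ[].
Qed.

Let transformed (J : R -> {RV P >-> R}) n (o : Omega) : R :=
  \sum_(k < n.+1) w (t_ n k) * (J (t_ n k.+1) o - J (t_ n k) o).

Let measurable_transformed J n : measurable_fun [set: Omega] (transformed J n).
Proof.
apply: measurable_sum => k; apply: measurable_funM => //; apply: measurable_funB; exact: measurable_funPT.
Qed.

Let sqnorm_transformed (J : R -> {RV P >-> R}) n :
  (forall t, t \in `[0, T] -> is_ito_integral P (fun s o => tnth (B s o) i)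
        (fun s => Num.sqrt (beta s)) t (J t)) ->
  (sqnorm P (fun o => transformed J n o - tnth (discretized n o) i)%R <=
   (4 * normal_variance R * ((ito_weight T sigma beta T - ito_weight T sigma beta 0) ^+ 2 * (T / n.+1%:R)))%:E)%E.
Proof.
move=> HJ.
pose Jk k (o : Omega) := w (t_ n k) * (J (t_ n k.+1) o + -1 * J (t_ n k) o) +
   -1 * (c_ n k * (tnth (B (t_ n k.+1) o) i + -1 * tnth (B (t_ n k) o) i)).
pose K (t s : R) := \1_(`]0, t] : set R) s : R.
pose g s := Num.sqrt (beta s).
pose hk k (s : measurableTypeR R) := w (t_ n k) * (g s * K (t_ n k.+1) s + -1 * (g s * K (t_ n k) s)) +
   -1 * (c_ n k * (K (t_ n k.+1) s + -1 * K (t_ n k) s)).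
have wJ k : (k <= n.+1)%N -> wiener_approx B i (J (t_ n k)) (fun s => g s * K (t_ n k) s).
  move=> kn; apply: (ito_wiener_approx (grid_ge0 T0 n k) (grid_leT T0 kn)).
  - exact: measurable_sqrt_beta hbeta.
  - exact: measurable_funPT.
  - exact/HJ/grid_mem.
have wB k : wiener_approx B i (fun o => tnth (B (t_ n k) o) i) (K (t_ n k)).
  exact: wiener_approx_brownian (grid_ge0 T0 n k).
have wk k : (k < n.+1)%N -> wiener_approx B i (Jk k) (hk k).
  move=> kn; apply: wiener_approxD; first apply: wiener_approxZ.
    by apply: wiener_approxD; [exact: wJ|apply: wiener_approxZ; exact/wJ/ltnW].
  do 2 apply: wiener_approxZ; apply: wiener_approxD; [exact: wB|apply: wiener_approxZ; exact: wB].
have := wiener_approx_bound hB (wiener_approx_sum wk).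
rewrite (_ : (fun o => \sum_(k < n.+1) Jk k o) =
  (fun o => transformed J n o - tnth (discretized n o) i)); last first.
  apply/funext => o; rewrite /transformed /discretized /= tnth_mktuple -sumrB.
  by apply: eq_bigr => k _; rewrite /Jk !mulN1r.
rewrite (_ : (fun s => \sum_(k < n.+1) hk k s) = kernel_error T sigma beta n); last first.
  apply/funext => s; apply: eq_bigr => k _.
  rewrite /hk !mulN1r -(indic_itv_diff s (grid_ge0 T0 n k) (ltW (grid_ltS T0 n k))).
  by rewrite -/(K _ _) -/(K _ _) -mulrBr mulrA -mulrBl.
move=> /le_trans; apply; rewrite [leRHS]EFinM; apply: lee_wpmul2l.
  by rewrite lee_fin mulr_ge0// normal_variance_ge0.
exact: sqnorm_kernel_error.
Qed.
Let transformed_cvg (J : R -> {RV P >-> R}) :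
  (forall t, t \in `[0, T] ->
    {ae P, forall o, J t o = martingale_part sigma beta (fun s => tnth (X s o) i) t}) ->
  {ae P, forall o, transformed J n o @[n --> \oo] --> tnth (X T o) i - a * tnth (X 0 o) i}.
Proof.
move=> HJ.
have : {ae P, forall o, forall n k, (k <= n.+1)%N ->
    J (t_ n k) o = martingale_part sigma beta (fun s => tnth (X s o) i) (t_ n k)}.
  apply/ae_foralln => n; apply/ae_foralln => k.
  have [kn|kn] := boolP (k <= n.+1)%N; last by apply: aeW => o /negP.
  by apply: filterS (HJ _ (grid_mem T0 kn)) => o h _.
move: (sde_continuous hX); apply: filterS2 => o cx eJ.
rewrite (_ : (fun n => _) = (fun n => \sum_(k < n.+1) w (t_ n k) *
   (martingale_part sigma beta (fun s => tnth (X s o) i) (t_ n k.+1) -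
    martingale_part sigma beta (fun s => tnth (X s o) i) (t_ n k)))); last first.
  by apply/funext => n; apply: eq_bigr => k _; rewrite !eJ// ltnW.
exact: (decay_sum_cvg T0 sigma0 hbeta (cx i)).
Qed.

Let split_alg (x y z h : R) : x - (y + 1 * h) = (x - y - z) + (z - h).
Proof. ring. Qed.

(** Compare through Z = sum_k w_k (I_(k+1) - I_k): almost surely Z tends to X_T - w_0 X_0 by
    [decay_sum_cvg], and the mean square of Z minus the discretized noise is at most a
    multiple of the mesh by the Wiener isometry. *)
Lemma discretized_terminal_in_probability (e r : R) : 0 < e -> 0 < r ->
  \forall n \near \oo,
   (P [set o | (e <= `|tnth (X T o) i - tnth (discretized_terminal n o) i|)%R] <= r%:E)%E.
Proof.
move=> e0 r0; have [J [HJ1 HJ2]] := sde_integrals.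
have e2 : 0 < e / 2 by rewrite divr_gt0.
have r2 : 0 < r / 2 by rewrite divr_gt0.
have mX t := measurable_coordinate (X t) i.
have mH n := measurable_coordinate (discretized n) i.
have mY : measurable_fun [set: Omega] (fun o => tnth (X T o) i - a * tnth (X 0 o) i).
  by apply: measurable_funB => //; exact: measurable_funM.
have near1 := ae_cvg_in_probability e2 r2 (measurable_transformed J) mY (transformed_cvg HJ2).
pose C := 4 * normal_variance R * (ito_weight T sigma beta T - ito_weight T sigma beta 0) ^+ 2.
have r3 : 0 < r / 2 * (e / 2) ^+ 2 by rewrite mulr_gt0// exprn_gt0.
have := @cvg_mesh R T C; move/cvgrPdist_lt/(_ _ r3); move: near1.
apply: filterS2 => n h1 h2.
have {}h2 : (P [set o | (e / 2 <= `|transformed J n o - tnth (discretized n o) i|)%R] <= (r / 2)%:E)%E.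
  apply: chebyshev_sqnorm => //; first exact: measurable_funB.
  apply: (le_trans (sqnorm_transformed n HJ1)); rewrite lee_fin mulrA ltW//.
  by apply: le_lt_trans h2; rewrite sub0r normrN ler_norm.
(* a deviation of e forces a deviation of e / 2 from the intermediate variable on one side *)
pose F1 := [set o | e / 2 <= `|tnth (X T o) i - a * tnth (X 0 o) i - transformed J n o|].
pose F2 := [set o | e / 2 <= `|transformed J n o - tnth (discretized n o) i|].
have mF1 : measurable F1 by apply: measurable_normr_ge; exact: measurable_funB.
have mF2 : measurable F2 by apply: measurable_normr_ge; exact: measurable_funB.
apply: (@le_trans _ _ (P (F1 `|` F2))).
  apply: le_measure; rewrite ?inE.
  - apply: measurable_normr_ge; apply: measurable_funB => //; exact: measurable_coordinate.
  - exact: measurableU.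
  move=> o /=; rewrite tnth_mktuple /= (split_alg _ _ (transformed J n o)) => eo.
  rewrite /F1 /F2 /=; apply/orP; rewrite -[_ || _]negbK negb_or -!ltNge; apply/negP => /andP[l1 l2].
  have := lt_le_trans (ltrD l1 l2) (le_refl _).
  by rewrite -splitr ltNge (le_trans eo (ler_normD _ _)).
apply: (le_trans (measureU2 _ mF1 mF2)); rewrite [r in leRHS]splitr EFinD leeD//.
Qed.
End coordinate.

(** The variables [discretized_terminal n] all have the law of a x + b z under the product
    of pi0 and the Gaussian measure, and they tend to X_T in probability. *)
Lemma terminal_law (pi0 : probability (d.-tuple R) R) (phi : d.-tuple R -> R) :
  (forall A, measurable A -> distribution P (X 0) A = pi0 A) ->
  bounded_measurable phi ->
  \int[distribution P (X T)]_x phi x =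
  \int[pi0]_x smoothing (gaussian sigma d) (@affine_tuple R a b d) phi x.
Proof.
move=> hX0 bphi.
pose Q := distribution (pi0 \x gaussian sigma d)%E (measurable_map (@measurable_affine_tuple R a b d)).
have QE f : bounded_measurable f ->
    \int[Q]_x f x = \int[pi0]_x smoothing (gaussian sigma d) (@affine_tuple R a b d) f x.
  move=> bf; rewrite (Rintegral_bd_distribution _ bf).
  exact: (Rintegral_fubini _ _ (bounded_measurable_comp bf (@measurable_affine_tuple R a b d))).
rewrite -(QE _ bphi); congr fine; apply: eq_measure_integral => A mA _.
apply: (@law_limit _ _ _ P d (X T) discretized_terminal Q) => //.
- move=> n; apply: eq_probability_Rintegral => f bf.
  by rewrite (Rintegral_bd_distribution _ bf) QE// (discretized_terminal_law n hX0 bf).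
- move=> e r e0 r0.
  have [N _ h] := filter_forall _ (fun i => discretized_terminal_in_probability i e0 r0).
  by exists N => i; apply: (h N) => /=.
Qed.

End forward_process.

Theorem lemmaB1 (R : realType) (d : nat) (hd : (1 <= d)%N)
    (sigma T : R) (hsigma : 0 < sigma) (hT : 0 < T)
    (pi_data : probability (d.-tuple R) R)
    (hdata : pi_data `<< gaussian sigma d)
    (beta : R -> R) (hbeta : noise_schedule T beta)
    (dO : measure_display) (Omega : measurableType dO)
    (P : probability Omega R)
    (B X : R -> {RV P >-> d.-tuple R})
    (hB : standard_brownian_motion B)
    (hX0 : forall A : set (d.-tuple R), measurable A ->
       distribution P (X 0) A = pi_data A)
    (hindep : independent_systems P (g_sigma_algebra_preimage (X 0))
       (process_sigma [set t : R | 0 <= t] B))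
    (hX : forward_sde sigma T beta B X) :
  (KL (distribution P (X T)) (gaussian sigma d)
   <= KL pi_data (gaussian sigma d)
      * (expR (- (1 / sigma ^+ 2)
           * \int[lebesgue_measure]_(s in `[0, T]) beta s))%:E)%E.
Proof.
have a0 := decay_gt0 T sigma beta 0.
rewrite mulNr -(decay0 hsigma hbeta) -[decay _ _ _ _ ^+ 2]invrK.
apply: (@KL_contraction _ _ R pi_data (distribution P (X T)) (gaussian sigma d)
  (@affine_tuple R (decay T sigma beta 0) (Num.sqrt (1 - decay T sigma beta 0 ^+ 2)) d)).
- by rewrite invr_gt0 exprn_gt0.
- exact: measurable_affine_tuple.
- apply: gaussian_exp_contractive => //; first exact: noise_gt0.
  exact: signal_noise.
- by move=> phi bphi; exact: (terminal_law hsigma hT hbeta hB hX hindep hX0 bphi).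
Qed.
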